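(* Given a $K$-annotated database $(D,\nu)$, a semiring $K$-aggregate query $\gamma=\pi_{X_n}^{\oplus_n}\cdots\pi_{X_1}^{\oplus_1}{\Join^{\otimes}}\, q$, and a project-connex join tree $(T,\mathbf b,\mathbf a)$ of $\gamma$, the evaluation result $\gamma\langle D,\nu\rangle$ admits a constant delay enumeration after a linear pre-processing. If $X_n=\emptyset$, the evaluation result can be obtained in time $O\big(|\gamma|\cdot\|D\|\big)$ in combined complexity.
   Context: Databases. A relational schema $\Sigma$ is a finite set of relation names, each with an arity. An atom is $R(\bar t)$ with $\bar t$ a tuple of variables and constants of length $\mathrm{arity}(R)$; a fact is an atom with only constants; a database is a finite set of facts. $\mathrm{vars}(\cdot)$ denotes the set of variables occurring in an object. $|D|=\sum_{R\in\Sigma}\sum_{R(\bar c)\in D}\mathrm{arity}(R)$ and $\|D\| = \max_{R\in\Sigma}\sum_{R(\bar c)\in D}\mathrm{arity}(R)$. A $K$-annotated database is a pair $(D,\nu)$ with $D$ a database and $\nu:D\to K$. Aggregate queries. A $K$-aggregate query is $\gamma=\pi_{X_n}^{\oplus_n}\cdots\pi_{X_1}^{\oplus_1}{\Join^{\otimes}}q$ with $q$ a finite set of atoms, $X_n\subsetneq\cdots\subsetneq X_1\subsetneq\mathrm{vars}(q)$, and $\oplus_i,\otimes$ commutative monoid operations on $K$. $|q|$ is the sum of arities of the atoms of $q$ and $|\gamma|=|q|+\sum_i|X_i|$. Semantics: for $q=\{\alpha_1,\dots,\alpha_\ell\}$, ${\Join^\otimes}q\langle D,\nu\rangle$ is the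 set of pairs $(h,\nu(h(\alpha_1))\otimes\cdots\otimes\nu(h(\alpha_\ell)))$ where $h$ ranges over the homomorphisms $q\to D$ fixing constants; and $(\pi_Y^\oplus\gamma')\langle D,\nu\rangle$ is the set of pairs $(f,n)$, $f:Y\to\mathrm{Const}$, such that $S_f=\{(f',n')\in\gamma'\langle D,\nu\rangle : f'|_Y=f\}$ is non-empty and $n$ is the $\oplus$-sum (with multiplicities) of all $n'$ over $(f',n')\in S_f$. $\gamma$ is a semiring $K$-aggregate query if $(K,\oplus_i,\otimes)$ is a commutative semiring for every $i$. A commutative semiring $(K,\oplus,\otimes)$: $(K,\oplus)$ and $(K,\otimes)$ are commutative monoids, $\otimes$ distributes over $\oplus$, and $a\otimes 0_\oplus=0_\oplus$ for all $a$. Tree decompositions. The underlying hypergraph of $\gamma$ has vertices $\mathrm{vars}(q)$ and hyperedges $\{\mathrm{vars}(\alpha):\alpha\in q\}$. A (generalized hyper-)tree decomposition of a hypergraph $G$ is $(T,\mathbf b,\mathbf a)$ with $T$ a tree, $\mathbf b:V(T)\to2^{V(G)}$, $\mathbf a:V(T)\to2^{E(G)}$ such that (a) every $e\in E(G)$ is contained in some $\mathbf b(v)$; (b) for each $x\in V(G)$, $\{t: x\in\mathbf b(t)\}$ is connected in $T$; (c) $\mathbf b(v)\subseteq\bigcup\mathbf a(v)$ for all $v$. Its width is $\max_v|\mathbf a(v)|$. A join tree of $q$ is a tree decomposition of width $1$ together with a witnessing bijection $\phi:V(T)\to q$ such that $\mathbf a(v)=\{\mathrm{vars}(\phi(v))\}$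 and $\mathbf b(v)=\mathrm{vars}(\phi(v))$ for every $v$. A witness subtree for $X$ is a connected subtree $T'$ with $\bigcup_{v\in V(T')}\mathbf b(v)=X$ (empty tree if $X=\emptyset$). A decomposition is project-connex for $\gamma$ if there are witness subtrees $T_i$ for $X_i$ ($i=1,\dots,n$) with $V(T_{i+1})\subseteq V(T_i)$ for $i<n$; a given project-connex decomposition comes with its witness subtrees. Complexity. The model is the RAM with unit-cost arithmetic and unit-cost semiring operations, memory initialised to $\bot$, and $d$-ary arrays (for every fixed $d$) indexed by constants with constant-time access. Constant delay enumeration after a linear pre-processing means: an algorithm which, in data complexity (i.e. for fixed query), performs a pre-processing in time $O(|D|)$ building a data structure, and then enumerates all answers in $\gamma\langle D,\nu\rangle$ one by one without repetition, with time between consecutive answers independent of the size of the database. Combined complexity: both query and database are part of the input.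
   Formalization: For the time bound O(|γ|·‖D‖), all atoms of q are assumed to have positive arity: nullary atoms count 0 in |γ| and ‖D‖, so A(x),B_1(),...,B_k() with |γ|=‖D‖=1 would violate it; O(f) is read as c·(f+1). *)

(* Defs.v *)
From HB Require Import structures.
From Stdlib Require List.
From mathcomp Require Import all_boot.

Set Implicit Arguments.
Unset Strict Implicit.
Unset Printing Implicit Defensive.

(** * Annotated databases and aggregate queries *)

Record schema := Schema { relname :> finType; arity : relname -> nat }.

(* The type [V] of variables is finite because only those of one query matter;
   they need not all occur in the query. *)
Definition atom (S : schema) (V : finType) (C : eqType) : eqType :=
  (S * seq (V + C))%type.
Definition fact (S : schema) (C : eqType) : eqType := (S * seq C)%type.

(* A finite set of facts is given by a duplicate-free listing, which is also
   the order in which the machine finds the facts in its memory. *)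
Record database (S : schema) (C : eqType) := Database {
  facts :> seq (fact S C);
  facts_uniq : uniq facts;
  facts_arity : all (fun f => size f.2 == arity f.1) facts }.

Record cmonoid (K : Type) := CMonoid {
  cm_one : K;
  cm_op :> Monoid.com_law cm_one }.

Definition avars (S : schema) (V : finType) (C : eqType) (a : atom S V C) :
    {set V} :=
  [set x | inl x \in a.2].

Definition qvars (S : schema) (V : finType) (C : eqType)
    (q : seq (atom S V C)) : {set V} :=
  \bigcup_(a <- q) avars a.

(* [steps] is [:: (op_1, X_1); ...; (op_n, X_n)], with op_1 applied first. *)
Record query (S : schema) (V : finType) (C : eqType) (K : Type) := Query {
  atoms : seq (atom S V C);
  mul : cmonoid K;
  steps : seq (cmonoid K * {set V});
  atoms_uniq : uniq atoms;
  atoms_arity : all (fun a => size a.2 == arity a.1) atoms;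
  steps_chain :
    path (fun A B : {set V} => B \proper A) (qvars atoms) (unzip2 steps) }.

Section Queries.
Context (S : schema) (V : finType) (C : eqType) (K : Type).
Implicit Types (D : database S C) (nu : fact S C -> K) (g : query S V C K).

Definition db_size D : nat :=
  \sum_(R : S) \sum_(f <- D | f.1 == R) arity f.1.

Definition db_norm D : nat :=
  \max_(R : S) \sum_(f <- D | f.1 == R) arity f.1.

Definition query_size g : nat :=
  \sum_(a <- atoms g) arity a.1 + \sum_(s <- steps g) #|s.2|.

(* X_n, with the convention X_0 = vars(q). *)
Definition free_vars g : {set V} := last (qvars (atoms g)) (unzip2 (steps g)).

Definition semiring_laws (plus times : cmonoid K) : Prop :=
  [/\ left_distributive times plus, right_distributive times plus
    & right_zero (cm_one plus) times].

Definition semiring_query g : Prop :=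
  forall s, List.In s (steps g) -> semiring_laws s.1 (mul g).

(* A map from a subset of V to C; it is [None] outside its domain. *)
Definition assignment := {ffun V -> option C}.

Definition adom (h : assignment) : {set V} := [set x | h x != None].

Definition restrict (X : {set V}) (h : assignment) : assignment :=
  [ffun x => if x \in X then h x else None].

Definition term_val (h : assignment) (t : V + C) : option C :=
  match t with inl x => h x | inr c => Some c end.

(* Only used when vars(a) is included in the domain of h, in which case
   [pmap] drops no term. *)
Definition apply_atom (h : assignment) (a : atom S V C) : fact S C :=
  (a.1, pmap (term_val h) a.2).

Definition homomorphism (q : seq (atom S V C)) D (h : assignment) : Prop :=
  adom h = qvars q /\ all (fun a => apply_atom h a \in facts D) q.

Definition answer := (assignment * K)%type.

Definition sem_join (times : cmonoid K) (q : seq (atom S V C)) D nu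
    (p : answer) : Prop :=
  homomorphism q D p.1 /\
  p.2 = \big[times/cm_one times]_(a <- q) nu (apply_atom p.1 a).

(* [l] lists without repetition the set S_f, for f = p.1. *)
Definition sem_proj (plus : cmonoid K) (Y : {set V}) (A : answer -> Prop)
    (p : answer) : Prop :=
  exists l : seq answer,
    [/\ List.NoDup l,
        forall p', List.In p' l <-> A p' /\ restrict Y p'.1 = p.1,
        l <> [::]
      & p.2 = \big[plus/cm_one plus]_(p' <- l) p'.2].

Definition sem g D nu : answer -> Prop :=
  foldl (fun A s => sem_proj s.1 s.2 A) (sem_join (mul g) (atoms g) D nu)
    (steps g).

(** * Join trees *)

Definition connected (N : finType) (e : rel N) (A : {set N}) : Prop :=
  {in A &, forall u v,
    connect [rel x y | [&& x \in A, y \in A & e x y]] u v}.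

Definition is_tree (N : finType) (e : rel N) : Prop :=
  [/\ 0 < #|N|, symmetric e, irreflexive e, connected e [set: N]
    & forall p : seq N, ucycle e p -> size p <= 2].

Definition hyperedges g : {set {set V}} :=
  [set:: [seq avars a | a <- atoms g]].

Record decomposition := Decomposition {
  node : finType;
  edge : rel node;
  bag : node -> {set V};
  cover : node -> {set {set V}} }.

Definition tree_decomposition g (T : decomposition) : Prop :=
  [/\ is_tree (@edge T),
      forall v : node T,
        bag v \subset qvars (atoms g) /\ cover v \subset hyperedges g,
      forall E, E \in hyperedges g -> exists v : node T, E \subset bag v,
      forall x, x \in qvars (atoms g) ->
        connected (@edge T) [set v | x \in bag v]
    & forall v : node T, bag v \subset \bigcup_(E in cover v) E].

Definition width (T : decomposition) : nat := \max_(v : node T) #|cover v|.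

Definition join_tree g (T : decomposition) (phi : node T -> atom S V C) :
    Prop :=
  [/\ tree_decomposition g T, width T = 1,
      injective phi,
      forall a, a \in atoms g <-> exists v, phi v = a
    & forall v, cover v = [set avars (phi v)] /\ bag v = avars (phi v)].

(* The empty subtree is allowed, and witnesses the empty set. *)
Definition witness_subtree (T : decomposition) (X : {set V})
    (W : {set node T}) : Prop :=
  connected (@edge T) W /\ \bigcup_(v in W) bag v = X.

(* [W] is the sequence of node sets V(T_1), ..., V(T_n). *)
Definition project_connex g (T : decomposition) (W : seq {set node T}) : Prop :=
  [/\ size W = size (steps g),
      forall i s A, onth (steps g) i = Some s -> onth W i = Some A ->
        witness_subtree s.2 A
    & sorted (fun A B : {set node T} => B \subset A) W].

Record connex_join_tree g := ConnexJoinTree {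
  jt :> decomposition;
  jt_atom : node jt -> atom S V C;
  jt_witness : seq {set node jt};
  jt_join : join_tree g jt_atom;
  jt_connex : project_connex g jt_witness }.

End Queries.

(** * The random access machine *)

(* The input arrays are described at [init_mem], the output ones at
   [shows_answer]; [Work k] are the other arrays of a program. *)
Inductive array :=
  | ARelArity | ANumFacts | AFact | AAnnot
  | ANumAtoms | AAtomRel | ATermVar | ATermCst
  | ANumSteps | AStepCard | AStepVar
  | ANodeAtom | ANodeDeg | ANodeNbr | ANodeLevel
  | AOutFlag | AOutVar | AOutVal
  | Work of nat.

Definition array_eq_dec : comparable array.
Proof. by move=> x y; rewrite /decidable; do 2! decide equality. Defined.
HB.instance Definition _ := hasDecEq.Build array (compareP array_eq_dec).

(* In [STimes e1 e2] and [SPlus e e1 e2] the two last arguments are elements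
   of the semiring; the value i of [e] selects the operation op_(i+1) of the
   query.  There is no test on semiring elements. *)
Inductive expr :=
  | Lit of nat
  | Read of array & seq expr
  | IsBot of expr
  | Eq of expr & expr
  | Le of expr & expr
  | Add of expr & expr
  | Sub of expr & expr
  | Mul of expr & expr
  | Div of expr & expr
  | STimes of expr & expr
  | SOne
  | SPlus of expr & expr & expr
  | SZero of expr.

Inductive cmd :=
  | Skip
  | Assign of array & seq expr & expr
  | Seq of cmd & cmd
  | If of expr & cmd & cmd
  | While of expr & cmd.

Section Machine.
Context (C : eqType) (K : Type).

Inductive word := Bot | Num of nat | Cst of C | Val of K.

(* Arrays are indexed by tuples of numbers and constants.  The dimension of
   each access is fixed by the program text. *)
Definition key : eqType := (nat + C)%type.

Definition to_key (w : word) : option key :=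
  match w with Num n => Some (inl n) | Cst c => Some (inr c) | _ => None end.

Fixpoint to_keys (ws : seq word) : option (seq key) :=
  if ws isn't w :: ws' then Some [::] else
  if to_key w is Some k then omap (cons k) (to_keys ws') else None.

Definition mem := array -> seq key -> word.

Definition update (m : mem) (a : array) (ks : seq key) (w : word) : mem :=
  fun a' ks' => if (a' == a) && (ks' == ks) then w else m a' ks'.

Context (times : cmonoid K) (plus : seq (cmonoid K)).

Definition arith (op : nat -> nat -> nat) (w1 w2 : word) : word :=
  if (w1, w2) is (Num n1, Num n2) then Num (op n1 n2) else Bot.

(* Ill-typed expressions evaluate to bottom. *)
Fixpoint eval (m : mem) (e : expr) : word :=
  match e with
  | Lit n => Num n
  | Read a es =>
      if to_keys [seq eval m e' | e' <- es] is Some ks then m a ks else Bot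
  | IsBot e1 => Num (if eval m e1 is Bot then 1 else 0)
  | Eq e1 e2 =>
      match to_key (eval m e1), to_key (eval m e2) with
      | Some k1, Some k2 => Num (k1 == k2)
      | _, _ => Bot
      end
  | Le e1 e2 => arith (fun n1 n2 => n1 <= n2 : nat) (eval m e1) (eval m e2)
  | Add e1 e2 => arith addn (eval m e1) (eval m e2)
  | Sub e1 e2 => arith subn (eval m e1) (eval m e2)
  | Mul e1 e2 => arith muln (eval m e1) (eval m e2)
  | Div e1 e2 => arith divn (eval m e1) (eval m e2)
  | STimes e1 e2 =>
      if (eval m e1, eval m e2) is (Val x, Val y) then Val (times x y) else Bot
  | SOne => Val (cm_one times)
  | SPlus e0 e1 e2 =>
      match eval m e0, eval m e1, eval m e2 with
      | Num i, Val x, Val y =>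
          if onth plus i is Some op then Val (op x y) else Bot
      | _, _, _ => Bot
      end
  | SZero e0 =>
      if eval m e0 is Num i then
        if onth plus i is Some op then Val (cm_one op) else Bot
      else Bot
  end.

Definition holds (m : mem) (e : expr) : bool :=
  if eval m e is Num n.+1 then true else false.

(* [exec p m t m']: from memory m, p halts after t steps with memory m'.
   Every assignment and every test is one step: the expressions of a program
   have bounded size, so this is unit cost per operation up to a factor that
   depends on the program only. *)
Inductive exec : cmd -> mem -> nat -> mem -> Prop :=
  | ExecSkip m : exec Skip m 0 m
  | ExecAssign m a es e ks :
      to_keys [seq eval m e' | e' <- es] = Some ks ->
      exec (Assign a es e) m 1 (update m a ks (eval m e))
  | ExecSeq m1 m2 m3 t1 t2 p1 p2 :
      exec p1 m1 t1 m2 -> exec p2 m2 t2 m3 ->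
      exec (Seq p1 p2) m1 (t1 + t2) m3
  | ExecIf m m' t e p1 p2 :
      exec (if holds m e then p1 else p2) m t m' ->
      exec (If e p1 p2) m t.+1 m'
  | ExecWhileStop m e p :
      ~~ holds m e -> exec (While e p) m 1 m
  | ExecWhileLoop m1 m2 m3 t1 t2 e p :
      holds m1 e -> exec p m1 t1 m2 -> exec (While e p) m2 t2 m3 ->
      exec (While e p) m1 (t1 + t2).+1 m3.

End Machine.

Arguments Bot {C K}.
Arguments Num {C K} n.
Arguments Cst {C K} c.
Arguments Val {C K} k.

(** * Evaluating queries on the machine *)

Section Evaluation.
Context (S : schema) (V : finType) (C : eqType) (K : Type).
Implicit Types (D : database S C) (nu : fact S C -> K) (g : query S V C K).

Definition code (T : finType) (x : T) : nat := enum_rank x.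

Definition cell (A : Type) (f : A -> word C K) (o : option A) : word C K :=
  oapp f Bot o.

Definition facts_of D (R : S) : seq (fact S C) := [seq f <- facts D | f.1 == R].

(* Relation names, variables and tree nodes are represented by their [code],
   an atom by its rank in [atoms g]; all ranks start at 0.  Facts are stored
   relation by relation, the tree by adjacency lists, and the decreasing
   sequence of witness subtrees by the level of each node v, i.e. the number of
   i such that v is in T_i. *)
Definition init_mem g (T : connex_join_tree g) D nu : mem C K :=
  fun a ks => match a, ks with
  | ARelArity, [:: inl r] =>
      cell (fun R => Num (arity R)) (onth (enum S) r)
  | ANumFacts, [:: inl r] =>
      cell (fun R => Num (size (facts_of D R))) (onth (enum S) r)
  | AFact, [:: inl r; inl i; inl j] =>
      cell Cst (obind (fun R => obind (fun f : fact S C => onth f.2 j)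
                                  (onth (facts_of D R) i)) (onth (enum S) r))
  | AAnnot, [:: inl r; inl i] =>
      cell (fun f => Val (nu f))
        (obind (fun R => onth (facts_of D R) i) (onth (enum S) r))
  | ANumAtoms, [::] => Num (size (atoms g))
  | AAtomRel, [:: inl i] => cell (fun b => Num (code b.1)) (onth (atoms g) i)
  | ATermVar, [:: inl i; inl j] =>
      cell (fun t => if t is inl x then Num (code x) else Bot)
        (obind (fun b : atom S V C => onth b.2 j) (onth (atoms g) i))
  | ATermCst, [:: inl i; inl j] =>
      cell (fun t => if t is inr c then Cst c else Bot)
        (obind (fun b : atom S V C => onth b.2 j) (onth (atoms g) i))
  | ANumSteps, [::] => Num (size (steps g))
  | AStepCard, [:: inl i] => cell (fun s : cmonoid K * {set V} => Num #|s.2|) (onth (steps g) i)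
  | AStepVar, [:: inl i; inl j] =>
      cell (fun x => Num (code x))
        (obind (fun s : cmonoid K * {set V} => onth (enum s.2) j)
           (onth (steps g) i))
  | ANodeAtom, [:: inl i] =>
      cell (fun v => Num (index (jt_atom v) (atoms g))) (onth (enum (node T)) i)
  | ANodeDeg, [:: inl i] =>
      cell (fun v => Num #|[set w | edge v w]|) (onth (enum (node T)) i)
  | ANodeNbr, [:: inl i; inl j] =>
      cell (fun w => Num (code w))
        (obind (fun v : node T => onth (enum [set w | edge v w]) j)
           (onth (enum (node T)) i))
  | ANodeLevel, [:: inl i] =>
      cell (fun v => Num (count (fun A : {set _} => v \in A) (jt_witness T)))
        (onth (enum (node T)) i)
  | _, _ => Bot
  end.

Definition runs g : cmd -> mem C K -> nat -> mem C K -> Prop :=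
  exec (mul g) (unzip1 (steps g)).

Definition shows_answer g (m : mem C K) (p : answer V C K) : Prop :=
  [/\ m AOutFlag [::] = Num 1,
      m AOutVal [::] = Val p.2
    & forall x, x \in free_vars g ->
        m AOutVar [:: inl (code x)] = cell Cst (p.1 x)].

Definition shows_none (m : mem C K) : Prop := m AOutFlag [::] = Num 0.

(* Successive runs of [next] produce exactly the answers of the list, in this
   order, and then the information that there are no more; each run takes at
   most d steps. *)
Fixpoint enumerates g (next : cmd) (d : nat) (m : mem C K)
    (l : seq (answer V C K)) : Prop :=
  exists t m', [/\ runs g next m t m', t <= d &
    match l with
    | [::] => shows_none m'
    | p :: l' => shows_answer g m' p /\ enumerates g next d m' l'
    end].

(* The query and its join tree are fixed: programs and constants may depend on
   them.  The "+ 1" of the linear bounds accounts for empty databases. *)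
Definition constant_delay_after_linear_preprocessing g
    (T : connex_join_tree g) : Prop :=
  exists (pre next : cmd) (c d : nat), forall D nu,
    exists t m l,
      [/\ runs g pre (init_mem T D nu) t m, t <= c * (db_size D + 1),
          List.NoDup l, forall p, List.In p l <-> sem g D nu p
        & enumerates g next d m l].

(* Meant for queries with at most one answer, i.e. without free variables. *)
Definition obtains_result g (p : cmd) (T : connex_join_tree g) D nu
    (t : nat) : Prop :=
  exists m, [/\ runs g p (init_mem T D nu) t m,
    forall a, sem g D nu a -> shows_answer g m a
    & (forall a, ~ sem g D nu a) -> shows_none m].

End Evaluation.

(* Main.v *)
(* Root the join tree at a node that lies in as many witness subtrees as
   possible: levels then decrease from the root to the leaves, so that the nodes
   can be eliminated in an order compatible with the projections, and a node of
   level i sends to its parent the sums, for the (i+1)-st addition, of the values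
   of its facts that agree on the variables shared with the parent, each value
   being multiplied by the messages of the children.  By distributivity and the
   running intersection property, replacing a node by its message amounts to
   projecting its private variables away.  Messages are indexed by tuples of
   unbounded length, hence stored in tries, at a cost proportional to the arity
   of the node for every fact of the node and of its parent.  Without free
   variables the message of the root is the result.  Otherwise one stops at the
   last witness subtree, in which the messages only delete dangling facts: every
   remaining choice of facts then extends downwards, and the answers are listed
   without repetition by an odometer running through the lists of facts that
   agree with the choice made at the parent. *)

From HB Require Import structures.
From Stdlib Require Import List Permutation.
From mathcomp Require Import all_boot zify.
Require Import Defs.

Set Implicit Arguments.
Unset Strict Implicit.
Unset Printing Implicit Defensive.

(** * Program logic with running times *)

(** The second claim asks for one program that works for all queries, so the rooting and the
    traversal of the join tree are computed at run time; for a fixed query the order is written into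
    the program. The machine cannot test semiring elements, so a dangling fact is marked by bottom,
    mirrored by [None] in [option K]. Absence must not be confused with a value that happens to be
    zero: an answer of value zero is still an answer. One message-passing program serves both
    claims, and the threshold [thr] decides at which levels a message keeps its value. For an
    answer, the values at all nodes of the last witness subtree are multiplied together; a message
    inside this subtree that kept its value would count the same factors twice. Every specification
    carries a step count, because the time bounds rest on the same invariants as correctness. *)

Notation var k := (Read (Work k) [::]).

(** [Le] is the only order test, so [k < e] is written [k + 1 <= e]. The bound is evaluated again at
    each turn, which is why [wp_for] asks that it be constant along the loop. *)
Definition for_loop (k : nat) (e : expr) (p : cmd) : cmd :=
  Seq (Assign (Work k) [::] (Lit 0))
      (While (Le (Add (var k) (Lit 1)) e)
         (Seq p (Assign (Work k) [::] (Add (var k) (Lit 1))))).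

Fixpoint writes (p : cmd) : seq array :=
  match p with
  | Skip => [::]
  | Assign a _ _ => [:: a]
  | Seq p1 p2 => writes p1 ++ writes p2
  | If _ p1 p2 => writes p1 ++ writes p2
  | While _ p1 => writes p1
  end.

Section Logic.
Context (C : eqType) (K : Type) (times : cmonoid K) (plus : seq (cmonoid K)).
Local Notation memory := (Defs.mem C K).
Local Notation exec := (@exec C K times plus).
Local Notation eval := (@eval C K times plus).
Local Notation holds := (@holds C K times plus).
Implicit Types (m : memory) (p : cmd) (e : expr).

(** Total correctness with time: the duration is an argument of [Q], so that bounds compose together
    with the invariants. *)
Definition wp p m (Q : nat -> memory -> Prop) : Prop :=
  exists t m', exec p m t m' /\ Q t m'.

Definition agree (s : seq array) m m' : Prop :=
  forall a ks, a \notin s -> m' a ks = m a ks.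

Lemma agree_trans s1 s2 s m1 m2 m3 :
  {subset s1 <= s} -> {subset s2 <= s} ->
  agree s1 m1 m2 -> agree s2 m2 m3 -> agree s m1 m3.
Proof.
move=> s1s s2s a12 a23 a ks as_.
rewrite a23 ?a12 //; first by apply: contra as_; apply: s1s.
by apply: contra as_; apply: s2s.
Qed.

Lemma update_same m a ks w : update m a ks w a ks = w.
Proof. by rewrite /update !eqxx. Qed.

Lemma update_ks m a ks ks' w :
  update m a ks w a ks' = if ks' == ks then w else m a ks'.
Proof. by rewrite /update eqxx. Qed.

Lemma update_array m a a' ks ks' w :
  a' != a -> update m a ks w a' ks' = m a' ks'.
Proof. by rewrite /update => /negPf->. Qed.

Lemma agree_update m a ks w : agree [:: a] m (update m a ks w).
Proof. by move=> a' ks'; rewrite inE => /update_array->. Qed.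

Lemma exec_agree p m t m' : exec p m t m' -> agree (writes p) m m'.
Proof.
elim=> {p m t m'} /=.
- by [].
- by move=> m a es e ks _; apply: agree_update.
- move=> m1 m2 m3 t1 t2 p1 p2 _ A1 _ A2.
  by apply: agree_trans A1 A2 => a; rewrite mem_cat => ->; rewrite ?orbT.
- move=> m m' t e p1 p2 _ A a ks; rewrite mem_cat negb_or => /andP[a1 a2].
  by apply: A; case: ifP.
- by [].
- by move=> m1 m2 m3 t1 t2 e p _ _ A1 _ A2; apply: agree_trans A1 A2 => a.
Qed.

(** The frame rule is built in: the continuation learns that arrays outside [writes p] are
    unchanged, so a specification only has to describe what its program modifies. *)
Lemma wp_conseq p m (Q Q' : nat -> memory -> Prop) :
  wp p m Q -> (forall t m', agree (writes p) m m' -> Q t m' -> Q' t m') ->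
  wp p m Q'.
Proof.
move=> [t [m' [ex Qm']]] QQ'; exists t, m'; split=> //.
exact: QQ' (exec_agree ex) Qm'.
Qed.

Lemma wp_skip m (Q : nat -> memory -> Prop) : Q 0 m -> wp Skip m Q.
Proof. by move=> Qm; exists 0, m; split=> //; constructor. Qed.

Lemma wp_assign m a es e ks (Q : nat -> memory -> Prop) :
  to_keys [seq eval m e' | e' <- es] = Some ks ->
  Q 1 (update m a ks (eval m e)) -> wp (Assign a es e) m Q.
Proof. by move=> es_ks Qm; exists 1, (update m a ks (eval m e)); split=> //; constructor. Qed.

Lemma wp_assign0 m a e (Q : nat -> memory -> Prop) :
  Q 1 (update m a [::] (eval m e)) -> wp (Assign a [::] e) m Q.
Proof. exact: wp_assign. Qed.

Lemma wp_assign1 m a e1 e k1 (Q : nat -> memory -> Prop) :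
  to_key (eval m e1) = Some k1 ->
  Q 1 (update m a [:: k1] (eval m e)) -> wp (Assign a [:: e1] e) m Q.
Proof. by move=> h1; apply: wp_assign; rewrite /= h1. Qed.

Lemma wp_assign2 m a e1 e2 e k1 k2 (Q : nat -> memory -> Prop) :
  to_key (eval m e1) = Some k1 -> to_key (eval m e2) = Some k2 ->
  Q 1 (update m a [:: k1; k2] (eval m e)) -> wp (Assign a [:: e1; e2] e) m Q.
Proof. by move=> h1 h2; apply: wp_assign; rewrite /= h1 h2. Qed.

Lemma wp_assign3 m a e1 e2 e3 e k1 k2 k3 (Q : nat -> memory -> Prop) :
  to_key (eval m e1) = Some k1 -> to_key (eval m e2) = Some k2 ->
  to_key (eval m e3) = Some k3 ->
  Q 1 (update m a [:: k1; k2; k3] (eval m e)) ->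
  wp (Assign a [:: e1; e2; e3] e) m Q.
Proof. by move=> h1 h2 h3; apply: wp_assign; rewrite /= h1 h2 h3. Qed.

Lemma wp_seq p1 p2 m (Q : nat -> memory -> Prop) :
  wp p1 m (fun t1 m1 => wp p2 m1 (fun t2 => Q (t1 + t2))) ->
  wp (Seq p1 p2) m Q.
Proof.
move=> [t1 [m1 [e1 [t2 [m2 [e2 Qm]]]]]].
by exists (t1 + t2), m2; split=> //; apply: ExecSeq e1 e2.
Qed.

Lemma wp_if e p1 p2 m (Q : nat -> memory -> Prop) :
  wp (if holds m e then p1 else p2) m (fun t => Q t.+1) -> wp (If e p1 p2) m Q.
Proof. by move=> [t [m' [ex Qm]]]; exists t.+1, m'; split=> //; apply: ExecIf. Qed.

Lemma eval_read1 m a e1 k1 :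
  to_key (eval m e1) = Some k1 -> eval m (Read a [:: e1]) = m a [:: k1].
Proof. by move=> /= ->. Qed.

Lemma eval_read2 m a e1 e2 k1 k2 :
  to_key (eval m e1) = Some k1 -> to_key (eval m e2) = Some k2 ->
  eval m (Read a [:: e1; e2]) = m a [:: k1; k2].
Proof. by move=> /= -> ->. Qed.

Lemma eval_read3 m a e1 e2 e3 k1 k2 k3 :
  to_key (eval m e1) = Some k1 -> to_key (eval m e2) = Some k2 ->
  to_key (eval m e3) = Some k3 ->
  eval m (Read a [:: e1; e2; e3]) = m a [:: k1; k2; k3].
Proof. by move=> /= -> -> ->. Qed.

Lemma eval_read2_bot m a e1 e2 :
  eval m e2 = Bot -> eval m (Read a [:: e1; e2]) = Bot.
Proof. by move=> /= ->; case: (to_key _). Qed.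

Lemma eval_read3_bot m a e1 e2 e3 :
  eval m e3 = Bot -> eval m (Read a [:: e1; e2; e3]) = Bot.
Proof. by move=> /= ->; case: (to_key _) => //; case: (to_key _). Qed.

Lemma eval_read3_bot2 m a e1 e2 e3 :
  eval m e2 = Bot -> eval m (Read a [:: e1; e2; e3]) = Bot.
Proof. by move=> /= ->; case: (to_key _). Qed.

Lemma eval_add m e1 e2 n1 n2 : eval m e1 = Num n1 -> eval m e2 = Num n2 ->
  eval m (Add e1 e2) = Num (n1 + n2).
Proof. by move=> /= -> ->. Qed.

Lemma eval_sub m e1 e2 n1 n2 : eval m e1 = Num n1 -> eval m e2 = Num n2 ->
  eval m (Sub e1 e2) = Num (n1 - n2).
Proof. by move=> /= -> ->. Qed.

Lemma eval_splus m e0 e1 e2 i o x y : eval m e0 = Num i -> eval m e1 = Val x ->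
  eval m e2 = Val y -> onth plus i = Some o ->
  eval m (SPlus e0 e1 e2) = Val (o x y).
Proof. by move=> /= -> -> -> ->. Qed.

Lemma eval_stimes m e1 e2 x y : eval m e1 = Val x -> eval m e2 = Val y ->
  eval m (STimes e1 e2) = Val (times x y).
Proof. by move=> /= -> ->. Qed.

Definition is_bot (w : word C K) : bool := if w is Bot then true else false.

Lemma holds_IsBot m e : holds m (IsBot e) = is_bot (eval m e).
Proof. by rewrite /holds /=; case: (eval m e). Qed.

Lemma holds_Eq m e1 e2 : holds m (Eq e1 e2) =
  match to_key (eval m e1), to_key (eval m e2) with
  | Some k1, Some k2 => k1 == k2
  | _, _ => false
  end.
Proof.
rewrite /holds /=; case: (to_key (eval m e1)) => [k1|] //.
by case: (to_key (eval m e2)) => [k2|] //; case: (k1 == k2).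
Qed.

Lemma holds_Le m e1 e2 n1 n2 : eval m e1 = Num n1 -> eval m e2 = Num n2 ->
  holds m (Le e1 e2) = (n1 <= n2).
Proof. by rewrite /holds /= => -> ->; rewrite /arith; case: (n1 <= n2). Qed.

(* A loop bound that is not a number makes the test fail at once. *)
Definition bound (w : word C K) : nat := if w is Num n then n else 0.

Lemma holds_bound m k e i : m (Work k) [::] = Num i ->
  holds m (Le (Add (var k) (Lit 1)) e) = (i < bound (eval m e)).
Proof.
move=> mk; rewrite /holds /= mk /arith /=.
by case: (eval m e) => //= n; rewrite addn1; case: (i < n).
Qed.

(* In the invariant [I i t m], [t] is the time spent so far. *)
Lemma wp_for k e p m n (I : nat -> nat -> memory -> Prop)
    (Q : nat -> memory -> Prop) :
  I 0 1 (update m (Work k) [::] (Num 0)) ->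
  (forall i t m', i <= n -> agree (Work k :: writes p) m m' ->
     m' (Work k) [::] = Num i -> I i t m' -> bound (eval m' e) = n) ->
  (forall i t m', i < n -> agree (Work k :: writes p) m m' ->
     m' (Work k) [::] = Num i -> I i t m' ->
     wp p m' (fun t' m'' => m'' (Work k) [::] = Num i /\
        I i.+1 (t + t' + 2) (update m'' (Work k) [::] (Num i.+1)))) ->
  (forall t m', agree (Work k :: writes p) m m' ->
     I n t m' -> Q t.+1 m') ->
  wp (for_loop k e p) m Q.
Proof.
move=> I0 Ie Ip IQ; apply: wp_seq; apply: wp_assign => //=.
set m0 := update m _ _ _ in I0 *.
have A0 : agree (Work k :: writes p) m m0.
  by move=> a ks; rewrite inE negb_or => /andP[ak _]; rewrite /m0 update_array.
have k0 : m0 (Work k) [::] = Num 0 by rewrite /m0 update_same.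
suff loop d : forall i t m', n - i = d -> i <= n ->
    agree (Work k :: writes p) m m' -> m' (Work k) [::] = Num i -> I i t m' ->
    wp (While (Le (Add (var k) (Lit 1)) e)
         (Seq p (Assign (Work k) [::] (Add (var k) (Lit 1))))) m'
      (fun t' => Q (t + t')).
  by apply: (loop n 0 1 m0) => //; lia.
elim: d => [|d IHd] i t m' di in_ A mk Iit.
  have ein : i = n by lia.
  exists 1, m'; split; last by rewrite addn1; apply: IQ; rewrite // -ein.
  apply: ExecWhileStop; rewrite (holds_bound _ mk) (Ie i t) //; lia.
have ltin : i < n by lia.
have [t1 [m1 [e1 [k1 I1]]]] := Ip i t m' ltin A mk Iit.
set m2 := update m1 _ _ _ in I1.
have A1 : agree (Work k :: writes p) m' m2.
  move=> a ks; rewrite inE negb_or => /andP[ak ap].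
  by rewrite /m2 update_array // (exec_agree e1).
have [||||t2 [m3 [e2 Qm3]]] := IHd i.+1 _ m2 _ _ _ _ I1; try lia.
- by apply: agree_trans A A1.
- by rewrite /m2 update_same.
exists (t1 + 1 + t2).+1, m3; split; last first.
  by move: Qm3; congr (Q _ _); lia.
apply: (ExecWhileLoop (m2 := m2)) e2.
  by rewrite (holds_bound _ mk) (Ie i t) //; lia.
apply: ExecSeq e1 _; rewrite /m2.
have -> : @Num C K i.+1 = eval m1 (Add (var k) (Lit 1)) by rewrite /= k1 /arith addn1.
by constructor.
Qed.

End Logic.

(** * Rooted orders of a tree *)

Section Trees.
Context (N : finType) (e : rel N).

(** Encodes a rooting by a listing: the first node is the root, and indices replace depths in all
    inductions. That every edge joins a node to its parent is not assumed; it follows from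
    acyclicity in [edge_par]. *)
Definition parent_order (s : seq N) (par : N -> option N) : Prop :=
  uniq s /\ {in s, forall v,
    if par v is Some p then e p v && (index p s < index v s)
    else index v s == 0}.

Definition up_closed (par : N -> option N) (P : {set N}) : Prop :=
  forall v p, v \in P -> par v = Some p -> p \in P.

Lemma restricted_path (A : {set N}) x p :
  path [rel x y | [&& x \in A, y \in A & e x y]] x p ->
  path e x p /\ {subset p <= A}.
Proof.
elim: p x => //= y p IHp x /andP[/and3P[_ yA exy] /IHp[yp pA]].
by rewrite exy yp; split=> // z; rewrite inE => /orP[/eqP->|/pA].
Qed.

Hypothesis tree_e : is_tree e.
Context (s : seq N) (par : N -> option N).
Hypotheses (s_ord : parent_order s par) (s_all : forall v, v \in s).

Lemma par_edge v p : par v = Some p -> e p v.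
Proof. by case: s_ord => _ /(_ v (s_all v)) + vp; rewrite vp => /andP[]. Qed.

Lemma par_lt v p : par v = Some p -> index p s < index v s.
Proof. by case: s_ord => _ /(_ v (s_all v)) + vp; rewrite vp => /andP[]. Qed.

Lemma par_none v : par v = None -> index v s = 0.
Proof. by case: s_ord => _ /(_ v (s_all v)) + vp; rewrite vp => /eqP. Qed.

Lemma index_eq u v : index u s = index v s -> u = v.
Proof. by move=> uv; rewrite -(nth_index u (s_all u)) uv nth_index. Qed.

(** Climbing from parent to parent stays in [P] and ends at the only node of index 0, through which
    any two nodes of [P] are joined. *)
Lemma up_closed_connected P : up_closed par P -> connected e P.
Proof.
move=> upP; have [_ sym_e _ _ _] := tree_e.
pose r := [rel x y | [&& x \in P, y \in P & e x y]].
have sym_r : connect_sym r.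
  by apply: sym_connect_sym => x y; rewrite /= sym_e andbCA.
have toroot n : forall v, index v s < n -> v \in P ->
    exists2 z, z \in P /\ index z s = 0 & connect r z v.
  elim: n => // n IHn v vn vP; case vp: (par v) => [p|]; last first.
    by exists v; rewrite ?(par_none vp).
  have pP := upP _ _ vP vp; have := par_lt vp.
  move=> pv; have [|z z0 zp] := IHn p _ pP; first by lia.
  exists z => //; apply: connect_trans zp (connect1 _).
  by rewrite /= pP vP par_edge.
move=> u v uP vP; have [z [_ z0] zu] := toroot _ u (ltnSn _) uP.
have [z' [_ z'0] zv] := toroot _ v (ltnSn _) vP.
rewrite (@index_eq z' z) in zv; last by rewrite z0.
by rewrite (connect_trans _ zv) // sym_r.
Qed.

(* Otherwise a path from [v] to [P] inside [A], closed through [P] and [p],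
   would be a cycle. *)
Lemma parent_in P A u v p :
  up_closed par P -> v \notin P -> par v = Some p -> p \in P ->
  connected e A -> v \in A -> u \in A -> u \in P -> p \in A.
Proof.
move=> upP vP vp pP conA vA uA uP; have [_ sym_e _ _ acyc] := tree_e.
have /connectP[q0 path_q0 last_q0] := conA v u vA uA.
case/shortenP: path_q0 last_q0 => q /restricted_path[path_q qA] uniq_q _ last_q.
have hasP : has [in P] q.
  apply/hasP; exists u => //; rewrite last_q.
  by move: vP uP; rewrite last_q; case: (q) => [/negPf->//|x q1 _ _]; apply: (mem_last x q1).
case/split_find: hasP path_q qA uniq_q last_q => w q1 q2 wP q1P.
rewrite cat_path rcons_path -cats1 => /andP[/andP[path_q1 e_w] _] qA uniq_q _.
have wA : w \in A by apply: qA; rewrite !mem_cat inE eqxx orbT.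
have /connectP[q0' path_q' last_q'] := up_closed_connected upP wP pP.
case/shortenP: path_q' last_q' => q' /restricted_path[path_q' q'P] uniq_q' _ last_q'.
have := acyc (v :: q1 ++ w :: q').
rewrite /ucycle /= rcons_cat cat_path /= rcons_path path_q1 e_w path_q' -last_q'.
rewrite par_edge // cat_uniq; move: uniq_q.
rewrite /= !cat_uniq mem_cat => /andP[vq /andP[/andP[uq1 _] _]].
have q'P' : {subset w :: q' <= P}.
  by move=> x; rewrite inE => /orP[/eqP->|/q'P].
move: uniq_q' => /= uniq_q'; rewrite -[_ || has _ _]/(has [in q1] (w :: q')) uq1 uniq_q' mem_cat.
have -> : v \in w :: q' = false by apply: contraNF vP => /q'P'.
have -> : has [in q1] (w :: q') = false.
  apply: contraNF q1P => /hasP[x /q'P' xP xq1]; by apply/hasP; exists x.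
move: vq; rewrite !mem_cat !negb_or => /andP[/andP[/negPf-> _] _].
(* If [q'] is empty then [p] is [w], which lies in [A]; otherwise the cycle has at least three
   nodes. *)
case: q' last_q' {path_q' q'P uniq_q' q'P'} => [->|x q'] //= _ /(_ isT).
by rewrite size_cat /=; lia.
Qed.

Lemma up_closed_before v : up_closed par [set x | index x s < index v s].
Proof. by move=> x p; rewrite !inE => xv /par_lt px; lia. Qed.

(** Let [v] be the later endpoint. The nodes before [v] are closed under parents and the pair of
    endpoints is connected, so [parent_in] places the parent of [v] in this pair, hence at [w]. *)
Lemma edge_par v w : e v w -> par v = Some w \/ par w = Some v.
Proof.
have [_ sym_e irr_e _ _] := tree_e.
wlog: v w / index w s < index v s.
  move=> wl evw; case: (ltngtP (index w s) (index v s)) => [lt|lt|eq].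
  - exact: wl.
  - by case: (wl w v lt); rewrite 1?sym_e; auto.
  - by rewrite (index_eq eq) irr_e in evw.
move=> wv evw; left; case vp: (par v) => [p|]; last by rewrite (par_none vp) in wv.
have pv := par_lt vp; suff: p \in [set v; w].
  by rewrite !inE => /orP[/eqP pv'|/eqP->//]; rewrite pv' ltnn in pv.
apply: (parent_in (u := w) (up_closed_before (v := v)) _ vp); rewrite ?inE ?ltnn ?eqxx ?orbT //.
move=> x y; rewrite !inE; pose r := [rel x y | [&& x \in [set v; w], y \in [set v; w] & e x y]].
  have rvw : connect r v w by apply: connect1; rewrite /= !inE !eqxx orbT evw.
  have rwv : connect r w v by apply: connect1; rewrite /= !inE !eqxx orbT sym_e evw.
  by move=> /orP[]/eqP-> /orP[]/eqP->.
Qed.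

(** Each adjacency links a node to its unique parent, in one direction or the other. This bounds the
    total length of the adjacency lists scanned by the search. *)
Lemma sum_degree : \sum_(v <- s) #|[set w | e v w]| <= 2 * size s.
Proof.
have [uniq_s _] := s_ord.
have to_all F : \sum_(v <- s) F v = \sum_v F v.
  by rewrite big_uniq //; apply: eq_bigl => v; rewrite s_all.
rewrite !to_all.
pose f v w : nat := (par v == Some w) + (par w == Some v).
apply: (@leq_trans (\sum_v \sum_w f v w)).
  apply: leq_sum => v _; rewrite -sum1dep_card big_mkcond /=.
  apply: leq_sum => w _; rewrite /f.
  case: ifP => // evw. have := edge_par evw; by case=> ->; rewrite eqxx ?addn1.
have half : \sum_v \sum_w (par v == Some w : nat) <= size s.
  rewrite -(sum1_size s) to_all; apply: leq_sum => v _.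
  rewrite -big_mkcond /= sum1dep_card.
  apply: (@leq_trans #|pred1 (odflt v (par v))|); last by rewrite card1.
  by apply: subset_leq_card; apply/subsetP => w; rewrite !inE => /eqP->.
rewrite mul2n -addnn /f.
under eq_bigr do rewrite big_split /=.
rewrite big_split /=; apply: leq_add => //.
by rewrite exchange_big.
Qed.

End Trees.

Section Existence.
Context (N : finType) (e : rel N).
Hypothesis tree_e : is_tree e.

Lemma closed_seq_all (s : seq N) r : r \in s ->
  (forall v w, v \in s -> e v w -> w \in s) -> forall v, v \in s.
Proof.
move=> rs cl v; have [_ _ _ con _] := tree_e.
have /connectP[p] := con r v (in_setT _) (in_setT _).
move=> /restricted_path[+ _]; elim: p r rs => [|x p IHp] r rs /=; first by move=> _ ->.
by move=> /andP[/(cl r x rs) xs /(IHp _ xs)].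
Qed.

Lemma parent_order_rcons s par u w :
  parent_order e s par -> u \in s -> w \notin s -> e u w ->
  parent_order e (rcons s w) (fun x => if x == w then Some u else par x).
Proof.
move=> [us sp] u_s ws euw; split; first by rewrite rcons_uniq ws.
move=> v; rewrite mem_rcons inE -cats1.
have old x : x \in s -> index x (s ++ [:: w]) = index x s.
  by move=> xs; rewrite index_cat xs.
case: eqP => [-> _|vw /= vs].
  by rewrite euw old // index_cat (negPf ws) /= eqxx addn0 index_mem.
have := sp v vs; rewrite old //; case: (par v) => // p /andP[-> pv] /=.
suff ps : p \in s by rewrite old.
by rewrite -index_mem; apply: leq_trans pv (index_size _ _).
Qed.

(** The list grows by a neighbour not yet in it; when there is none, it is closed under adjacency
    and connectedness makes it complete. *)
Lemma parent_order_exists r : exists s par,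
  [/\ parent_order e s par, forall v, v \in s & index r s = 0].
Proof.
have N0 : 0 < #|N| by case: tree_e.
suff build k : 0 < k <= #|N| -> exists s par,
    [/\ size s = k, parent_order e s par, index r s = 0 & r \in s].
  have [|s [par [size_s s_ord r_s rs]]] := build #|N|; first by rewrite N0 leqnn.
  exists s, par; split=> // v; have [us _] := s_ord.
  have /subset_cardP/(_ (subset_predT _))-> // : #|s| = #|{: N}|.
  by rewrite (card_uniqP us).
elim: k => // k IHk /andP[_ kN]; case: k => [|k] in IHk kN *.
  exists [:: r], (fun=> None); rewrite /= eqxx inE eqxx; split=> //.
  by split=> // v; rewrite inE => /eqP->; rewrite /= eqxx.
have [|s [par [size_s s_ord r_s rs]]] := IHk; first by rewrite /= ltnW.
have [/existsP[u /existsP[w /and3P[us ws euw]]]|] :=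
  boolP [exists u, exists w, [&& u \in s, w \notin s & e u w]]; last first.
  move=> /existsPn no; have all_s : forall v, v \in s.
    apply: closed_seq_all rs _ => v w vs evw; apply: contraT => ws; move: no.
    by move=> /(_ v); rewrite negb_exists => /forallP/(_ w); rewrite vs ws evw.
  have : #|N| <= size s by apply: leq_trans (card_size s); apply/subset_leq_card/subsetP => y _; apply: all_s.
  by lia.
exists (rcons s w), (fun x => if x == w then Some u else par x).
split; rewrite ?size_rcons ?size_s ?mem_rcons ?inE ?rs ?orbT //.
- exact: parent_order_rcons.
- by rewrite -cats1 index_cat rs.
Qed.

End Existence.

(** * Annotated relations and the semantics of queries *)

(* [None] stands for the absence of a tuple: it is neutral for sums and
   absorbing for products, so no zero of [K] is needed. *)
Section OptionMonoids.
Context (K : Type).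

Definition omul (times : cmonoid K) (x y : option K) : option K :=
  if (x, y) is (Some a, Some b) then Some (times a b) else None.

Definition oplus (plus : cmonoid K) (x y : option K) : option K :=
  match x, y with
  | Some a, Some b => Some (plus a b)
  | Some a, None => Some a
  | None, _ => y
  end.

Lemma omulA times : associative (omul times).
Proof. by move=> [a|] [b|] [c|] //=; rewrite /omul Monoid.mulmA. Qed.
Lemma omulC times : commutative (omul times).
Proof. by move=> [a|] [b|] //=; rewrite /omul Monoid.mulmC. Qed.
Lemma omul1 times : left_id (Some (cm_one times)) (omul times).
Proof. by move=> [a|] //=; rewrite /omul Monoid.mul1m. Qed.
HB.instance Definition _ times :=
  Monoid.isComLaw.Build (option K) (Some (cm_one times)) (omul times)
    (@omulA times) (@omulC times) (@omul1 times).

Lemma oplusA plus : associative (oplus plus).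
Proof. by move=> [a|] [b|] [c|] //=; rewrite Monoid.mulmA. Qed.
Lemma oplusC plus : commutative (oplus plus).
Proof. by move=> [a|] [b|] //=; rewrite Monoid.mulmC. Qed.
Lemma oplus0 plus : left_id None (oplus plus).
Proof. by []. Qed.
HB.instance Definition _ plus :=
  Monoid.isComLaw.Build (option K) None (oplus plus)
    (@oplusA plus) (@oplusC plus) (@oplus0 plus).

Lemma omul_None times x : omul times x None = None.
Proof. by case: x. Qed.

Lemma omul_big_oplus (plus times : cmonoid K) (I : Type) (r : seq I) (P : pred I) F x :
  right_distributive times plus ->
  omul times x (\big[oplus plus/None]_(i <- r | P i) F i) =
  \big[oplus plus/None]_(i <- r | P i) omul times x (F i).
Proof.
move=> dist; apply: big_morph; last exact: omul_None.
by case: x => [x|] [a|] [b|] //=; rewrite /omul dist.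
Qed.

Lemma omul_big_Some times (I : Type) (r : seq I) (P : pred I) F :
  \big[omul times/Some (cm_one times)]_(i <- r | P i) Some (F i) =
  Some (\big[times/cm_one times]_(i <- r | P i) F i).
Proof. by rewrite (big_morph Some (id1 := Some (cm_one times)) (op1 := omul times)). Qed.

Lemma omul_big_None times (I : eqType) (r : seq I) (P : pred I) F i :
  i \in r -> P i -> F i = None ->
  \big[omul times/Some (cm_one times)]_(i <- r | P i) F i = None.
Proof.
by move=> ir Pi Fi; rewrite (big_rem _ ir) /= Pi Fi.
Qed.

Lemma oplus_big_Some plus (I : Type) (r : seq I) F :
  \big[oplus plus/None]_(i <- r) Some (F i) =
  if nilp r then None else Some (\big[plus/cm_one plus]_(i <- r) F i).
Proof.
elim: r => [|i r IHr]; first by rewrite big_nil.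
rewrite !big_cons IHr /=; case: r {IHr} => [|j r] //=.
by rewrite big_nil Monoid.mulm1.
Qed.

Lemma big_Permutation (op : cmonoid K) (I : Type) (r1 r2 : seq I) F :
  Permutation r1 r2 ->
  \big[op/cm_one op]_(i <- r1) F i = \big[op/cm_one op]_(i <- r2) F i.
Proof.
elim=> {r1 r2} // [i r1 r2 _ IH|i j r|r1 r2 r3 _ -> _ ->] //.
  by rewrite !big_cons IH.
by rewrite !big_cons Monoid.mulmCA.
Qed.

End OptionMonoids.

Section Relations.
Context (V : finType) (C : eqType) (K : Type) (cs : seq C).
Local Notation assignment := (assignment V C).
Implicit Types (h f : assignment) (phi psi : assignment -> option K).

(** A finite universe over which all sums run. The extra rank [size cs] falls outside [cs] and
    encodes an undefined variable; [undup] is there because [cs] may contain repetitions. *)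
Definition all_assignments : seq assignment :=
  undup [seq [ffun x => onth cs (f x)] | f : {ffun V -> 'I_(size cs).+1}].

Lemma mem_all_assignments h :
  (forall x c, h x = Some c -> c \in cs) -> h \in all_assignments.
Proof.
move=> hcs; rewrite mem_undup.
pose f := [ffun x : V => inord (if h x is Some c then index c cs else size cs)
             : 'I_(size cs).+1].
apply/mapP; exists f; first by rewrite mem_enum.
apply/ffunP => x; rewrite !ffunE inordK; case hx: (h x) => [c|]; rewrite ?ltnS //.
- by have ccs := hcs _ _ hx; rewrite onthE (nth_map c) ?index_mem // nth_index.
- by rewrite onth_default.
- by rewrite index_size.
Qed.

Lemma all_assignments_val h x c : h \in all_assignments -> h x = Some c -> c \in cs.
Proof.
rewrite mem_undup => /mapP[f _ ->]; rewrite ffunE => fx.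
by apply/onthP; exists (f x).
Qed.

Lemma restrict_all_assignments Y h :
  h \in all_assignments -> restrict Y h \in all_assignments.
Proof.
move=> hL; apply: mem_all_assignments => x c; rewrite ffunE.
by case: ifP => // _; apply: all_assignments_val.
Qed.

Definition supported phi : Prop :=
  forall h, phi h <> None -> h \in all_assignments.

Definition proj (plus : cmonoid K) (Y : {set V}) phi f : option K :=
  \big[oplus plus/None]_(h <- all_assignments | restrict Y h == f) phi h.

Lemma eq_proj plus Y phi psi : phi =1 psi -> proj plus Y phi =1 proj plus Y psi.
Proof. by move=> eq_phi f; apply: eq_bigr => h _. Qed.

Lemma proj_supported plus Y phi : supported (proj plus Y phi).
Proof.
move=> f; rewrite /proj => nf.
have [|/hasPn no] := boolP (has (fun h => restrict Y h == f) all_assignments).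
  by case/hasP=> h hL /eqP<-; apply: restrict_all_assignments.
by case: nf; rewrite big_seq_cond big_pred0 // => h; apply/negP=> /andP[/no/negP].
Qed.

Lemma restrict_restrict (Y Z : {set V}) h :
  Y \subset Z -> restrict Y (restrict Z h) = restrict Y h.
Proof.
move=> /subsetP YZ; apply/ffunP=> x; rewrite !ffunE.
by case: ifP => // /YZ->.
Qed.

Lemma restrict_id h : restrict (adom h) h = h.
Proof. by apply/ffunP=> x; rewrite ffunE inE; case: (h x). Qed.

Lemma adom_restrict Y h : adom (restrict Y h) = Y :&: adom h.
Proof. by apply/setP=> x; rewrite !inE ffunE; case: ifP. Qed.

Lemma sum_all_assignments (plus : cmonoid K) phi f :
  supported phi ->
  \big[oplus plus/None]_(h <- all_assignments | h == f) phi h = phi f.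
Proof.
move=> phiL; have [fL|fL] := boolP (f \in all_assignments).
  rewrite (big_rem _ fL) /= eqxx big_seq_cond big_pred0 ?Monoid.mulm1 // => h.
  by rewrite mem_rem_uniq ?undup_uniq // inE andbC; case: eqP.
rewrite big_seq_cond big_pred0 => [|h]; last first.
  by apply: contraNF fL => /andP[hL /eqP<-].
by case phif: (phi f) => // [a]; rewrite phiL ?phif in fL.
Qed.

(** After exchanging the sums, each [h] contributes through the single intermediate assignment
    [restrict Z h]. It allows one projection of the query to be carried out node by node. *)
Lemma proj_proj plus (Y Z : {set V}) phi :
  Y \subset Z -> supported phi ->
  proj plus Y (proj plus Z phi) =1 proj plus Y phi.
Proof.
move=> YZ phiL f; rewrite /proj.
rewrite (exchange_big_dep (fun h => restrict Y h == f)) /=; last first.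
  by move=> g h /eqP<- /eqP<-; rewrite restrict_restrict.
rewrite big_seq_cond [RHS]big_seq_cond; apply: eq_bigr => h /andP[hL /eqP hf].
rewrite (eq_bigl (fun g => g == restrict Z h)); last first.
  move=> g; rewrite [RHS]eq_sym andbC; case: (restrict Z h =P g) => [<-|//].
  by rewrite restrict_restrict // hf eqxx.
have zL := restrict_all_assignments Z hL.
rewrite (big_rem _ zL) eqxx big_seq_cond big_pred0 ?Monoid.mulm1 // => g.
by rewrite mem_rem_uniq ?undup_uniq // inE andbC; case: eqP.
Qed.

Lemma proj_id plus Y phi :
  supported phi -> (forall h, phi h <> None -> adom h = Y) ->
  proj plus Y phi =1 phi.
Proof.
move=> phiL phiY f.
have [adf|adf] := eqVneq (adom f) Y; last first.
  case phif: (phi f) => [a|]; first by rewrite phiY ?phif ?eqxx in adf.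
  apply: big1_seq => h /andP[/eqP hf _]; case phih: (phi h) => [a|] //.
  by rewrite -hf -(phiY h) ?phih // restrict_id phih in phif.
rewrite -(sum_all_assignments plus f phiL) /proj.
rewrite [LHS]big_mkcond [RHS]big_mkcond; apply: eq_bigr => h _.
case phih: (phi h) => [a|]; last by rewrite !if_same.
by rewrite -(phiY h) ?phih // restrict_id.
Qed.

(** Replaces the relational semantics, whose sums run over listings given existentially, by a
    partial function on assignments. *)
Definition represents (A : answer V C K -> Prop) phi : Prop :=
  supported phi /\ forall p, A p <-> phi p.1 = Some p.2.

Definition answers phi f Y : seq (answer V C K) :=
  pmap (fun h => omap (pair h) (phi h))
    [seq h <- all_assignments | restrict Y h == f].

Lemma NoDup_pmap (r : seq assignment) phi :
  uniq r -> NoDup (pmap (fun h => omap (pair h) (phi h)) r).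
Proof.
elim: r => [|h r IHr] /= => [_|/andP[hr /IHr nd]]; first by constructor.
case: (phi h) => [a|] //=; constructor=> // hin.
suff: h \in r by rewrite (negPf hr).
elim: (r) hin => //= h' r' IH; case: (phi h') => [b|] /=; rewrite inE.
  by case=> [[-> _]|/IH->]; rewrite ?eqxx ?orbT.
by move/IH->; rewrite orbT.
Qed.

Lemma In_pmap (r : seq assignment) phi p :
  List.In p (pmap (fun h => omap (pair h) (phi h)) r) <->
  p.1 \in r /\ phi p.1 = Some p.2.
Proof.
elim: r => [|h r IHr] /=; first by split=> // [[]].
rewrite inE; case phih: (phi h) => [a|] /=; rewrite IHr.
  split=> [[<-/=|[-> ->]]|[/orP[/eqP ph|pr] phip]]; rewrite ?eqxx ?orbT //.
    by left; move: phip; rewrite ph phih => -[->]; rewrite -ph -surjective_pairing.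
  by right.
split=> [[-> ->]|[/orP[/eqP ph|pr] phip]]; rewrite ?orbT //.
by rewrite ph phih in phip.
Qed.

Lemma proj_answers plus Y phi f :
  proj plus Y phi f =
  \big[oplus plus/None]_(p <- answers phi f Y) Some p.2.
Proof.
rewrite /proj /answers -big_filter; elim: [seq _ <- _ | _] => [|h r IHr] /=.
  by rewrite !big_nil.
by rewrite big_cons IHr; case: (phi h) => [a|] //=; rewrite big_cons.
Qed.

(** Two repetition-free listings of the same fibre are permutations of each other, so the sum does
    not depend on the listing and may be computed on [answers]. *)
Lemma sem_proj_represents plus Y A phi :
  represents A phi -> represents (sem_proj plus Y A) (proj plus Y phi).
Proof.
move=> [phiL Aphi]; split; first exact: proj_supported.
move=> p; have In_ans p' : List.In p' (answers phi p.1 Y) <->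
    A p' /\ restrict Y p'.1 = p.1.
  rewrite In_pmap mem_filter Aphi; split=> [[/andP[/eqP]]|[phip /eqP->]] //.
  by split=> //; apply: phiL; rewrite phip.
have nd : NoDup (answers phi p.1 Y) by apply/NoDup_pmap/filter_uniq/undup_uniq.
rewrite proj_answers oplus_big_Some; split=> [[l [ndl In_l l0 ->]]|].
  have perm : Permutation l (answers phi p.1 Y).
    by apply: NoDup_Permutation => // p'; rewrite In_l In_ans.
  rewrite (big_Permutation _ _ perm); case: nilP => // ans0.
  by move: perm; rewrite ans0 => /Permutation_sym/Permutation_nil.
by case: nilP => // ans0 [eqp]; exists (answers phi p.1 Y).
Qed.

End Relations.

Section Semantics.
Context (S : schema) (V : finType) (C : eqType) (K : Type).
Context (g : query S V C K) (D : database S C) (nu : fact S C -> K).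

Definition consts : seq C := flatten [seq f.2 | f <- facts D].

Lemma fact_consts (f : fact S C) c : f \in facts D -> c \in f.2 -> c \in consts.
Proof. by move=> fD cf; apply/flatten_mapP; exists f. Qed.

Lemma apply_atom_val (a : atom S V C) (h : assignment V C) x c :
  x \in avars a -> h x = Some c -> c \in (apply_atom h a).2.
Proof.
by rewrite inE mem_pmap => xa hx; apply/mapP; exists (inl x).
Qed.

Definition join_val (h : assignment V C) : option K :=
  if (adom h == qvars (atoms g)) &&
     all (fun a => apply_atom h a \in facts D) (atoms g)
  then Some (\big[mul g/cm_one (mul g)]_(a <- atoms g) nu (apply_atom h a))
  else None.

Lemma qvarsP (q : seq (atom S V C)) x :
  reflect (exists2 a, a \in q & x \in avars a) (x \in qvars q).
Proof.
rewrite /qvars; elim: q => [|a q IHq].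
  by rewrite big_nil inE; constructor=> -[].
rewrite big_cons inE; apply: (iffP orP) => [[xa|/IHq[b bq xb]]|[b]].
- by exists a => //; rewrite mem_head.
- by exists b => //; rewrite inE bq orbT.
- by rewrite inE => /orP[/eqP->|bq] xb; [left|right; apply/IHq; exists b].
Qed.

Lemma join_represents : represents consts (sem_join (mul g) (atoms g) D nu) join_val.
Proof.
split=> [h|p]; rewrite /join_val.
  case: ifP => // /andP[/eqP hq /allP hD] _; apply: mem_all_assignments => x c hx.
  have /qvarsP[a aq xa] : x \in qvars (atoms g) by rewrite -hq inE hx.
  exact: fact_consts (hD a aq) (apply_atom_val xa hx).
split=> [[[-> ->] ->]|]; first by rewrite eqxx.
by case: ifP => // /andP[/eqP ? ?] [eqp].
Qed.

Definition sem_val : assignment V C -> option K :=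
  foldl (fun phi s => proj consts s.1 s.2 phi) join_val (steps g).

Lemma sem_represents : represents consts (sem g D nu) sem_val.
Proof.
rewrite /sem /sem_val; elim: (steps g) (sem_join _ _ _ _) join_val join_represents => //=.
by move=> s l IHl A phi /(sem_proj_represents s.1 s.2)/IHl.
Qed.

End Semantics.

(** * Messages along the join tree *)

Section Atoms.
Context (S : schema) (V : finType) (C : eqType).
Implicit Types (h : assignment V C) (a : atom S V C).

Lemma eq_apply_atom h1 h2 a :
  {in avars a, h1 =1 h2} -> apply_atom h1 a = apply_atom h2 a.
Proof.
move=> eq12; congr pair; apply: eq_in_pmap => -[x|c] //= xa.
by apply: eq12; rewrite inE.
Qed.

Lemma apply_atom_restrict (X : {set V}) h a :
  avars a \subset X -> apply_atom (restrict X h) a = apply_atom h a.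
Proof.
by move=> /subsetP aX; apply: eq_apply_atom => x /aX; rewrite ffunE => ->.
Qed.

Lemma onth_apply_atom h a j : avars a \subset adom h ->
  onth (apply_atom h a).2 j = obind (term_val h) (onth a.2 j).
Proof.
case: a => R ts /subsetP ah /=.
have {}ah : {in ts, forall t, term_val h t}.
  move=> [x|c] //= xt; have := ah x; rewrite !inE => /(_ xt).
  by case: (h x).
elim: ts j ah => [|t ts IH] [|j] ah //=.
  by case: (term_val h t) (ah t (mem_head _ _)).
case: (term_val h t) (ah t (mem_head _ _)) => //= c _.
by apply: IH => t' t'ts; apply: ah; rewrite inE t'ts orbT.
Qed.

(* A variable takes its value from its first occurrence. *)
Definition read_atom a (f : fact S C) : assignment V C :=
  [ffun x => if x \in avars a then onth f.2 (index (inl x) a.2) else None].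

(** Rebuilding the fact from the values read in it tests at once the constants of the atom and its
    repeated variables. *)
Definition matches a (f : fact S C) : bool := apply_atom (read_atom a f) a == f.

Lemma adom_read_atom a f : size f.2 = size a.2 -> adom (read_atom a f) = avars a.
Proof.
move=> fa; apply/setP=> x; rewrite inE ffunE; case: ifP => // xa.
have : onth f.2 (index (inl x) a.2) by rewrite onthTE fa index_mem; move: xa; rewrite inE.
by case: (onth _ _).
Qed.

Lemma read_apply_atom h a : avars a \subset adom h ->
  read_atom a (apply_atom h a) = restrict (avars a) h.
Proof.
move=> ah; apply/ffunP=> x; rewrite !ffunE; case: ifP => //; rewrite inE => xa.
by rewrite onth_apply_atom // onthE (nth_map (inl x)) ?index_mem // nth_index.
Qed.

Lemma matches_apply_atom h a : avars a \subset adom h -> matches a (apply_atom h a).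
Proof.
by move=> ah; rewrite /matches read_apply_atom // apply_atom_restrict.
Qed.

End Atoms.

Section GeneralizedSums.
Context (K : Type).

(* The operation is missing at the level of the free variables, where all the
   sums have at most one term. *)
Definition add_opt (op : option (cmonoid K)) (x y : option K) : option K :=
  match x, y with
  | Some a, Some b => Some (if op is Some o then o a b else a)
  | Some a, None => Some a
  | None, _ => y
  end.

Definition sum_opt op (xs : seq (option K)) : option K := foldl (add_opt op) None xs.

Lemma sum_opt_big o (I : Type) (r : seq I) (F : I -> option K) :
  sum_opt (Some o) [seq F i | i <- r] = \big[oplus o/None]_(i <- r) F i.
Proof.
rewrite /sum_opt (_ : add_opt (Some o) = oplus o) //.
suff acc x : foldl (oplus o) x [seq F i | i <- r] =
    oplus o x (\big[oplus o/None]_(i <- r) F i) by rewrite acc.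
elim: r x => [|i r IHr] x /=; first by rewrite big_nil Monoid.mulm1.
by rewrite IHr big_cons Monoid.mulmA.
Qed.

Lemma sum_opt_rcons op xs x :
  sum_opt op (rcons xs x) = add_opt op (sum_opt op xs) x.
Proof. by rewrite /sum_opt foldl_rcons. Qed.

Lemma big_oplus_support o (I : eqType) (r1 r2 : seq I) (F : I -> option K) :
  uniq r1 -> uniq r2 -> (forall i, F i <> None -> (i \in r1) = (i \in r2)) ->
  \big[oplus o/None]_(i <- r1) F i = \big[oplus o/None]_(i <- r2) F i.
Proof.
move=> u1 u2 r12.
have drop (r : seq I) : \big[oplus o/None]_(i <- r) F i =
    \big[oplus o/None]_(i <- [seq i <- r | F i]) F i.
  rewrite big_filter [RHS]big_mkcond; apply: eq_bigr => i _.
  by case: (F i).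
rewrite [LHS]drop [RHS]drop; apply/perm_big/uniq_perm; rewrite ?filter_uniq //.
move=> i; rewrite !mem_filter; have := r12 i; case: (F i) => //= a -> //.
Qed.

End GeneralizedSums.

Section Messages.
Context (S : schema) (V : finType) (C : eqType) (K : Type).
Context (g : query S V C K) (T : connex_join_tree g).
Context (D : database S C) (nu : fact S C -> K).
Context (s : seq (node T)) (par : node T -> option (node T)) (thr : nat).
Local Notation N := (node T).
Local Notation at_ := (@jt_atom _ _ _ _ _ T).
Local Notation times := (mul g).
Local Notation "\prod_ ( i | P ) F" :=
  (\big[omul times/Some (cm_one times)]_(i | P) F).
Local Notation assignment := (assignment V C).
Implicit Types (X : {set V}) (v c u : N) (h z : assignment) (f : fact S C) (P : {set N}).

Definition nvars v : {set V} := avars (at_ v).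
Definition node_facts v : seq (fact S C) := facts_of D (at_ v).1.
Definition read v (f : fact S C) : assignment := read_atom (at_ v) f.
Definition fits v (f : fact S C) : bool := matches (at_ v) f.
Definition level v : nat := count (fun A : {set N} => v \in A) (jt_witness T).
Definition shared c : {set V} := if par c is Some p then nvars c :&: nvars p else set0.
Definition op_at v : option (cmonoid K) := onth (unzip1 (steps g)) (level v).

Definition init v h : option K :=
  let f := apply_atom h (at_ v) in if f \in facts D then Some (nu f) else None.

(** Abstract in [E] because values and messages are mutually recursive; [tuple_val_rec] ties the
    knot. *)
Definition message_of (E : N -> assignment -> option K) c z : option K :=
  sum_opt (op_at c)
    [seq E c (read c f) | f <- [seq f <- node_facts c |
       fits c f && (restrict (shared c) (read c f) == z)]].

(* Messages of level at least [thr] only filter.  With [thr] above all levels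
   the message of the root is the result of a query without free variables;
   with [thr = size (steps g)] the values at the nodes of the last witness
   subtree are the factors of the values of the answers. *)
Definition gate c (x : option K) : option K :=
  if level c < thr then x else omap (fun=> cm_one times) x.

(* The first argument is fuel; since parents precede their children in [s],
   [size s] is enough. *)
Fixpoint tuple_val_rec (k : nat) v h : option K :=
  if k is k'.+1 then
    omul times (init v h)
      (\prod_(c | par c == Some v)
         gate c (message_of (tuple_val_rec k') c (restrict (shared c) h)))
  else None.

Definition tuple_val : N -> assignment -> option K := tuple_val_rec (size s).
Definition message : N -> assignment -> option K := message_of tuple_val.

Lemma eq_message_of E E' c z :
  E c =1 E' c -> message_of E c z = message_of E' c z.
Proof. by move=> eqE; congr sum_opt; apply: eq_map => f; apply: eqE. Qed.

Hypothesis s_ord : parent_order (@edge V T) s par.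
Hypothesis s_all : forall v, v \in s.

(** Fuel stops mattering once it reaches the number of nodes from [v] to the end of [s], since
    indices grow from parent to child. *)
Lemma tuple_valE v h :
  tuple_val v h = omul times (init v h)
    (\prod_(c | par c == Some v) gate c (message c (restrict (shared c) h))).
Proof.
have stable k : forall v h, size s - index v s <= k ->
    tuple_val_rec k v h = tuple_val_rec k.+1 v h.
  elim: k => [|k IHk] u h' uk; first by move: (s_all u) uk; rewrite -index_mem -subn_gt0; case: (_ - _).
  rewrite [LHS]/= [RHS]/=; congr omul; apply: eq_bigr => c /eqP cu.
  congr gate; apply: eq_message_of => h''; apply: IHk.
  by have := par_lt s_ord s_all cu; lia.
by rewrite /message /tuple_val [LHS]stable ?leq_subr.
Qed.

Definition dom P : {set V} := \bigcup_(v in P) nvars v.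

(** A root outside [P] counts as well, so that the boundary of the empty set is the root and its
    elimination is no special case. *)
Definition boundary P : pred N :=
  fun c => (c \notin P) && (if par c is Some p then p \in P else true).

(* The join of the atoms of [P] and of the messages entering [P]. *)
Definition partial_val P h : option K :=
  if adom h == dom P then
    omul times (\prod_(v | v \in P) init v h)
      (\prod_(c | boundary P c) message c (restrict (shared c) h))
  else None.

Lemma init_restrict X v h : nvars v \subset X -> init v (restrict X h) = init v h.
Proof. by move=> vX; rewrite /init apply_atom_restrict. Qed.

Lemma shared_sub c : shared c \subset nvars c.
Proof. by rewrite /shared; case: (par c) => [p|]; rewrite ?subsetIl ?sub0set. Qed.

Lemma shared_par c p : par c = Some p -> shared c \subset nvars p.
Proof. by rewrite /shared => ->; rewrite subsetIr. Qed.

Lemma tuple_val_restrict X v h :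
  nvars v \subset X -> tuple_val v (restrict X h) = tuple_val v h.
Proof.
move=> vX; rewrite !tuple_valE init_restrict //; congr omul.
apply: eq_bigr => c /eqP cv; rewrite restrict_restrict //.
exact: subset_trans (shared_par cv) vX.
Qed.

Lemma init_consts v h x y : init v h <> None -> x \in nvars v -> h x = Some y ->
  y \in consts D.
Proof.
rewrite /init; case: ifP => // fD _ xv hx.
exact: fact_consts fD (apply_atom_val xv hx).
Qed.

Lemma tuple_val_init v h : tuple_val v h <> None -> init v h <> None.
Proof. by rewrite tuple_valE; case: (init v h). Qed.

Lemma partial_val_supported P : supported (consts D) (partial_val P).
Proof.
move=> h; rewrite /partial_val; case: eqP => // hP nN.
apply: mem_all_assignments => x y hx.
have /bigcupP[v vP xv] : x \in dom P by rewrite -hP inE hx.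
apply: init_consts (hx) => //; last exact: xv; move=> ih; apply: nN.
by rewrite (@omul_big_None _ times _ _ _ _ v) ?mem_index_enum.
Qed.

Lemma partial_val_adom P h : partial_val P h <> None -> adom h = dom P.
Proof. by rewrite /partial_val; case: eqP. Qed.

Lemma nvars_dom P v : v \in P -> nvars v \subset dom P.
Proof. by move=> vP; apply: bigcup_sup vP. Qed.

Hypothesis s_root : forall u v, par v = None -> level u <= level v.

Lemma jtree : is_tree (@edge V T).
Proof. by have [[]] := jt_join T. Qed.

Lemma bag_nvars v : bag v = nvars v.
Proof. by have [_ _ _ _ /(_ v)[]] := jt_join T. Qed.

Lemma nvars_connected x : connected (@edge V T) [set v | x \in nvars v].
Proof.
have [[_ sub _ con _] _ _ _ _] := jt_join T.
move=> u v; rewrite [u \in _]in_set => xu; have xq : x \in qvars (atoms g).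
  by have [/subsetP/(_ x)+ _] := sub u; rewrite bag_nvars; apply.
suff -> : [set v : N | x \in nvars v] = [set v | x \in bag v].
  by move=> xv; apply: con; rewrite // in_set bag_nvars.
by apply/setP=> w; rewrite in_set [RHS]in_set bag_nvars.
Qed.

Lemma root_in P u v : up_closed par P -> u \in P -> par v = None -> v \in P.
Proof.
move=> upP uP vn; have v0 := par_none s_ord s_all vn.
suff down k : forall w, index w s <= k -> w \in P -> v \in P by apply: (down _ u).
elim: k => [|k IHk] w wk wP.
  by have <- : w = v by apply: (index_eq s_all); rewrite v0; lia.
case wp: (par w) => [p|].
  by apply: IHk (upP _ _ wP wp); have := par_lt s_ord s_all wp; lia.
by have <- : w = v by apply: (index_eq s_all); rewrite v0 (par_none s_ord s_all wp).
Qed.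

(** The running intersection property in the form used for elimination: the nodes containing [x] are
    connected and meet both [v] and [P], so by [parent_in] they include the parent of [v]. *)
Lemma boundary_shared P v x : up_closed par P -> boundary P v ->
  x \in nvars v -> x \in dom P -> x \in shared v.
Proof.
move=> upP /andP[vP]; case vp: (par v) => [p|] pP xv /bigcupP[u uP xu].
  rewrite /shared vp in_setI xv /=.
  have H := parent_in jtree s_ord s_all upP vP vp pP (nvars_connected (x := x)) (u := u).
  have : p \in [set w | x \in nvars w] by apply: H; rewrite // in_set.
  by rewrite in_set.
by rewrite (root_in upP uP vp) in vP.
Qed.

Lemma dom_setU1 P v : dom (v |: P) = nvars v :|: dom P.
Proof. by rewrite /dom bigcup_setU big_set1. Qed.

Lemma at_atoms v : at_ v \in atoms g.
Proof. by have [_ _ _ /(_ (at_ v))[_ +] _] := jt_join T; apply; exists v. Qed.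

Lemma at_size v : size (at_ v).2 = arity (at_ v).1.
Proof. by have /allP/(_ _ (at_atoms v))/eqP := atoms_arity g. Qed.

Lemma node_facts_size v f : f \in node_facts v -> size f.2 = size (at_ v).2.
Proof.
rewrite mem_filter => /andP[/eqP fv fD].
by have /allP/(_ f fD)/eqP-> := facts_arity D; rewrite fv at_size.
Qed.

Lemma adom_read v f : f \in node_facts v -> adom (read v f) = nvars v.
Proof. by move/node_facts_size; apply: adom_read_atom. Qed.

Lemma init_read v f : f \in node_facts v -> fits v f -> init v (read v f) = Some (nu f).
Proof.
rewrite mem_filter => /andP[_ fD] /eqP fv.
by rewrite /init [apply_atom _ _]fv fD.
Qed.

Lemma init_node_facts v h : nvars v \subset adom h -> init v h <> None ->
  [/\ apply_atom h (at_ v) \in node_facts v, fits v (apply_atom h (at_ v))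
    & read v (apply_atom h (at_ v)) = restrict (nvars v) h].
Proof.
move=> vh; rewrite /init; case: ifP => // fD _; split.
- by rewrite mem_filter /= eqxx.
- exact: matches_apply_atom.
- exact: read_apply_atom.
Qed.

(** * Elimination of one node *)

Section Elimination.
Context (P : {set N}) (v : N).
Hypotheses (upP : up_closed par P) (upvP : up_closed par (v |: P)) (vP : v \notin P).
Hypothesis children_out : forall c, par c = Some v -> c \notin P /\ level c < thr.

Let Q := v |: P.

Lemma boundary_v : boundary P v.
Proof.
rewrite /boundary vP; case vp: (par v) => [p|] //=.
have := upvP (setU11 v P) vp; rewrite in_setU1 => /orP[/eqP pv|//].
by have := par_lt s_ord s_all vp; rewrite pv ltnn.
Qed.

(** The factor common to both sides of the elimination. It only depends on the variables of [P], so
    it is constant on each fibre of the projection. *)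
Definition rest h : option K :=
  omul times (\prod_(u | u \in P) init u h)
    (\prod_(c | boundary P c && (c != v)) message c (restrict (shared c) h)).

Lemma rest_restrict h : rest (restrict (dom P) h) = rest h.
Proof.
congr omul; apply: eq_bigr => u; first by move=> uP; rewrite init_restrict ?nvars_dom.
move=> /andP[/andP[uP pP] uv]; rewrite restrict_restrict //.
case up: (par u) pP => [p|] pP; first exact: subset_trans (shared_par up) (nvars_dom pP).
by rewrite /shared up sub0set.
Qed.

Lemma partial_val_rest h : adom h = dom P ->
  partial_val P h = omul times (rest h) (message v (restrict (shared v) h)).
Proof.
move=> hP; rewrite /partial_val hP eqxx /rest (bigD1 v boundary_v) /=.
by rewrite -Monoid.mulmA; congr omul; rewrite Monoid.mulmC.
Qed.

Lemma par_neq c : par c = Some v -> c != v.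
Proof. by move=> cv; apply: contraTneq (par_lt s_ord s_all cv) => ->; rewrite ltnn. Qed.

Lemma boundary_children c : boundary Q c =
  (boundary P c && (c != v)) || (par c == Some v).
Proof.
rewrite /boundary /Q in_setU1 negb_or.
have [cv|cv] := eqVneq (par c) (Some v).
  by rewrite cv setU11 (par_neq cv) (children_out cv).1 orbT.
rewrite orbF; case cp: (par c) cv => [p|] cv; last by rewrite !andbT andbC.
have pv : p != v by apply: contra_neq cv => ->.
by rewrite in_setU1 (negPf pv) [RHS]andbC andbA.
Qed.

Lemma partial_val_tuple h : adom h = dom Q ->
  partial_val Q h = omul times (rest h) (tuple_val v h).
Proof.
move=> hP; rewrite /partial_val hP eqxx /rest (bigD1 v) ?setU11 //=.
rewrite (eq_bigl (fun u => u \in P)); last first.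
  move=> u; rewrite in_setU1; case: eqP => [->|]; rewrite ?andbT //=.
  by rewrite (negPf vP).
rewrite [X in omul _ _ X](bigID (fun c => par c == Some v)) /=.
rewrite [X in omul _ _ (omul _ X _)](eq_bigl (fun c => par c == Some v)); last first.
  by move=> c; rewrite boundary_children; case: (par c =P Some v); rewrite ?orbT ?andbF.
rewrite [X in omul _ _ (omul _ _ X)](eq_bigl (fun c => boundary P c && (c != v))); last first.
  move=> c; rewrite boundary_children; case: (par c =P Some v) => [cv|]; last by rewrite orbF andbT.
  by rewrite /boundary cv (negPf vP) !andbF.
rewrite tuple_valE [X in _ = omul _ _ (omul _ _ X)](eq_bigr
  (fun c => message c (restrict (shared c) h))); last first.
  by move=> c /eqP cv; rewrite /gate (children_out cv).2.
by rewrite Monoid.mulmACA Monoid.mulmC.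
Qed.

Definition glue z h : assignment := [ffun x => if z x is Some y then Some y else h x].

Lemma glue_dom z h : adom z = dom P -> adom h = nvars v -> adom (glue z h) = dom Q.
Proof.
move=> zP hv; rewrite dom_setU1 -zP -hv; apply/setP => x.
by rewrite in_setU ![_ \in adom _]in_set ffunE orbC; case: (z x).
Qed.

Lemma glue_left z h : adom z = dom P -> restrict (dom P) (glue z h) = z.
Proof.
move=> zP; apply/ffunP => x; rewrite !ffunE -zP in_set.
by case: (z x).
Qed.

Lemma glue_right z h : adom z = dom P -> adom h = nvars v ->
  restrict (shared v) h = restrict (shared v) z -> restrict (nvars v) (glue z h) = h.
Proof.
move=> zP hv hz; apply/ffunP => x; rewrite !ffunE -hv in_set.
case hx: (h x) => [y|] //=; case zx: (z x) => [y'|] //=.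
have xv : x \in nvars v by rewrite -hv in_set hx.
have xP : x \in dom P by rewrite -zP in_set zx.
have /ffunP/(_ x) := hz.
by rewrite !ffunE (boundary_shared upP boundary_v xv xP) hx zx.
Qed.

(* By the running intersection property, the extensions of [z] to the
   variables of [v] are glued from [z] and the facts of [v] that agree with [z]
   on the shared variables. *)
Lemma message_sum (o : cmonoid K) z :
  op_at v = Some o -> adom z = dom P -> z \in all_assignments V (consts D) ->
  \big[oplus o/None]_(h <- all_assignments V (consts D) |
      (restrict (dom P) h == z) && (adom h == dom Q)) tuple_val v h =
  message v (restrict (shared v) z).
Proof.
move=> vo zP zL; have upP' := upP; rewrite /message /message_of vo sum_opt_big.
set r := [seq f <- node_facts v | _].
have rP f : f \in r -> [/\ f \in node_facts v, fits v f, adom (read v f) = nvars v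
    & restrict (shared v) (read v f) = restrict (shared v) z].
  by rewrite mem_filter => /andP[/andP[ff /eqP fz] fv]; rewrite adom_read.
(* Facts of [v] are exchanged for assignments by sending [f] to [glue z (read v f)]; the two index
   lists are then compared only where the summand is not [None]. *)
have -> : \big[oplus o/None]_(f <- r) tuple_val v (read v f) =
    \big[oplus o/None]_(h <- [seq glue z (read v f) | f <- r]) tuple_val v h.
  rewrite big_map big_seq [RHS]big_seq; apply: eq_bigr => f /rP[fv ff fa fz].
  by rewrite -(tuple_val_restrict _ (subxx _)) [in LHS]/= -[in RHS](tuple_val_restrict _ (subxx _)) glue_right // -{1}fa restrict_id.
rewrite -big_filter; apply: big_oplus_support => [||h hN].
- by rewrite filter_uniq ?undup_uniq.
- rewrite map_inj_in_uniq => [|f1 f2 /rP[_ /eqP f1f f1a f1z] /rP[_ /eqP f2f f2a f2z] eq12].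
    by rewrite !filter_uniq ?facts_uniq.
  by rewrite -f1f -f2f -[X in apply_atom X _ = _](glue_right zP f1a f1z) eq12 glue_right.
have iN := tuple_val_init hN; rewrite mem_filter.
apply/andP/mapP => [[/andP[/eqP hz /eqP hQ] hL]|[f /rP[fv ff fa fz] ->]].
  have vh : nvars v \subset adom h by rewrite hQ nvars_dom ?setU11.
  have [fv ff fr] := init_node_facts vh iN.
  exists (apply_atom h (at_ v)); last first.
    rewrite fr; apply/ffunP => x; rewrite -hz !ffunE.
    case: ifP => xP; first by case: (h x) => //; rewrite if_same.
    case: ifP => // xv; apply/eqP; have : x \notin adom h.
      by rewrite hQ dom_setU1 in_setU xP xv.
    by rewrite in_set negbK.
  rewrite mem_filter ff fv fr restrict_restrict ?shared_sub //= andbT -hz.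
  apply/eqP/ffunP => x; rewrite !ffunE; case: ifP => // xv; case: ifP => // /negP[].
  move: xv; rewrite /shared; case vp: (par v) => [p|]; rewrite ?in_set0 //.
  rewrite in_setI => /andP[_ xp]; apply: (subsetP (nvars_dom _)) xp.
  by have := boundary_v; rewrite /boundary vp => /andP[].
split; first by rewrite glue_left // glue_dom // !eqxx.
apply: mem_all_assignments => x y; rewrite ffunE.
case zx: (z x) => [y'|] => [[<-]|fx]; first exact: all_assignments_val zL zx.
have xv : x \in nvars v by rewrite -fa in_set fx.
by apply: init_consts xv fx; rewrite init_read.
Qed.

(** Distributivity pulls [rest] out of the sum, and [message_sum] evaluates what remains. Outside
    the universe or on a wrong domain, both sides are [None]. *)
Lemma sum_partial_val (o : cmonoid K) : op_at v = Some o ->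
  right_distributive times o -> proj (consts D) o (dom P) (partial_val Q) =1 partial_val P.
Proof.
move=> vo dist z; have [zL|zL] := boolP (z \in all_assignments V (consts D)); last first.
  case pz: (partial_val P z) => [k|]; first by rewrite (@partial_val_supported P) ?pz in zL.
  case qz: (proj _ _ _ _ _) => [k|] //; case/negP: zL.
  by apply: (@proj_supported _ _ _ _ o (dom P) (partial_val Q)); rewrite qz.
have [zP|zP] := eqVneq (adom z) (dom P); last first.
  rewrite /partial_val (negPf zP); apply: big1 => h /eqP hz; case: eqP => // hQ.
  by rewrite -hz adom_restrict hQ dom_setU1 (setIidPl (subsetUr _ _)) eqxx in zP.
rewrite partial_val_rest // -(message_sum vo zP zL) omul_big_oplus // /proj.
rewrite big_mkcondr /=; apply: eq_bigr => h /eqP hz; case: eqP => hQ.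
  by rewrite partial_val_tuple // -(rest_restrict h) hz.
by rewrite /partial_val; case: eqP.
Qed.

(* At the level of the free variables there is no operation to sum with, but
   if there are no such variables then there is at most one term. *)
Lemma partial_val_novars : nvars v = set0 -> partial_val Q =1 partial_val P.
Proof.
move=> v0 z; have QP : dom Q = dom P by rewrite dom_setU1 v0 set0U.
have [zP|zP] := eqVneq (adom z) (dom P); last by rewrite /partial_val QP (negPf zP).
rewrite partial_val_rest // partial_val_tuple ?QP //; congr omul.
have -> : restrict (shared v) z = restrict (nvars v) z.
  by have := shared_sub v; rewrite v0 subset0 => /eqP->.
rewrite -(tuple_val_restrict _ (subxx _)) /message /message_of.
set z0 := restrict _ z; set r := [seq f <- _ | _].
have vz0 : nvars v \subset adom z0 by rewrite v0 sub0set.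
have z0r X : X \subset nvars v -> restrict X z0 = z0.
  rewrite v0 subset0 => /eqP->; apply/ffunP=> x.
  by rewrite !ffunE v0 in_set0.
have rP f : f \in r -> f = apply_atom z0 (at_ v).
  rewrite mem_filter => /andP[/andP[/eqP ff _] _]; rewrite -[LHS]ff.
  by apply: eq_apply_atom => x; rewrite [avars _]v0 in_set0.
have ur : uniq r by rewrite !filter_uniq ?facts_uniq.
case er: r rP ur => [|f [|f' r']] rP ur.
- rewrite /=; case tv: (tuple_val v z0) => [k|] //.
  have iN : init v z0 <> None by apply: tuple_val_init; rewrite tv.
  have [fv ff fr] := init_node_facts vz0 iN.
  have : apply_atom z0 (at_ v) \in r.
    by rewrite mem_filter ff fv fr /= !z0r ?shared_sub ?eqxx.
  by rewrite er.
- have rf : read v f = z0.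
    rewrite [in LHS](rP f (mem_head _ _)) [LHS](read_apply_atom vz0).
    exact: (z0r (nvars v) (subxx _)).
  by rewrite /sum_opt [foldl _ _ _]/= rf.
- have f'r : f' \in [:: f, f' & r'] by rewrite in_cons mem_head orbT.
  have ff' : f = f' := etrans (rP f (mem_head _ _)) (esym (rP f' f'r)).
  by rewrite ff' cons_uniq mem_head in ur.
Qed.

End Elimination.

(** * Witness subtrees as level sets *)

Definition above (L : nat) : {set N} := [set v | L <= level v].

(** The sets decrease, so those containing [v] form an initial segment of the list, of length
    [level v]; the count therefore determines them. *)
Lemma mem_witness L v : (v \in nth set0 (jt_witness T) L) = (L < level v).
Proof.
have [_ _] := jt_connex T; rewrite /level.
elim: (jt_witness T) L => [|A W IH] L /= AW; first by rewrite nth_nil in_set0.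
case vA: (v \in A); first by case: L => [|L] //=; rewrite IH // (path_sorted AW).
have subA : all (fun B : {set N} => B \subset A) W.
  by apply: order_path_min AW => B1 B2 B3 s12 s23; apply: subset_trans s23 s12.
rewrite add0n (eq_in_count (a2 := pred0)); last first.
  by move=> B /(allP subA)/subsetP BA; apply: contraFF vA => /BA.
rewrite count_pred0 ltn0; case: L => // L /=; apply: contraFF vA => vW.
case: (ltnP L (size W)) vW => [lt|ge]; last by rewrite nth_default ?in_set0.
by apply/subsetP/(allP subA)/mem_nth.
Qed.

Lemma witness_above L A : onth (jt_witness T) L = Some A -> A = above L.+1.
Proof. by move=> /(onth_nth set0) AL; apply/setP => v; rewrite in_set -AL mem_witness. Qed.

Lemma level_le v : level v <= size (steps g).
Proof. by have [<- _ _] := jt_connex T; apply: count_size. Qed.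

Lemma onth_witness L : L < size (steps g) -> onth (jt_witness T) L = Some (above L.+1).
Proof.
have [sW _ _] := jt_connex T; rewrite -sW -onthTE.
by case AL: (onth _ _) => [A|] // _; rewrite (witness_above AL).
Qed.

Lemma above_witness_subtree L st : onth (steps g) L = Some st ->
  witness_subtree (T := T) st.2 (above L.+1).
Proof.
move=> sL; have [_ wit _] := jt_connex T; apply: wit (sL) _.
by apply: onth_witness; rewrite -onthTE sL.
Qed.

Lemma dom_above L st : onth (steps g) L = Some st -> dom (above L.+1) = st.2.
Proof.
move=> /above_witness_subtree[_ <-].
by apply: eq_bigr => v _; rewrite bag_nvars.
Qed.

Lemma nvars_sub v : nvars v \subset qvars (atoms g).
Proof. by apply/subsetP => x xv; apply/qvarsP; exists (at_ v); rewrite ?at_atoms. Qed.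

Lemma dom_setT : dom setT = qvars (atoms g).
Proof.
apply/eqP; rewrite eqEsubset; apply/andP; split.
  by apply/bigcupsP => v _; apply: nvars_sub.
apply/subsetP => x /qvarsP[a aq xa]; have [_ _ _ /(_ a)[+ _] _] := jt_join T.
by case/(_ aq) => v va; apply/bigcupP; exists v; rewrite // /nvars va.
Qed.

Lemma above0 : above 0 = setT.
Proof. by apply/setP=> v; rewrite !in_set. Qed.

Lemma dom_free : dom (above (size (steps g))) = free_vars g.
Proof.
rewrite /free_vars; case: (lastP (steps g)) (@dom_above (size (steps g)).-1) => [_|l st].
  by rewrite above0 dom_setT.
move=> /(_ st); rewrite size_rcons /unzip2 map_rcons last_rcons; apply.
by rewrite -cats1 onth_cat /= ltnn subnn.
Qed.

(** A non-empty witness subtree contains the root, whose level is maximal, and it is connected; by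
    [parent_in] it contains the parent of each of its nodes. *)
Lemma level_mono v p : par v = Some p -> level v <= level p.
Proof.
move=> vp; case Lv: (level v) => [|L] //.
have Ln : L < size (steps g) by rewrite -Lv level_le.
have [st sL] : exists st, onth (steps g) L = Some st.
  by move: Ln; rewrite -onthTE; case: onth => // st _; exists st.
have [con _] := above_witness_subtree sL.
have s0 : 0 < size s by have := s_all v; case: (s).
pose u := nth v s 0.
have u0 : index u s = 0 by rewrite /u index_uniq //; case: s_ord.
have un : par u = None.
  by case up: (par u) => [q|] //; have := par_lt s_ord s_all up; rewrite u0.
have pv := par_lt s_ord s_all vp.
have : p \in above L.+1.
  apply: (parent_in jtree s_ord s_all (up_closed_before s_ord s_all (v := v)) _ vp _ con (u := u)).
  - by rewrite in_set ltnn.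
  - by rewrite in_set.
  - by rewrite in_set Lv.
  - by rewrite in_set -Lv s_root.
  - by rewrite in_set u0; lia.
by rewrite in_set.
Qed.

Lemma above_up_closed L : up_closed par (above L).
Proof. by move=> v p; rewrite !in_set => Lv /level_mono; apply: leq_trans. Qed.

(** The node of [P] outside [Q] that comes last in [s] has no child in [P], so it may be removed
    without losing closure under parents. *)
Lemma setD1_last P Q : up_closed par P -> up_closed par Q -> Q \proper P ->
  exists v, [/\ v \in P, v \notin Q, Q \subset P :\ v, up_closed par (P :\ v)
    & forall c, par c = Some v -> c \notin P].
Proof.
move=> upP upQ /properP[QP [v0 v0P v0Q]].
have [|v /andP[vP vQ] vmax] := @arg_maxnP _ v0 (fun v => (v \in P) && (v \notin Q)) (index^~ s).
  by rewrite v0P.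
have noc c : par c = Some v -> c \notin P.
  move=> cv; apply/negP => cP; have := par_lt s_ord s_all cv.
  suff cv' : index c s <= index v s by rewrite ltnNge cv'.
  by apply: vmax; rewrite cP; apply: contra vQ => cQ; apply: upQ cQ cv.
exists v; split=> //.
  by apply/subsetP => u uQ; rewrite in_setD1 (subsetP QP) // andbT; apply: contraNneq vQ => <-.
move=> u p; rewrite !in_setD1 => /andP[uv uP] up; rewrite (upP u) // andbT.
by apply: contraL uP => /eqP pv; apply: noc; rewrite up pv.
Qed.

Hypothesis semiring : semiring_query g.

(** The nodes of [P] still to be removed all have level exactly [L], hence the same operation. They
    go one at a time: [proj_proj] inserts the projection that [sum_partial_val] computes. *)
Lemma proj_above L st P : onth (steps g) L = Some st -> L < thr ->
  up_closed par P -> above L.+1 \subset P -> P \subset above L ->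
  proj (consts D) st.1 st.2 (partial_val P) =1 partial_val (above L.+1).
Proof.
move=> sL Lthr; rewrite -(dom_above sL).
have dist : right_distributive (mul g) st.1.
  have /semiring[] // : List.In st (steps g).
  elim: (steps g) L sL {Lthr} => [|st' l IH] [|L] //=; first by case; left.
  by move/IH; right.
have [k] := ubnP #|P|; elim: k P => // k IHk P Pk upP QP PL f.
have [->|QnP] := eqVneq P (above L.+1).
  by apply: proj_id; [apply: partial_val_supported | apply: partial_val_adom].
have prop : above L.+1 \proper P by rewrite properEneq eq_sym QnP.
have [v [vP vQ QP' upP' noc]] := setD1_last upP (@above_up_closed L.+1) prop.
have vL : level v = L.
  by move/subsetP/(_ v vP): PL vQ; rewrite !in_set; lia.
have vo : op_at v = Some st.1 by rewrite /op_at vL /unzip1 onth_map sL.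
have vD : v \notin P :\ v by rewrite in_setD1 eqxx.
have out c : par c = Some v -> c \notin P :\ v /\ level c < thr.
  move=> cv; split; last by apply: leq_ltn_trans Lthr; rewrite -vL level_mono.
  by rewrite in_setD1 negb_and noc // orbT.
have upvP : up_closed par (v |: P :\ v) by rewrite setD1K.
have step := sum_partial_val upP' upvP vD out vo dist; rewrite setD1K // in step.
have domQ : dom (above L.+1) \subset dom (P :\ v).
  by apply/bigcupsP => u /(subsetP QP'); apply: nvars_dom.
rewrite -(proj_proj st.1 domQ (@partial_val_supported P)) (eq_proj _ _ _ step).
apply: IHk; rewrite // ?(subset_trans _ PL) ?subsetDl //.
by rewrite [#|P|](cardsD1 v) vP in Pk.
Qed.

Lemma atoms_perm : perm_eq (atoms g) [seq at_ v | v <- index_enum N].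
Proof.
have [_ _ inj allq _] := jt_join T.
apply: uniq_perm; rewrite ?atoms_uniq ?map_inj_uniq ?index_enum_uniq // => a.
apply/idP/mapP => [/allq[v va]|[v _ ->]]; last exact: at_atoms.
by exists v; rewrite ?mem_index_enum.
Qed.

Lemma join_val_partial : join_val g D nu =1 partial_val setT.
Proof.
move=> h; rewrite /join_val /partial_val dom_setT; case: eqP => //= hq.
rewrite [X in omul _ _ X]big_pred0 => [|c]; last by rewrite /boundary inE.
rewrite Monoid.mulm1 [RHS](eq_bigl predT) => [|v]; last by rewrite inE.
rewrite (perm_all _ atoms_perm) (perm_big _ atoms_perm) all_map big_map; case: allP => [hD|nD].
  rewrite -omul_big_Some; apply: eq_bigr => v _.
  by rewrite /init [_ \in _](hD v) // mem_index_enum.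
have [/allP //|/allPn[v vi hv]] := boolP (all (preim at_ (fun a => apply_atom h a \in facts D)) (index_enum N)).
by rewrite (@omul_big_None _ times _ _ _ _ v) // /init ifN.
Qed.

(** Only nodes of level below the number of steps are eliminated here, so with this threshold their
    messages and those of their children keep their values. *)
Theorem sem_val_partial : size (steps g) <= thr ->
  sem_val g D nu =1 partial_val (above (size (steps g))).
Proof.
move=> nthr; rewrite /sem_val -{1}(take_size (steps g)).
elim: {1 3 4}(size (steps g)) (leqnn (size (steps g))) => [|L IHL] Ln h.
  by rewrite take0 /= join_val_partial above0.
have [st sL] : exists st, onth (steps g) L = Some st.
  by move: Ln; rewrite -onthTE; case: onth => // st _; exists st.
rewrite (take_nth st) // -cats1 foldl_cat /= (onth_nth _ _ _ _ sL).
rewrite (eq_proj _ _ _ (IHL (ltnW Ln))) (proj_above sL) //.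
- exact: leq_trans Ln nthr.
- exact: above_up_closed.
- by apply/subsetP => v; rewrite !in_set => /ltnW.
Qed.

(** The nodes of the last witness subtree contain no variables, so [partial_val_novars] removes them
    without any sum, down to the empty set, whose boundary is the root. The strict bound on [thr]
    preserves the values of their messages too. *)
Theorem sem_val_closed r : size (steps g) < thr -> free_vars g = set0 ->
  par r = None -> forall z, sem_val g D nu z =
    if adom z == set0 then message r z else None.
Proof.
move=> nthr free0 rn z; rewrite sem_val_partial ?(ltnW nthr) //.
have dom0 P : P \subset above (size (steps g)) -> dom P = set0.
  move=> sub; apply/eqP; rewrite -subset0 -free0 -dom_free.
  by apply/bigcupsP => v /(subsetP sub); apply: nvars_dom.
suff down P : up_closed par P -> P \subset above (size (steps g)) ->
    partial_val P =1 partial_val set0.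
  rewrite down //; last exact: above_up_closed.
  rewrite /partial_val /dom big_set0; case: eqP => // z0.
  rewrite big_pred0 => [|v]; last by rewrite in_set0.
  rewrite Monoid.mul1m (big_pred1 r) => [|c].
    by rewrite /shared rn; congr message; rewrite -z0 restrict_id.
  rewrite /boundary in_set0 /=; case cp: (par c) => [p|].
    by rewrite in_set0; apply/esym/negP => /eqP cr; rewrite cr rn in cp.
  apply/esym/eqP/(index_eq s_all).
  by rewrite (par_none s_ord s_all cp) (par_none s_ord s_all rn).
have [k] := ubnP #|P|; elim: k P => // k IHk P Pk upP PL h.
have [->//|P0] := eqVneq P set0.
have up0 : up_closed par set0 by move=> v p; rewrite in_set0.
have [|v [vP _ _ upP' noc]] := setD1_last upP up0; first by rewrite proper0.
have vD : v \notin P :\ v by rewrite in_setD1 eqxx.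
have out c : par c = Some v -> c \notin P :\ v /\ level c < thr.
  move=> cv; split; last by apply: leq_ltn_trans nthr; apply: level_le.
  by rewrite in_setD1 negb_and noc // orbT.
have upvP : up_closed par (v |: P :\ v) by rewrite setD1K.
have v0 : nvars v = set0 by apply/eqP; rewrite -subset0 -(dom0 P) // nvars_dom.
have := partial_val_novars upvP vD out v0; rewrite setD1K // => ->.
apply: IHk; rewrite // ?(subset_trans _ PL) ?subsetDl //.
by rewrite [#|P|](cardsD1 v) vP in Pk.
Qed.

End Messages.

(** * Evaluation of input cells; selection of the matching facts *)

(* The registers [x...] are numbers of zero-dimensional work arrays.  Nodes are
   given by their codes and facts by their ranks:
   - [aPos[v, x]] is the first position of the variable x in the atom of v;
   - [aW[v, i]] is the value of fact i of v so far, bottom if it is dangling;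
   - [aTrie[v, id, c]] is the child for constant c of the node id of a trie of
     the tuples of values of the variables that v shares with its parent;
   - [aAgg[v, id]] is the message of v for the tuple that leads to id, and
     [aHead[v, id]] the first of the facts of v with this tuple, which are linked
     by [aNext[v, i]];
   - [aKey[v, i]] is the trie node of v to which fact i of the parent of v leads;
   - [aOrd[k]] is the k-th node, parents first, and [aPar[v]] the parent of v. *)
Definition xV := 0. Definition xJ := 1. Definition xI := 2. Definition xId := 3.
Definition xP := 4. Definition xCnt := 5. Definition xK := 6.
Definition aPos := Work 10. Definition aW := Work 11. Definition aTrie := Work 12.
Definition aAgg := Work 13. Definition aHead := Work 14. Definition aNext := Work 15.
Definition aKey := Work 16. Definition aOrd := Work 17. Definition aPar := Work 18.

Definition node_atom v := Read ANodeAtom [:: v].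
Definition node_rel v := Read AAtomRel [:: node_atom v].
Definition node_arity v := Read ARelArity [:: node_rel v].
Definition node_nfacts v := Read ANumFacts [:: node_rel v].
Definition node_level v := Read ANodeLevel [:: v].
Definition term_var v j := Read ATermVar [:: node_atom v; j].
Definition term_cst v j := Read ATermCst [:: node_atom v; j].
Definition fact_at v i j := Read AFact [:: node_rel v; i; j].
Definition annot v i := Read AAnnot [:: node_rel v; i].
Definition num_nodes := Read ANumAtoms [::].
(** [Add] is meant for numbers; applied to semiring elements it is ill-typed, which gives an
    expression for bottom. *)
Definition bot := Add SOne SOne.

Arguments node_atom : simpl never.
Arguments node_rel : simpl never.
Arguments node_arity : simpl never.
Arguments node_nfacts : simpl never.
Arguments node_level : simpl never.
Arguments term_var : simpl never.
Arguments term_cst : simpl never.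
Arguments fact_at : simpl never.
Arguments annot : simpl never.
Arguments num_nodes : simpl never.

Definition pos_loop : cmd :=
  for_loop xJ (node_arity (var xV))
    (If (IsBot (term_var (var xV) (var xJ))) Skip
    (If (IsBot (Read aPos [:: var xV; term_var (var xV) (var xJ)]))
       (Assign aPos [:: var xV; term_var (var xV) (var xJ)] (var xJ)) Skip)).

(** No case distinction on the term is required: at a variable [term_cst] is bottom and the first
    comparison fails; at a constant [term_var] is bottom, and so is the position read from it, so
    the second fails. *)
Definition test_fact : cmd :=
  for_loop xJ (node_arity (var xV))
    (If (Eq (fact_at (var xV) (var xI) (var xJ)) (term_cst (var xV) (var xJ))) Skip
    (If (Eq (fact_at (var xV) (var xI) (var xJ))
            (fact_at (var xV) (var xI)
               (Read aPos [:: var xV; term_var (var xV) (var xJ)]))) Skip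
       (Assign aW [:: var xV; var xI] bot))).

Definition filter_loop : cmd :=
  for_loop xI (node_nfacts (var xV))
    (Seq (Assign aW [:: var xV; var xI] (annot (var xV) (var xI))) test_fact).

Definition phase1 : cmd := for_loop xV num_nodes (Seq pos_loop filter_loop).

Definition is_input (a : array) : bool :=
  match a with AOutFlag | AOutVar | AOutVal | Work _ => false | _ => true end.

Section Programs.
Context (S : schema) (V : finType) (C : eqType) (K : Type).
Context (g : query S V C K) (T : connex_join_tree g).
Context (D : database S C) (nu : fact S C -> K).
Local Notation N := (node T).
Local Notation at_ := (@jt_atom _ _ _ _ _ T).
Local Notation times := (mul g).
Local Notation plus := (unzip1 (steps g)).
Local Notation memory := (Defs.mem C K).
Local Notation eval := (@eval C K times plus).
Local Notation holds := (@holds C K times plus).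
Local Notation wp := (@wp C K times plus).
Local Notation read := (@read _ _ _ _ _ T).
Local Notation fits := (@fits _ _ _ _ _ T).
Local Notation nvars := (@nvars _ _ _ _ _ T).
Local Notation node_facts := (@node_facts _ _ _ _ _ T D).
Local Notation level := (@level _ _ _ _ _ T).
Implicit Types (m : memory) (v u c : N) (x : V) (f : fact S C).

Definition opt (o : option K) : word C K := oapp Val Bot o.

Definition inp m : Prop :=
  forall a ks, is_input a -> m a ks = init_mem T D nu a ks.

Lemma inp_agree ws m m' : inp m -> agree ws m m' ->
  all (fun a => ~~ is_input a) ws -> inp m'.
Proof.
move=> im A /allP wsP a ks ia; rewrite A ?im //.
by apply/negP => /wsP; rewrite ia.
Qed.

Lemma inp_update m a ks w : ~~ is_input a -> inp m -> inp (update m a ks w).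
Proof.
move=> na im a' ks' ia; rewrite update_array ?im //.
by apply: contraNneq na => <-.
Qed.

Lemma onth_code (F : finType) (x : F) : onth (enum F) (code x) = Some x.
Proof. by rewrite onthE (nth_map x) ?nth_enum_rank // -cardE ltn_ord. Qed.

Lemma code_inj (F : finType) : injective (@code F).
Proof. by move=> x y /ord_inj/enum_rank_inj. Qed.

Lemma code_lt (F : finType) (x : F) : code x < #|F|.
Proof. exact: ltn_ord. Qed.

Lemma code_onto (F : finType) k : k < #|F| -> exists x : F, code x = k.
Proof. by move=> kF; exists (enum_val (Ordinal kF)); rewrite /code enum_valK. Qed.

Lemma onth_at v : onth (atoms g) (index (at_ v) (atoms g)) = Some (at_ v).
Proof.
rewrite onthE (nth_map (at_ v)) ?nth_index ?index_mem //; exact: at_atoms.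
Qed.

Lemma card_nodes : #|N| = size (atoms g).
Proof.
have [_ _ inj allq _] := jt_join T.
rewrite cardE -(size_map at_); apply/perm_size/uniq_perm.
- by rewrite map_inj_uniq ?enum_uniq.
- exact: atoms_uniq.
move=> a; apply/mapP/idP => [[v _ ->]|/allq[v va]]; first exact: at_atoms.
by exists v; rewrite ?mem_enum.
Qed.

Section Eval.
Variables (m : memory) (im : inp m) (e : expr) (v : N).
Hypothesis ev : eval m e = Num (code v).

Lemma eval_node_atom : eval m (node_atom e) = Num (index (at_ v) (atoms g)).
Proof. by rewrite (eval_read1 _ (k1 := inl (code v))) ?ev // im //= onth_code. Qed.

Lemma eval_node_rel : eval m (node_rel e) = Num (code (at_ v).1).
Proof.
rewrite (eval_read1 _ (k1 := inl (index (at_ v) (atoms g)))) ?eval_node_atom //.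
by rewrite im //= onth_at.
Qed.

Lemma eval_node_arity : eval m (node_arity e) = Num (size (at_ v).2).
Proof.
rewrite (eval_read1 _ (k1 := inl (code (at_ v).1))) ?eval_node_rel //.
by rewrite im //= onth_code /= at_size.
Qed.

Lemma eval_node_nfacts : eval m (node_nfacts e) = Num (size (node_facts v)).
Proof.
rewrite (eval_read1 _ (k1 := inl (code (at_ v).1))) ?eval_node_rel //.
by rewrite im //= onth_code.
Qed.

Lemma eval_node_level : eval m (node_level e) = Num (level v).
Proof. by rewrite (eval_read1 _ (k1 := inl (code v))) ?ev // im //= onth_code. Qed.

Section Position.
Variables (ej : expr) (j : nat).
Hypothesis ejj : eval m ej = Num j.

Lemma eval_term_var : eval m (term_var e ej) =
  cell (fun t => if t is inl x then Num (code x) else Bot) (onth (at_ v).2 j).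
Proof.
rewrite (eval_read2 _ (k1 := inl (index (at_ v) (atoms g))) (k2 := inl j))
  ?eval_node_atom ?ejj //.
by rewrite im //= onth_at.
Qed.

Lemma eval_term_cst : eval m (term_cst e ej) =
  cell (fun t => if t is inr c then Cst c else Bot) (onth (at_ v).2 j).
Proof.
rewrite (eval_read2 _ (k1 := inl (index (at_ v) (atoms g))) (k2 := inl j))
  ?eval_node_atom ?ejj //.
by rewrite im //= onth_at.
Qed.

Lemma eval_annot : eval m (annot e ej) = cell (fun f => Val (nu f)) (onth (node_facts v) j).
Proof.
rewrite (eval_read2 _ (k1 := inl (code (at_ v).1)) (k2 := inl j))
  ?eval_node_rel ?ejj //.
by rewrite im //= onth_code.
Qed.

Lemma eval_fact_at ei i : eval m ei = Num i ->
  eval m (fact_at e ei ej) = cell Cst (obind (fun f => onth f.2 j) (onth (node_facts v) i)).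
Proof.
move=> eii.
rewrite (eval_read3 _ (k1 := inl (code (at_ v).1)) (k2 := inl i) (k3 := inl j))
  ?eval_node_rel ?ejj ?eii //.
by rewrite im //= onth_code.
Qed.

End Position.
End Eval.

(** For the fictitious parent of the root, whose number is out of range: the loop over its facts
    makes no turn. *)
Lemma bound_nfacts_out m e n : inp m -> eval m e = Num n -> #|N| <= n ->
  bound (eval m (node_nfacts e)) = 0.
Proof.
move=> im en Nn; rewrite /= en /= im //= onth_default // -cardE //.
Qed.

Lemma eval_num_nodes m : inp m -> eval m num_nodes = Num #|N|.
Proof. by move=> im; rewrite /= im //= card_nodes. Qed.

Definition pos_ok m v : Prop := forall x, m aPos [:: inl (code v); inl (code x)] =
  if x \in nvars v then Num (index (inl x) (at_ v).2) else Bot.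

Lemma onth_lt (A : Type) (l : seq A) j : j < size l -> exists a, onth l j = Some a.
Proof. by rewrite -onthTE; case: onth => // a _; exists a. Qed.

Lemma index_onth (A : eqType) (a : A) (l : seq A) j :
  onth l j = Some a -> a \notin take j l -> index a l = j.
Proof.
move=> lj aj; have jl : j < size l by rewrite -onthTE lj.
rewrite -[in LHS](cat_take_drop j l) index_cat (negPf aj) (drop_nth a) //.
by rewrite (onth_nth _ _ _ _ lj) /= eqxx addn0 size_take jl.
Qed.

(** In all such bounds a turn costs its body plus 2, for the test and the increment, and the loop
    costs 2 more, for the initialisation and the last test. Here the body is two tests and an
    assignment. *)
Lemma pos_loop_spec m v : inp m -> m (Work xV) [::] = Num (code v) ->
  (forall x, m aPos [:: inl (code v); inl (code x)] = Bot) ->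
  wp pos_loop m (fun t m' => [/\ t <= 5 * size (at_ v).2 + 2, pos_ok m' v &
    forall k ks, k != inl (code v) -> m' aPos (k :: ks) = m aPos (k :: ks)]).
Proof.
move=> im mV m0; set ts := (at_ v).2.
pose I j t m' := [/\ t <= 5 * j + 1,
  forall x, m' aPos [:: inl (code v); inl (code x)] =
    if inl x \in take j ts then Num (index (inl x) ts) else Bot
  & forall k ks, k != inl (code v) -> m' aPos (k :: ks) = m aPos (k :: ks)].
apply: (wp_for (n := size ts) (I := I)).
- by split=> // x; rewrite take0 update_array // m0.
- move=> j t m' _ A mJ _; have im' := inp_agree im A isT.
  by rewrite (eval_node_arity im' (v := v)) // [LHS](A (Work xV) [::] isT).
- move=> j t m' jts A mJ [tj posj rowj]; have im' := inp_agree im A isT.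
  have mV' : eval m' (var xV) = Num (code v) by rewrite [LHS](A (Work xV) [::] isT).
  have mJ' : eval m' (var xJ) = Num j by [].
  have [[x|c] tsj] := onth_lt jts; last first.
    apply: wp_if; rewrite holds_IsBot (eval_term_var im' mV' mJ') tsj /=.
    apply: wp_skip; split=> //; split; [lia| |].
      move=> x; rewrite update_array // posj (take_nth (inr c)) // mem_rcons in_cons.
      by rewrite (onth_nth _ _ _ _ tsj).
    by move=> k ks kv; rewrite update_array // rowj.
  have tv : eval m' (term_var (var xV) (var xJ)) = Num (code x).
    by rewrite (eval_term_var im' mV' mJ') tsj.
  have tk y : (inl y \in take j.+1 ts) = (y == x) || (inl y \in take j ts).
    rewrite (take_nth (inl x)) // mem_rcons in_cons (onth_nth _ _ _ _ tsj).
    by congr orb; apply/eqP/eqP => [[]|->].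
  apply: wp_if; rewrite holds_IsBot tv /=; apply: wp_if; rewrite holds_IsBot.
  rewrite (eval_read2 _ (k1 := inl (code v)) (k2 := inl (code x))) ?mV' ?tv // posj.
  case xj: (inl x \in take j ts) => /=.
    apply: wp_skip; split=> //; split; [lia| |].
      by move=> y; rewrite update_array // posj tk; case: eqP => [->|]; rewrite ?xj.
    by move=> k ks kv; rewrite update_array // rowj.
  apply: (wp_assign2 (k1 := inl (code v)) (k2 := inl (code x))); rewrite ?mV' ?tv //.
  split; first by rewrite update_array.
  split; [lia| |].
    move=> y; rewrite update_array // update_ks tk.
    case: eqP => [[/code_inj->]|yx]; last by case: eqP yx => [->|_ _]; rewrite ?posj.
    rewrite eqxx /= [m' _ _]mJ; congr Num.
    by rewrite (index_onth tsj) ?xj.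
  by move=> k ks kv; rewrite update_array // update_ks eqseq_cons (negPf kv) rowj.
- move=> t m' A [tn posn rown]; split=> //; first by lia.
  by move=> x; rewrite posn take_size; congr (if _ then _ else _); rewrite [RHS]inE.
Qed.

Lemma matches_all v f : f \in node_facts v -> fits v f =
  all (fun j => onth f.2 j == obind (term_val (read v f)) (onth (at_ v).2 j))
    (iota 0 (size (at_ v).2)).
Proof.
move=> fv; have sf := node_facts_size fv.
have sub : avars (at_ v) \subset adom (read v f) by rewrite (adom_read fv).
have f1 : f.1 = (at_ v).1 by move: fv; rewrite mem_filter => /andP[/eqP].
apply/eqP/allP => [ff j _|all_ok].
  by rewrite -(onth_apply_atom j sub) [apply_atom _ _]ff.
have : (apply_atom (read v f) (at_ v)).2 = f.2.
  apply: eq_from_onth => j; rewrite onth_apply_atom //.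
  have [js|sj] := ltnP j (size (at_ v).2); last by rewrite !onth_default ?sf.
  by rewrite (eqP (all_ok j _)) // mem_iota.
move=> e2; rewrite [LHS]surjective_pairing [X in (_, X)]e2 [_.1]/= -f1.
by rewrite -surjective_pairing.
Qed.

Definition init_val v f : option K := if fits v f then Some (nu f) else None.

Lemma test_fact_spec m v i f : inp m -> m (Work xV) [::] = Num (code v) ->
  m (Work xI) [::] = Num i -> onth (node_facts v) i = Some f -> pos_ok m v ->
  m aW [:: inl (code v); inl i] = Val (nu f) ->
  wp test_fact m (fun t m' => [/\ t <= 5 * size (at_ v).2 + 2,
    m' aW [:: inl (code v); inl i] = opt (init_val v f) &
    forall ks, ks != [:: inl (code v); inl i] -> m' aW ks = m aW ks]).
Proof.
move=> im mV mI vi pos w0; set ts := (at_ v).2.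
have fv : f \in node_facts v by apply/onthP; exists i.
have sf : size f.2 = size ts := node_facts_size fv.
pose ok j := onth f.2 j == obind (term_val (read v f)) (onth ts j).
pose I j t m' := [/\ t <= 5 * j + 1,
  m' aW [:: inl (code v); inl i] = if all ok (iota 0 j) then Val (nu f) else Bot
  & forall ks, ks != [:: inl (code v); inl i] -> m' aW ks = m aW ks].
apply: (wp_for (n := size ts) (I := I)).
- by split=> //; rewrite update_array // w0.
- move=> j t m' _ A mJ _; have im' := inp_agree im A isT.
  by rewrite (eval_node_arity im' (v := v)) // [LHS](A (Work xV) [::] isT).
- move=> j t m' jts A mJ [tj Wj rowj]; have im' := inp_agree im A isT.
  have mV' : eval m' (var xV) = Num (code v) by rewrite [LHS](A (Work xV) [::] isT).
  have mI' : eval m' (var xI) = Num i by rewrite [LHS](A (Work xI) [::] isT).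
  have mJ' : eval m' (var xJ) = Num j by [].
  have pos' x : m' aPos [:: inl (code v); inl (code x)] =
    if x \in nvars v then Num (index (inl x) ts) else Bot by rewrite (A aPos _ isT) pos.
  have [b tsj] := onth_lt jts.
  have [c fj] : exists c : C, onth f.2 j = Some c by apply: onth_lt; rewrite sf.
  have fc : eval m' (fact_at (var xV) (var xI) (var xJ)) = Cst c.
    by rewrite (eval_fact_at im' mV' mJ' mI') vi /= fj.
  have iotaS : all ok (iota 0 j.+1) = all ok (iota 0 j) && ok j.
    by rewrite -addn1 iotaD all_cat /= andbT.
  have pass : ok j -> I j.+1 (t + 1 + 2) (update m' (Work xJ) [::] (Num j.+1)).
    move=> okj; split; first by lia.
      by rewrite update_array // iotaS okj andbT.
    by move=> ks kv; rewrite update_array // rowj.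
  have pass2 : ok j -> I j.+1 (t + 2 + 2) (update m' (Work xJ) [::] (Num j.+1)).
    by move=> /pass[_ ? ?]; split=> //; lia.
  have fail : ok j = false -> wp (Assign aW [:: var xV; var xI] bot) m'
      (fun t' m'' => m'' (Work xJ) [::] = Num j /\
         I j.+1 (t + t'.+2 + 2) (update m'' (Work xJ) [::] (Num j.+1))).
    move=> nok; apply: (wp_assign2 (k1 := inl (code v)) (k2 := inl i)); rewrite ?mV' ?mI' //.
    split; first by rewrite update_array.
    split; first by lia.
      by rewrite update_array // update_same iotaS nok andbF.
    by move=> ks kv; rewrite update_array // update_ks (negPf kv) rowj.
  apply: wp_if; rewrite holds_Eq fc (eval_term_cst im' mV' mJ') tsj /=.
  case: b tsj => [x|c'] tsj /=.
    have xv : x \in nvars v.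
      rewrite inE; apply/onthP; by exists j.
    have ri : eval m' (Read aPos [:: var xV; term_var (var xV) (var xJ)]) =
        Num (index (inl x) ts).
      rewrite (eval_read2 _ (k1 := inl (code v)) (k2 := inl (code x))) ?mV' //.
        by rewrite pos' xv.
      by rewrite (eval_term_var im' mV' mJ') tsj.
    apply: wp_if; rewrite holds_Eq fc (eval_fact_at im' mV' ri mI') vi /=.
    have [c' fx] : exists c' : C, onth f.2 (index (inl x) ts) = Some c'.
      by apply: onth_lt; rewrite sf index_mem; apply/onthP; exists j.
    have okE : ok j = (c == c') by rewrite /ok fj tsj /= ffunE xv fx.
    rewrite fx /=; have -> : (inr c == inr c' :> nat + C) = ok j by rewrite okE.
    case okj: (ok j); last exact: fail.
    by apply: wp_skip; split=> //; apply: pass2.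
  have -> : (inr c == inr c' :> nat + C) = ok j by rewrite /ok fj tsj.
  case okj: (ok j); first by apply: wp_skip; split=> //; apply: pass.
  apply: wp_if; rewrite holds_Eq fc.
  have -> : to_key (eval m' (fact_at (var xV) (var xI)
     (Read aPos [:: var xV; term_var (var xV) (var xJ)]))) = None; last exact: fail.
  have tv : eval m' (term_var (var xV) (var xJ)) = Bot.
    by rewrite (eval_term_var im' mV' mJ') tsj.
  have rb : eval m' (Read aPos [:: var xV; term_var (var xV) (var xJ)]) = Bot.
    exact: eval_read2_bot.
  by rewrite [eval _ _](eval_read3_bot _ _ _ rb).
- move=> t m' A [tn Wn rown]; split=> //; first by lia.
  by rewrite Wn /init_val (matches_all fv); case: ifP.
Qed.

Lemma filter_loop_spec m v : inp m -> m (Work xV) [::] = Num (code v) -> pos_ok m v ->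
  wp filter_loop m (fun t m' => [/\ t <= (5 * size (at_ v).2 + 6) * size (node_facts v) + 2,
    forall i f, onth (node_facts v) i = Some f ->
      m' aW [:: inl (code v); inl i] = opt (init_val v f) &
    forall k ks, k != inl (code v) -> m' aW (k :: ks) = m aW (k :: ks)]).
Proof.
move=> im mV pos; set a := size (at_ v).2.
pose I i t m' := [/\ t <= (5 * a + 6) * i + 1,
  forall i' f, i' < i -> onth (node_facts v) i' = Some f ->
      m' aW [:: inl (code v); inl i'] = opt (init_val v f)
  & forall k ks, k != inl (code v) -> m' aW (k :: ks) = m aW (k :: ks)].
apply: (wp_for (n := size (node_facts v)) (I := I)).
- by split=> //; rewrite muln0.
- move=> i t m' _ A mI _; have im' := inp_agree im A isT.
  by rewrite (eval_node_nfacts im' (v := v)) // [LHS](A (Work xV) [::] isT).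
- move=> i t m' inf A mI [ti Wi rowi]; have im' := inp_agree im A isT.
  have mV' : eval m' (var xV) = Num (code v) by rewrite [LHS](A (Work xV) [::] isT).
  have mI' : eval m' (var xI) = Num i by [].
  have [f vi] := onth_lt inf.
  apply: wp_seq; apply: (wp_assign2 (k1 := inl (code v)) (k2 := inl i)); rewrite ?mV' ?mI' //.
  rewrite (eval_annot im' mV' mI') vi /=; set m1 := update _ _ _ _.
  have im1 : inp m1 by apply: (inp_agree (ws := [:: aW]) im' _ isT); apply: agree_update.
  have m1V : m1 (Work xV) [::] = Num (code v) by rewrite /m1 update_array.
  have m1I : m1 (Work xI) [::] = Num i by rewrite /m1 update_array.
  have pos1 : pos_ok m1 v by move=> x; rewrite /m1 update_array // (A aPos _ isT) pos.
  have w1 : m1 aW [:: inl (code v); inl i] = Val (nu f) by rewrite /m1 update_same.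
  apply: wp_conseq (test_fact_spec im1 m1V m1I vi pos1 w1) _ => t2 m2 A2 [t2a W2 row2].
  split; first by rewrite (A2 (Work xI) [::] isT).
  split; first by rewrite -/a in t2a; lia.
    move=> i' f' i'i vi'; rewrite update_array //.
    have [i'E|i'n] := eqVneq i' i; first by move: vi'; rewrite i'E vi => -[<-].
    rewrite row2; last by rewrite eqseq_cons eqxx eqseq_cons andbT; apply: contra i'n => /eqP[->].
    rewrite /m1 update_ks eqseq_cons eqxx eqseq_cons andbT ifN.
      by rewrite (Wi _ f') //; lia.
    by apply: contra i'n => /eqP[->].
  move=> k ks kv; rewrite update_array // row2 ?eqseq_cons ?(negPf kv) //.
  by rewrite /m1 update_ks eqseq_cons (negPf kv) rowi.
- move=> t m' A [tn Wn rown]; split=> //; first by lia.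
  move=> i f vi; by apply: (Wn _ _ _ vi); rewrite -onthTE vi.
Qed.

Definition cost1 v : nat :=
  5 * size (at_ v).2 + (5 * size (at_ v).2 + 6) * size (node_facts v) + 6.

Definition facts_ok m : Prop := forall v i f, onth (node_facts v) i = Some f ->
  m aW [:: inl (code v); inl i] = opt (init_val v f).

(** For [k] equal to the number of nodes this includes the row of the fictitious parent of the root,
    in which every position must read as bottom. *)
Definition blank_rows m a (k : nat) : Prop :=
  forall j ks, k <= j -> m a (inl j :: ks) = Bot.

Lemma sum_nodes (F : N -> nat) :
  \sum_(i < #|N|) oapp F 0 (onth (enum N) i) = \sum_v F v.
Proof.
rewrite (reindex (@enum_rank N)) /=; last first.
  by exists (@enum_val N predT) => x _; rewrite ?enum_rankK ?enum_valK.
by apply: eq_bigr => v _; rewrite -/(code v) onth_code.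
Qed.

Lemma phase1_spec m : inp m -> blank_rows m aPos 0 ->
  wp phase1 m (fun t m' => [/\ t <= \sum_v cost1 v + 2,
    forall v, pos_ok m' v, blank_rows m' aPos #|N| & facts_ok m']).
Proof.
move=> im bl.
pose I k t m' := [/\ t <= \sum_(i < k) oapp cost1 0 (onth (enum N) i) + 1,
  forall v, code v < k -> pos_ok m' v, blank_rows m' aPos k &
  forall v i f, code v < k -> onth (node_facts v) i = Some f ->
    m' aW [:: inl (code v); inl i] = opt (init_val v f)].
apply: (wp_for (n := #|N|) (I := I)).
- by split=> //; rewrite big_ord0.
- by move=> k t m' _ A mV _; have im' := inp_agree im A isT; rewrite eval_num_nodes.
- move=> k t m' kN A mV [tk posk blk Wk]; have im' := inp_agree im A isT.
  have [v cv] := code_onto kN; have mV' : m' (Work xV) [::] = Num (code v) by rewrite cv.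
  apply: wp_seq; apply: wp_conseq (pos_loop_spec im' mV' _) _ => [x|t1 m1 A1 [t1a pos1 row1]].
    by rewrite blk // cv.
  have im1 := inp_agree im' A1 isT.
  have m1V : m1 (Work xV) [::] = Num (code v) by rewrite (A1 (Work xV) [::] isT).
  apply: wp_conseq (filter_loop_spec im1 m1V pos1) _ => t2 m2 A2 [t2a W2 row2].
  split; first by rewrite (A2 (Work xV) [::] isT) m1V cv.
  have other u : u <> v -> inl (code u) != inl (code v) :> nat + C.
    by move=> uv; apply/eqP => -[/code_inj].
  split.
  - rewrite big_ord_recr /=.
    have -> : oapp cost1 0 (onth (enum N) k) = cost1 v by rewrite -cv onth_code.
    by move: (\sum_(i < k) _) tk => s0 tk; rewrite /cost1; lia.
  - move=> u uk x; rewrite update_array // (A2 aPos _ isT).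
    have [->|/eqP uv] := eqVneq u v; first exact: pos1.
    rewrite row1 ?other // posk //; suff : code u != k by lia.
    by rewrite -cv; apply: contra_not_neq uv => /code_inj.
  - move=> j ks kj; rewrite update_array // (A2 aPos _ isT) row1 ?blk //; first by lia.
    by apply/eqP => -[]; lia.
  - move=> u i f uk ui; rewrite update_array //.
    have [uv|/eqP uv] := eqVneq u v; first by rewrite uv in ui *; apply: W2.
    rewrite row2 ?other // (A1 aW _ isT) (Wk u i f) //; suff : code u != k by lia.
    by rewrite -cv; apply: contra_not_neq uv => /code_inj.
- move=> t m' A [tn posn bln Wn]; split=> //.
  + by rewrite -sum_nodes; lia.
  + by move=> v; apply: posn; apply: code_lt.
  + by move=> v i f; apply: Wn; apply: code_lt.
Qed.

End Programs.

(** * Passing the messages *)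

Definition trie_entry := Read aTrie [:: var xV; var xId; fact_at (var xV) (var xI) (var xJ)].
Definition par_pos_entry := Read aPos [:: var xP; term_var (var xV) (var xJ)].
Definition agg_entry := Read aAgg [:: var xV; var xId].

(** [par_pos_entry] doubles as the test for shared variables: it is bottom at a constant and at a
    variable that does not occur in the parent. *)
Definition insert_loop : cmd :=
  for_loop xJ (node_arity (var xV))
    (If (IsBot par_pos_entry) Skip
       (Seq (If (IsBot trie_entry)
               (Seq (Assign aTrie [:: var xV; var xId; fact_at (var xV) (var xI) (var xJ)]
                       (var xCnt))
                    (Assign (Work xCnt) [::] (Add (var xCnt) (Lit 1))))
               Skip)
            (Assign (Work xId) [::] trie_entry))).

Definition aggregate : cmd :=
  If (IsBot agg_entry)
    (Assign aAgg [:: var xV; var xId] (Read aW [:: var xV; var xI]))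
    (If (Le (Add (node_level (var xV)) (Lit 1)) (Read ANumSteps [::]))
       (Assign aAgg [:: var xV; var xId]
          (SPlus (node_level (var xV)) agg_entry (Read aW [:: var xV; var xI])))
       Skip).

Definition push_fact : cmd :=
  Seq (Assign aNext [:: var xV; var xI] (Read aHead [:: var xV; var xId]))
      (Assign aHead [:: var xV; var xId] (var xI)).

Definition gather : cmd :=
  for_loop xI (node_nfacts (var xV))
    (If (IsBot (Read aW [:: var xV; var xI])) Skip
       (Seq (Assign (Work xId) [::] (Lit 0))
       (Seq insert_loop (Seq aggregate push_fact)))).

(** Runs through the positions of the child, not of the parent, so that the trie is followed in the
    order in which it was built; the constants come from the fact of the parent. *)
Definition lookup_loop : cmd :=
  for_loop xJ (node_arity (var xV))
    (If (IsBot par_pos_entry) Skip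
       (Assign (Work xId) [::]
          (Read aTrie [:: var xV; var xId; fact_at (var xP) (var xI) par_pos_entry]))).

Definition multiply (thr : expr) : cmd :=
  If (IsBot agg_entry) (Assign aW [:: var xP; var xI] bot)
    (If (Le (Add (node_level (var xV)) (Lit 1)) thr)
       (Assign aW [:: var xP; var xI] (STimes (Read aW [:: var xP; var xI]) agg_entry))
       Skip).

Definition scatter (thr : expr) : cmd :=
  for_loop xI (node_nfacts (var xP))
    (If (IsBot (Read aW [:: var xP; var xI])) Skip
       (Seq (Assign (Work xId) [::] (Lit 0))
       (Seq lookup_loop
       (Seq (multiply thr) (Assign aKey [:: var xV; var xI] (var xId)))))).

(** The trie counter restarts at 1 because 0 is the root of every trie; the index [xV] of the arrays
    keeps the tries of different nodes apart. *)
Definition node_step (thr : expr) : cmd :=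
  Seq (Assign (Work xP) [::] (Read aPar [:: var xV]))
  (Seq (Assign (Work xCnt) [::] (Lit 1))
  (Seq gather (scatter thr))).

Definition phase2 (thr : expr) : cmd :=
  for_loop xK num_nodes
    (Seq (Assign (Work xV) [::] (Read aOrd [:: Sub (Sub num_nodes (Lit 1)) (var xK)]))
         (node_step thr)).

Section Propagation.
Context (S : schema) (V : finType) (C : eqType) (K : Type).
Context (g : query S V C K) (T : connex_join_tree g).
Context (D : database S C) (nu : fact S C -> K).
Context (s : seq (node T)) (par : node T -> option (node T)) (thr : nat).
Local Notation N := (node T).
Local Notation at_ := (@jt_atom _ _ _ _ _ T).
Local Notation times := (mul g).
Local Notation plus := (unzip1 (steps g)).
Local Notation memory := (Defs.mem C K).
Local Notation eval := (@eval C K times plus).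
Local Notation holds := (@holds C K times plus).
Local Notation wp := (@wp C K times plus).
Local Notation read := (@read _ _ _ _ _ T).
Local Notation fits := (@fits _ _ _ _ _ T).
Local Notation nvars := (@nvars _ _ _ _ _ T).
Local Notation node_facts := (@node_facts _ _ _ _ _ T D).
Local Notation level := (@level _ _ _ _ _ T).
Local Notation opt := (@opt C K).
Local Notation shared := (shared par).
Local Notation tuple_val := (tuple_val D nu s par thr).
Local Notation message := (message D nu s par thr).
Local Notation inp := (@inp _ _ _ _ _ T D nu).
Local Notation pos_ok := (@pos_ok _ _ _ _ _ T).
Implicit Types (m : memory) (v u p : N) (x : V) (f : fact S C) (h : assignment V C).
Implicit Types (y : C) (ys : seq C) (Q : {set N}).

Hypothesis s_ord : parent_order (@edge V T) s par.
Hypothesis s_all : forall v, v \in s.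

Definition tr m v id y : option nat :=
  if m aTrie [:: inl (code v); inl id; inr y] is Num n then Some n else None.

Definition walk m v ys : option nat :=
  foldl (fun o y => obind (fun id => tr m v id y) o) (Some 0) ys.

Lemma walk_rcons m v ys y :
  walk m v (rcons ys y) = obind (fun id => tr m v id y) (walk m v ys).
Proof. by rewrite /walk foldl_rcons. Qed.

(* Every trie node has at most one incoming edge, so that tuples of the same
   length leading to the same node are equal. *)
Definition trie_ok m v (cnt : nat) : Prop :=
  [/\ 0 < cnt,
      forall id y, m aTrie [:: inl (code v); inl id; inr y] = oapp Num Bot (tr m v id y),
      forall id y n, tr m v id y = Some n -> id < cnt /\ 0 < n < cnt &
      forall id1 y1 id2 y2 n, tr m v id1 y1 = Some n -> tr m v id2 y2 = Some n ->
        id1 = id2 /\ y1 = y2].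

Lemma eq_walk m m' v : (forall ks, m' aTrie (inl (code v) :: ks) = m aTrie (inl (code v) :: ks)) ->
  walk m' v =1 walk m v.
Proof.
move=> eqm ys; elim/last_ind: ys => // ys y IH; rewrite !walk_rcons IH.
by case: (walk m v ys) => //= id; rewrite /tr eqm.
Qed.

Lemma eq_trie_ok m m' v cnt :
  (forall ks, m' aTrie (inl (code v) :: ks) = m aTrie (inl (code v) :: ks)) ->
  trie_ok m v cnt -> trie_ok m' v cnt.
Proof.
move=> eqm [c0 val lt inj]; have eqt id y : tr m' v id y = tr m v id y by rewrite /tr eqm.
split=> // [id y|id y n|id1 y1 id2 y2 n]; rewrite !eqt //; first by rewrite eqm.
- exact: lt.
- exact: inj.
Qed.

Lemma walk_inj m v cnt ys1 ys2 id : trie_ok m v cnt -> size ys1 = size ys2 ->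
  walk m v ys1 = Some id -> walk m v ys2 = Some id -> ys1 = ys2.
Proof.
move=> [_ _ _ inj]; elim/last_ind: ys1 ys2 id => [|ys1 y1 IH] ys2 id; first by case: ys2.
case/lastP: ys2 => [|ys2 y2]; rewrite !size_rcons // => -[ss]; rewrite !walk_rcons.
case w1: (walk m v ys1) => [id1|] //= t1; case w2: (walk m v ys2) => [id2|] //= t2.
have [id12 ->] := inj _ _ _ _ _ t1 t2; congr rcons; apply: IH w1 _ => //.
by rewrite id12.
Qed.

Lemma walk_lt m v cnt ys id : trie_ok m v cnt -> walk m v ys = Some id -> id < cnt.
Proof.
move=> [c0 _ lt _]; case/lastP: ys => [[<-]//|ys y]; rewrite walk_rcons.
by case: (walk m v ys) => //= id' /lt[_ /andP[]].
Qed.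

(** Listed by position, repetitions included: a shared variable that occurs twice in the atom of [v]
    is followed twice, by insertion and lookup alike. *)
Definition kvars v (j : nat) : seq V :=
  pmap (fun t : V + C => if t is inl x then if x \in shared v then Some x else None
                        else None) (take j (at_ v).2).

Definition key v (j : nat) h : seq C := pmap h (kvars v j).

Definition full_key v h : seq C := key v (size (at_ v).2) h.

Lemma kvarsS v j b : onth (at_ v).2 j = Some b ->
  kvars v j.+1 = if b is inl x then if x \in shared v then rcons (kvars v j) x
                                   else kvars v j else kvars v j.
Proof.
move=> jb; have js : j < size (at_ v).2 by rewrite -onthTE jb.
rewrite /kvars (take_nth b) // (onth_nth _ _ _ _ jb) -cats1 pmap_cat /=.
by case: (b) => [x|y]; rewrite ?cats0 //=; case: ifP; rewrite ?cats0 ?cats1.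
Qed.

Lemma mem_kvars v j x : x \in kvars v j -> x \in shared v.
Proof.
rewrite mem_pmap => /mapP[[y|y] _] //; by case: ifP => // ys [->].
Qed.

Lemma keyS v j x y h : onth (at_ v).2 j = Some (inl x) -> h x = Some y ->
  key v j.+1 h = if x \in shared v then rcons (key v j h) y else key v j h.
Proof.
move=> jx hx; rewrite /key (kvarsS jx); case: ifP => // _.
by rewrite -!cats1 pmap_cat /= hx.
Qed.

Lemma keyS_out v j b h : onth (at_ v).2 j = Some b ->
  (if b is inl x then x \notin shared v else true) -> key v j.+1 h = key v j h.
Proof. by move=> /[dup] jb /kvarsS e bs; rewrite /key e; case: b jb e bs => // x _ _ /negPf->. Qed.

Lemma shared_kvars v x : x \in shared v -> x \in kvars v (size (at_ v).2).
Proof.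
move=> xs; rewrite mem_pmap take_size; apply/mapP; exists (inl x); last by rewrite xs.
by have := subsetP (@shared_sub _ _ _ _ _ T par v) x xs; rewrite inE.
Qed.

(** Every shared variable occurs among the key variables. Hence tries index messages faithfully. *)
Lemma full_key_eq v h1 h2 : shared v \subset adom h1 -> shared v \subset adom h2 ->
  (full_key v h1 == full_key v h2) = (restrict (shared v) h1 == restrict (shared v) h2).
Proof.
move=> /subsetP s1 /subsetP s2; set kv := kvars v (size (at_ v).2).
have mapk (h : assignment V C) : {subset shared v <= adom h} ->
    [seq h x | x <- kv] = [seq Some y | y <- full_key v h].
  move=> sh; rewrite /full_key /key -/kv.
  have : {subset kv <= shared v} by move=> x; apply: mem_kvars.
  elim: kv => //= x l IH xl; have := sh x (xl x (mem_head _ _)).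
  rewrite in_set; case hx: (h x) => [y|] //= _; congr cons; apply: IH => x' x'l.
  by apply: xl; rewrite in_cons x'l orbT.
apply/eqP/eqP => [e|e].
  apply/ffunP => x; rewrite !ffunE; case: ifP => // xs.
  have : [seq h1 x | x <- kv] = [seq h2 x | x <- kv] by rewrite !mapk ?e.
  by move/eq_in_map; apply; apply: shared_kvars.
rewrite /full_key /key; have : {subset kv <= shared v} by move=> x; apply: mem_kvars.
rewrite -/kv; elim: kv {mapk} => //= x l IH xl.
have xs := xl x (mem_head _ _).
have := congr1 (fun h : assignment V C => h x) e; rewrite !ffunE xs => ->.
by rewrite IH // => x' x'l; apply: xl; rewrite in_cons x'l orbT.
Qed.

Lemma size_full_key v h : shared v \subset adom h ->
  size (full_key v h) = size (kvars v (size (at_ v).2)).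
Proof.
move=> /subsetP sh; rewrite size_pmap; apply/eqP; rewrite -all_count.
by apply/allP => x /mem_kvars/sh; rewrite in_set; case: (h x).
Qed.

(* The parent of the root is encoded by the number of nodes, for which every
   array reads as bottom. *)
Definition pcode v : nat := oapp (@code _) #|N| (par v).
Definition par_pos v x : nat := if par v is Some p then index (inl x) (at_ p).2 else 0.

Definition pos_all m : Prop := (forall v, pos_ok m v) /\ blank_rows m aPos #|N|.

Lemma pos_all_agree ws m m' : pos_all m -> agree ws m m' -> aPos \notin ws -> pos_all m'.
Proof.
by move=> [pos bl] A aw; split=> [v x|j ks jN]; rewrite A // ?pos ?bl.
Qed.

Lemma eval_par_pos m v x j : inp m -> pos_all m -> m (Work xV) [::] = Num (code v) ->
  m (Work xP) [::] = Num (pcode v) -> m (Work xJ) [::] = Num j ->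
  onth (at_ v).2 j = Some (inl x) ->
  eval m par_pos_entry = if x \in shared v then Num (par_pos v x) else Bot.
Proof.
move=> im [pos bl] mV mP mJ jx.
have tv : eval m (term_var (var xV) (var xJ)) = Num (code x).
  by rewrite (eval_term_var im (e := var xV) (v := v) mV (ej := var xJ) (j := j) mJ) jx.
rewrite (eval_read2 _ (k1 := inl (pcode v)) (k2 := inl (code x))) ?tv //; last first.
  by rewrite [eval _ _]mP.
have xv : x \in nvars v by rewrite inE; apply/onthP; exists j.
rewrite /pcode /par_pos /shared; case: (par v) => [p|] /=; last by rewrite bl ?in_set0.
by rewrite in_setI xv /= pos.
Qed.

Lemma eval_par_pos_cst m v y j : inp m -> m (Work xV) [::] = Num (code v) ->
  m (Work xJ) [::] = Num j -> onth (at_ v).2 j = Some (inr y) ->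
  eval m par_pos_entry = Bot.
Proof.
move=> im mV mJ jy; apply: eval_read2_bot.
by rewrite (eval_term_var im (e := var xV) (v := v) mV (ej := var xJ) (j := j) mJ) jy.
Qed.

Lemma fits_val v f j x : f \in node_facts v -> fits v f ->
  onth (at_ v).2 j = Some (inl x) -> onth f.2 j = read v f x.
Proof.
move=> fv ff jx; rewrite -{1}(eqP ff) onth_apply_atom ?[onth _ _]jx //.
by rewrite [adom _](adom_read fv).
Qed.

Lemma walk_monotone m m' v : (forall id y n, tr m v id y = Some n -> tr m' v id y = Some n) ->
  forall ys n, walk m v ys = Some n -> walk m' v ys = Some n.
Proof.
move=> mono ys; elim/last_ind: ys => // ys y IH n; rewrite !walk_rcons.
by case w: (walk m v ys) => [id|] //= /mono t; rewrite (IH _ w).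
Qed.

Lemma insert_loop_spec m v i f cnt : inp m -> pos_all m ->
  m (Work xV) [::] = Num (code v) -> m (Work xP) [::] = Num (pcode v) ->
  m (Work xI) [::] = Num i -> m (Work xId) [::] = Num 0 ->
  m (Work xCnt) [::] = Num cnt -> trie_ok m v cnt ->
  onth (node_facts v) i = Some f -> fits v f ->
  wp insert_loop m (fun t m' => t <= 7 * size (at_ v).2 + 2 /\
    exists cnt' id, [/\ m' (Work xCnt) [::] = Num cnt', trie_ok m' v cnt',
      m' (Work xId) [::] = Num id & walk m' v (full_key v (read v f)) = Some id] /\
    (forall ys n, walk m v ys = Some n -> walk m' v ys = Some n) /\
    (forall k ks, k != inl (code v) -> m' aTrie (k :: ks) = m aTrie (k :: ks))).
Proof.
move=> im pos mV mP mI mId mCnt tok vi ff; set ts := (at_ v).2.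
have fv : f \in node_facts v by apply/onthP; exists i.
have sf : size f.2 = size ts := node_facts_size fv.
pose I j t m' := t <= 7 * j + 1 /\
    exists cnt' id, [/\ m' (Work xCnt) [::] = Num cnt', trie_ok m' v cnt',
      m' (Work xId) [::] = Num id & walk m' v (key v j (read v f)) = Some id] /\
    (forall ys n, walk m v ys = Some n -> walk m' v ys = Some n) /\
    (forall k ks, k != inl (code v) -> m' aTrie (k :: ks) = m aTrie (k :: ks)).
apply: (wp_for (n := size ts) (I := I)).
- split=> //; exists cnt, 0; split; last by split=> // ys n; rewrite (@eq_walk m).
  by split; rewrite ?update_array // /key /kvars ?take0.
- move=> j t m' _ A mJ _; have im' := inp_agree im A isT.
  by rewrite (eval_node_arity im' (v := v)) // [LHS](A (Work xV) [::] isT).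
- move=> j t m' jts A mJ [tj [cnt1 [id [[cnt1E tok1 idE wj] [mono row]]]]].
  have im' := inp_agree im A isT; have pos' := pos_all_agree pos A isT.
  have mV' : m' (Work xV) [::] = Num (code v) by rewrite (A (Work xV) [::] isT).
  have mP' : m' (Work xP) [::] = Num (pcode v) by rewrite (A (Work xP) [::] isT).
  have mI' : m' (Work xI) [::] = Num i by rewrite (A (Work xI) [::] isT).
  have [b tsj] := onth_lt jts.
  have out : (if b is inl x then x \notin shared v else true) ->
      I j.+1 (t + 1 + 2) (update m' (Work xJ) [::] (Num j.+1)).
    move=> bs; split; first by lia.
    by exists cnt1, id; rewrite (keyS_out _ tsj bs).
  apply: wp_if; rewrite holds_IsBot.
  case: b tsj out => [x|y] tsj out; last first.
    by rewrite (eval_par_pos_cst im' mV' mJ tsj) /=; apply: wp_skip; split=> //; apply: out.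
  rewrite (eval_par_pos im' pos' mV' mP' mJ tsj).
  case xs: (x \in shared v) out => out /=; last by apply: wp_skip; split=> //; apply: out.
  have [y fj] : exists y, onth f.2 j = Some y by apply: onth_lt; rewrite sf.
  have hx : read v f x = Some y by rewrite -(fits_val fv ff tsj).
  have fy : eval m' (fact_at (var xV) (var xI) (var xJ)) = Cst y.
    by rewrite (eval_fact_at im' (e := var xV) (v := v) mV' (ej := var xJ) (j := j) mJ (ei := var xI) (i := i) mI') vi /= fj.
  have [c10 val1 lt1 inj1] := tok1.
  have te : eval m' trie_entry = oapp Num Bot (tr m' v id y).
    rewrite (eval_read3 _ (k1 := inl (code v)) (k2 := inl id) (k3 := inr y)) ?fy //.
    - by rewrite [eval _ _]mV'.
    - by rewrite [eval _ _]idE.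
  apply: wp_seq; apply: wp_if; rewrite holds_IsBot te.
  case tid: (tr m' v id y) => [n|] /=.
    apply: wp_skip; apply: wp_assign0; rewrite te tid /=.
    split; first by rewrite update_array.
    split; first by lia.
    exists cnt1, n; split; last by split.
    by split=> //; rewrite (keyS tsj hx) xs (@eq_walk m') // walk_rcons wj.
  apply: wp_seq; apply: (wp_assign3 (k1 := inl (code v)) (k2 := inl id) (k3 := inr y)).
  - by rewrite [eval _ _]mV'.
  - by rewrite [eval _ _]idE.
  - by rewrite fy.
  rewrite [eval _ _]cnt1E; set m1 := update _ _ _ _.
  apply: wp_assign0; rewrite [eval _ _]/= [m1 _ _]cnt1E /arith; set m2 := update _ _ _ _.
  have tr2 id' y' : tr m2 v id' y' = if (id' == id) && (y' == y) then Some cnt1 else tr m' v id' y'.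
    rewrite /tr /m2 update_array // /m1 update_ks !eqseq_cons eqxx andbT /=.
    have -> : (inl id' == inl id :> nat + C) = (id' == id) by [].
    have -> : (inr y' == inr y :> nat + C) = (y' == y) by [].
    by case: ifP.
  have im2 : inp m2.
    apply: (inp_agree (ws := [:: Work xCnt; aTrie]) im' _ isT) => a ks.
    rewrite !inE negb_or => /andP[a1 a2].
    by rewrite /m2 update_array // /m1 update_array.
  have te2 : eval m2 trie_entry = Num cnt1.
    rewrite (eval_read3 _ (k1 := inl (code v)) (k2 := inl id) (k3 := inr y)).
    - by rewrite /m2 update_array // /m1 update_same.
    - by rewrite [eval _ _]mV'.
    - by rewrite [eval _ _]idE.
    - by rewrite (eval_fact_at im2 (e := var xV) (v := v) mV' (ej := var xJ) (j := j) mJ (ei := var xI) (i := i) mI') vi /= fj.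
  apply: wp_assign0; rewrite te2; split; first by rewrite update_array.
  have mono2 id' y' n : tr m' v id' y' = Some n -> tr m2 v id' y' = Some n.
    by rewrite tr2; case: andP => // -[/eqP-> /eqP->]; rewrite tid.
  split; first by lia.
  exists (cnt1 + 1), cnt1; split; last first.
    split; first by move=> ys n /mono w; apply: (walk_monotone mono2).
    move=> k ks kv; rewrite -row // !update_array // /m2 update_array // /m1 update_ks.
    by rewrite eqseq_cons (negPf kv).
  split=> //; last first.
    rewrite (keyS tsj hx) xs (@eq_walk m2) // walk_rcons (walk_monotone mono2 wj) /= tr2.
    by rewrite !eqxx.
  apply: (@eq_trie_ok m2) => //; split; first by lia.
  - move=> id' y'; rewrite tr2 /m2 update_array // /m1 update_ks !eqseq_cons eqxx andbT /=.
    have -> : (inl id' == inl id :> nat + C) = (id' == id) by [].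
    have -> : (inr y' == inr y :> nat + C) = (y' == y) by [].
    by case: ifP.
  - move=> id' y' n; rewrite tr2; case: andP => [[/eqP-> _] [<-]|_ /lt1]; last by lia.
    by have := walk_lt tok1 wj; lia.
  - move=> id1 y1 id2 y2 n; rewrite !tr2.
    case: andP => [[/eqP-> /eqP->] [<-]|_ t1]; case: andP => [[/eqP-> /eqP->]|_] //.
      by move=> /lt1; lia.
    + by move=> [cn]; have := lt1 _ _ _ t1; lia.
    + exact: inj1 t1.
- move=> t m' A [tn R]; split; first by lia.
  exact: R.
Qed.

Definition ival v (i : nat) : option K :=
  if onth (node_facts v) i is Some f then
    if fits v f then tuple_val v (read v f) else None
  else None.

Definition ikey v (i : nat) : seq C :=
  oapp (fun f => full_key v (read v f)) [::] (onth (node_facts v) i).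

Definition group m v (i id : nat) : seq nat :=
  [seq i' <- iota 0 i | ival v i' && (walk m v (ikey v i') == Some id)].

Fixpoint chain m v (w : word C K) (l : seq nat) : Prop :=
  if l is i :: l' then w = Num i /\ chain m v (m aNext [:: inl (code v); inl i]) l'
  else w = Bot.

Lemma eq_chain m m' v w l :
  (forall i, i \in l -> m' aNext [:: inl (code v); inl i] = m aNext [:: inl (code v); inl i]) ->
  chain m v w l -> chain m' v w l.
Proof.
elim: l w => //= i l IH w eqm [-> ch]; split=> //; rewrite eqm ?mem_head //.
by apply: IH ch => i' i'l; apply: eqm; rewrite in_cons i'l orbT.
Qed.

Lemma aggregate_spec m v i id (x : option K) (b : K) : inp m ->
  m (Work xV) [::] = Num (code v) -> m (Work xI) [::] = Num i ->
  m (Work xId) [::] = Num id -> m aAgg [:: inl (code v); inl id] = opt x ->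
  m aW [:: inl (code v); inl i] = Val b ->
  wp aggregate m (fun t m' => t <= 3 /\ forall ks, m' aAgg ks =
    if ks == [:: inl (code v); inl id] then opt (add_opt (op_at v) x (Some b))
    else m aAgg ks).
Proof.
move=> im mV mI mId ax wb.
have mV' : eval m (var xV) = Num (code v) by [].
have ae : eval m agg_entry = opt x.
  by rewrite (eval_read2 _ (k1 := inl (code v)) (k2 := inl id)) // [eval _ _]/= ?mV ?mId.
have we : eval m (Read aW [:: var xV; var xI]) = Val b.
  by rewrite (eval_read2 _ (k1 := inl (code v)) (k2 := inl i)) // [eval _ _]/= ?mV ?mI.
have lev : eval m (node_level (var xV)) = Num (level v).
  exact: (eval_node_level im (e := var xV) (v := v) mV').
have assign e w : eval m e = w ->
    (w = opt (add_opt (op_at v) x (Some b))) -> forall k, k <= 2 ->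
    wp (Assign aAgg [:: var xV; var xId] e) m (fun t m' => t + k <= 3 /\ forall ks, m' aAgg ks =
    if ks == [:: inl (code v); inl id] then opt (add_opt (op_at v) x (Some b))
    else m aAgg ks).
  move=> ew wE k k2; apply: (wp_assign2 (k1 := inl (code v)) (k2 := inl id)).
  - by rewrite mV'.
  - by rewrite [eval _ _]mId.
  - by split; [lia | move=> ks; rewrite update_ks ew wE].
apply: wp_if; rewrite holds_IsBot ae; case: x ax ae assign => [a|] ax ae assign /=.
  apply: wp_if; rewrite (@holds_Le _ _ _ _ _ _ _ (level v + 1) (size (steps g))); last first.
  - by rewrite [eval _ _]/= im.
  - exact: eval_add.
  rewrite addn1; case: ifP => lv.
    have [o vo] : exists o, op_at v = Some o by apply: onth_lt; rewrite size_map.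
    apply: wp_conseq (assign _ (Val (o a b)) _ _ 2 isT) _ => [||t m' _ [? ?]]; last first.
    + by split=> //; lia.
    + by rewrite /= vo.
    + exact: eval_splus lev ae we vo.
  apply: wp_skip; split=> // ks; case: eqP => // ->; rewrite ax.
  have -> : op_at v = None by rewrite /op_at onth_default // size_map leqNgt lv.
  by [].
apply: wp_conseq (assign _ _ we _ 1 isT) _ => [|t m' _ [? ?]] //=.
by split=> //; lia.
Qed.

Lemma push_fact_spec m v i id :
  m (Work xV) [::] = Num (code v) -> m (Work xI) [::] = Num i ->
  m (Work xId) [::] = Num id ->
  wp push_fact m (fun t m' => [/\ t = 2,
    forall ks, m' aNext ks = if ks == [:: inl (code v); inl i]
       then m aHead [:: inl (code v); inl id] else m aNext ks &
    forall ks, m' aHead ks = if ks == [:: inl (code v); inl id] then Num i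
       else m aHead ks]).
Proof.
move=> mV mI mId; apply: wp_seq; apply: (wp_assign2 (k1 := inl (code v)) (k2 := inl i)).
- by rewrite [eval _ _]mV.
- by rewrite [eval _ _]mI.
rewrite (eval_read2 _ (k1 := inl (code v)) (k2 := inl id)); first last.
- by rewrite [eval _ _]mId.
- by rewrite [eval _ _]mV.
apply: (wp_assign2 (k1 := inl (code v)) (k2 := inl id)).
- by rewrite [eval _ _]update_array // mV.
- by rewrite [eval _ _]update_array // mId.
split=> [//|ks|ks]; first by rewrite update_array // update_ks.
by rewrite update_ks [eval _ _]update_array // mI update_array.
Qed.

Definition row_blank m v (a : array) : Prop := forall ks, m a (inl (code v) :: ks) = Bot.
Definition other_rows m m' v (a : array) : Prop :=
  forall k ks, k != inl (code v) -> m' a (k :: ks) = m a (k :: ks).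

(** [rev] appears because [push_fact] inserts at the head of the list. The second clause says that
    every live fact has been inserted, so that a failing lookup means an empty group. *)
Definition gathered m v (i cnt : nat) : Prop :=
  [/\ trie_ok m v cnt,
      forall i', i' < i -> ival v i' -> walk m v (ikey v i'),
      forall id, m aAgg [:: inl (code v); inl id] =
        opt (sum_opt (op_at v) [seq ival v i' | i' <- group m v i id]) &
      forall id, chain m v (m aHead [:: inl (code v); inl id]) (rev (group m v i id))].

Lemma groupS m v i id : group m v i.+1 id =
  if ival v i && (walk m v (ikey v i) == Some id) then rcons (group m v i id) i
  else group m v i id.
Proof.
by rewrite /group -addn1 iotaD filter_cat /=; case: ifP; rewrite ?cats0 ?cats1.
Qed.

Lemma row_neq v j ks : (inl (code v) :: ks == [:: inl (code v); inl j] :> seq (nat + C)) = (ks == [:: inl j]).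
Proof. by rewrite eqseq_cons eqxx. Qed.

Lemma gather_spec m v : inp m -> pos_all m ->
  m (Work xV) [::] = Num (code v) -> m (Work xP) [::] = Num (pcode v) ->
  m (Work xCnt) [::] = Num 1 ->
  row_blank m v aTrie -> row_blank m v aAgg -> row_blank m v aHead ->
  (forall i f, onth (node_facts v) i = Some f ->
     m aW [:: inl (code v); inl i] = opt (ival v i)) ->
  wp gather m (fun t m' => [/\
    t <= (7 * size (at_ v).2 + 11) * size (node_facts v) + 2,
    exists cnt, gathered m' v (size (node_facts v)) cnt &
    [/\ other_rows m m' v aTrie, other_rows m m' v aAgg, other_rows m m' v aHead
      & other_rows m m' v aNext]]).
Proof.
move=> im pos mV mP mCnt btrie bagg bhead mW; set a := size (at_ v).2.
pose I i t m' := [/\ t <= (7 * a + 11) * i + 1,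
    exists cnt, m' (Work xCnt) [::] = Num cnt /\ gathered m' v i cnt &
    [/\ other_rows m m' v aTrie, other_rows m m' v aAgg, other_rows m m' v aHead
      & other_rows m m' v aNext]].
apply: (wp_for (n := size (node_facts v)) (I := I)).
- split; [by rewrite muln0| |by []].
  exists 1; split; first by rewrite update_array.
  have trN id y : tr (update m (Work xI) [::] (Num 0)) v id y = None.
    by rewrite /tr update_array // btrie.
  split=> //; last by move=> id; rewrite update_array // bhead.
  + by split=> // id y; rewrite trN // update_array // btrie.
  + by move=> id; rewrite update_array // bagg.
- move=> i t m' _ A mI _; have im' := inp_agree im A isT.
  by rewrite (eval_node_nfacts im' (e := var xV) (v := v)) // [LHS](A (Work xV) [::] isT).
- move=> i t m' inf A mI [ti [cnt [cntE [tok wok agg ch]]] [r1 r2 r3 r4]].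
  have im' := inp_agree im A isT; have pos' := pos_all_agree pos A isT.
  have mV' : m' (Work xV) [::] = Num (code v) by rewrite (A (Work xV) [::] isT).
  have mP' : m' (Work xP) [::] = Num (pcode v) by rewrite (A (Work xP) [::] isT).
  have [f vi] := onth_lt inf.
  have Wi : m' aW [:: inl (code v); inl i] = opt (ival v i) by rewrite (A aW _ isT) (mW _ f).
  have We : eval m' (Read aW [:: var xV; var xI]) = opt (ival v i).
    rewrite (eval_read2 _ (k1 := inl (code v)) (k2 := inl i)) //.
    - by rewrite [eval _ _]mV'.
    - by rewrite [eval _ _]mI.
  apply: wp_if; rewrite holds_IsBot We; case iv: (ival v i) => [b|] /=; last first.
    apply: wp_skip; split=> //; split=> //; first by rewrite -/a; lia.
    exists cnt; split; first by rewrite update_array.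
    split=> //.
    - move=> i' i'i i'v; apply: wok => //; suff : i' != i by lia.
      by apply: contraTneq i'v => ->; rewrite iv.
    - by move=> id; rewrite groupS iv; apply: agg.
    - by move=> id; rewrite groupS iv; apply: eq_chain (ch id) => i' _; rewrite update_array.
  have ff : fits v f by move: iv; rewrite /ival vi; case: (fits v f).
  apply: wp_seq; apply: wp_assign0; rewrite [eval _ _]/=; set m1 := update m' _ _ _.
  have A1 : agree [:: Work xId] m' m1 by exact: agree_update.
  have im1 : inp m1 := inp_agree im' A1 isT.
  apply: wp_seq.
  apply: wp_conseq (@insert_loop_spec m1 v i f cnt im1 (pos_all_agree pos' A1 isT) _ _ _ _ _ _ vi ff) _ => //.
  move=> t2 m2 A2 [t2a [cnt2 [id [[cnt2E tok2 id2 w2] [mono row2]]]]].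
  have im2 := inp_agree im1 A2 isT.
  have m2V : m2 (Work xV) [::] = Num (code v) by rewrite (A2 (Work xV) _ isT).
  have m2I : m2 (Work xI) [::] = Num i by rewrite (A2 (Work xI) _ isT).
  have m2W : m2 aW [:: inl (code v); inl i] = Val b by rewrite (A2 aW _ isT) [LHS]Wi iv.
  have m2a : m2 aAgg [:: inl (code v); inl id] =
      opt (sum_opt (op_at v) [seq ival v i' | i' <- group m' v i id]).
    by rewrite (A2 aAgg _ isT) [LHS]agg.
  apply: wp_seq; apply: wp_conseq (aggregate_spec im2 m2V m2I id2 m2a m2W) _.
  move=> t3 m3 A3 [t33 agg3].
  have m3V : m3 (Work xV) [::] = Num (code v) by rewrite (A3 (Work xV) _ isT).
  have m3I : m3 (Work xI) [::] = Num i by rewrite (A3 (Work xI) _ isT).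
  have m3Id : m3 (Work xId) [::] = Num id by rewrite (A3 (Work xId) _ isT).
  apply: wp_conseq (push_fact_spec m3V m3I m3Id) _ => t4 m4 A4 [-> next4 head4].
  split; first by rewrite (A4 (Work xI) _ isT) (A3 (Work xI) _ isT).
  set m5 := update m4 _ _ _.
  have trie5 ks : m5 aTrie ks = m2 aTrie ks.
    by rewrite /m5 update_array // (A4 aTrie _ isT) (A3 aTrie _ isT).
  have walk5 : walk m5 v =1 walk m2 v by apply: eq_walk.
  have group5 id' : group m5 v i id' = group m' v i id'.
    apply: eq_in_filter => i'; rewrite mem_iota => /andP[_ i'i].
    case i'v: (ival v i') => [b'|] //=; rewrite walk5.
    have : walk m' v (ikey v i') by apply: wok; rewrite ?i'v.
    by case w: (walk _ _ _) => [n|] // _; rewrite (mono _ n).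
  have ik : ikey v i = full_key v (read v f) by rewrite /ikey vi.
  have groupS5 id' : group m5 v i.+1 id' =
      if id' == id then rcons (group m' v i id) i else group m' v i id'.
    rewrite groupS iv group5 walk5 ik w2 /=.
    have -> : (Some id == Some id') = (id' == id) by rewrite eq_sym.
    by case: eqP => [->|].
  have rowN k (ks : seq (nat + C)) j : k != inl (code v) ->
      (k :: ks == [:: inl (code v); inl j]) = false.
    by move=> kv; rewrite eqseq_cons (negPf kv).
  split.
  - by rewrite -/a in t2a; lia.
  - exists cnt2; split.
      by rewrite /m5 update_array // (A4 (Work xCnt) _ isT) (A3 (Work xCnt) _ isT).
    split; first by apply: eq_trie_ok tok2.
    + move=> i' i'i i'v; rewrite walk5; have [->|i'n] := eqVneq i' i; first by rewrite ik w2.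
      have : walk m' v (ikey v i') by apply: wok; rewrite ?i'v //; lia.
      by case w: (walk _ _ _) => [n|] // _; rewrite (mono _ n).
    + move=> id'; rewrite groupS5 /m5 update_array // (A4 aAgg _ isT) agg3.
      rewrite row_neq (_ : ([:: inl id'] == [:: inl id] :> seq (nat + C)) = (id' == id)); last first.
        by rewrite eqseq_cons andbT.
      case: eqP => [_|_]; first by rewrite map_rcons sum_opt_rcons iv.
      by rewrite (A2 aAgg _ isT) [LHS]agg.
    + move=> id'; rewrite groupS5 /m5 update_array // head4 row_neq.
      rewrite (_ : ([:: inl id'] == [:: inl id] :> seq (nat + C)) = (id' == id)); last first.
        by rewrite eqseq_cons andbT.
      have tail id0 : chain m5 v (m3 aHead [:: inl (code v); inl id0]) (rev (group m' v i id0)).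
        rewrite (A3 aHead _ isT) (A2 aHead _ isT); apply: eq_chain (ch id0) => i'.
        rewrite mem_rev mem_filter mem_iota => /andP[_ i'i].
        rewrite /m5 update_array // next4 row_neq ifN ?(A3 aNext _ isT) ?(A2 aNext _ isT) //.
        by rewrite eqseq_cons andbT; apply/eqP => -[]; lia.
      case: eqP => [_|_]; last exact: tail.
      rewrite rev_rcons; split=> //.
      by rewrite /m5 update_array // next4 eqxx; apply: tail.
  - split=> k ks kv; rewrite /m5 update_array //.
    + by rewrite (A4 aTrie _ isT) (A3 aTrie _ isT) row2 // -r1.
    + by rewrite (A4 aAgg _ isT) agg3 rowN // (A2 aAgg _ isT) -r2.
    + by rewrite head4 rowN // (A3 aHead _ isT) (A2 aHead _ isT) -r3.
    + by rewrite next4 rowN // (A3 aNext _ isT) (A2 aNext _ isT) -r4.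
- move=> t m' A [tn [cnt [_ G]] R]; split=> //; first by lia.
  by exists cnt.
Qed.

Definition joins v z (i : nat) : bool :=
  if onth (node_facts v) i is Some f then restrict (shared v) (read v f) == z else false.

Definition siblings v z : seq nat :=
  [seq i <- iota 0 (size (node_facts v)) | ival v i && joins v z i].

Lemma sum_opt_somes op (xs : seq (option K)) :
  sum_opt op [seq o <- xs | isSome o] = sum_opt op xs.
Proof.
rewrite /sum_opt; elim: xs None => //= -[a|] xs IH o /=; first exact: IH.
by rewrite IH; case: o.
Qed.

(** Passes from facts to ranks and drops the dangling ones, whose [None] is neutral in the sum; this
    is the form in which the machine meets the message. *)
Lemma message_siblings v z :
  message v z = sum_opt (op_at v) [seq ival v i | i <- siblings v z].
Proof.
have onth_iota (A : Type) (l : seq A) : [seq onth l i | i <- iota 0 (size l)] = map Some l.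
  apply: (@eq_from_nth _ None); rewrite !size_map size_iota // => i il.
  by rewrite (nth_map 0) ?size_iota // nth_iota // add0n onthE.
pose F (o : option (fact S C)) := if o is Some f then
    if fits v f then tuple_val v (read v f) else None else None.
pose M (o : option (fact S C)) := if o is Some f then restrict (shared v) (read v f) == z
  else false.
have -> : [seq ival v i | i <- siblings v z] =
    [seq F o | o <- map Some (node_facts v) & F o && M o].
  by rewrite -onth_iota filter_map -map_comp.
rewrite filter_map -map_comp -[LHS]sum_opt_somes; congr sum_opt.
elim: (node_facts v) => //= f l IH.
case ff: (fits v f); case: (_ == z); case tf: (tuple_val v (read v f)) => [b|];
  by rewrite /= ?ff ?tf /= ?IH.
Qed.

Lemma ival_adom v i : ival v i ->
  exists2 f, onth (node_facts v) i = Some f & adom (read v f) = nvars v /\ fits v f.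
Proof.
rewrite /ival; case vi: (onth _ _) => [f|] //; case ff: (fits v f) => // _.
have fv : f \in node_facts v by apply/onthP; exists i.
by exists f => //; split=> //; apply: adom_read fv.
Qed.

(** Keys at [v] all have the same length, so by [walk_inj] reaching the same trie node means having
    the same key, which is agreement on the shared variables. *)
Lemma group_siblings m v cnt h id : gathered m v (size (node_facts v)) cnt ->
  shared v \subset adom h -> walk m v (full_key v h) = Some id ->
  group m v (size (node_facts v)) id = siblings v (restrict (shared v) h).
Proof.
move=> [tok wok _ _] sh wh; apply: eq_in_filter => i; rewrite mem_iota => /andP[_ iv].
case vi: (ival v i) => [b|] //=; have [|f vif [fa ff]] := @ival_adom v i; first by rewrite vi.
have := wok i iv; rewrite vi => /(_ isT).
have sf : shared v \subset adom (read v f) by rewrite fa shared_sub.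
rewrite /joins /ikey vif /= -(full_key_eq sf sh).
case w: (walk _ _ _) => [id'|] // _; apply/eqP/eqP => [[id'E]|e].
  by apply: (walk_inj tok) w _; rewrite ?size_full_key // wh id'E.
by rewrite -w e wh.
Qed.

(** When the walk fails there is no sibling, since a live fact with this key would have created the
    path; the message is then an empty sum, read as bottom. *)
Lemma agg_lookup m v cnt h : gathered m v (size (node_facts v)) cnt ->
  shared v \subset adom h ->
  (if walk m v (full_key v h) is Some id then m aAgg [:: inl (code v); inl id] else Bot) =
  opt (message v (restrict (shared v) h)).
Proof.
move=> G sh; case w: (walk _ _ _) => [id|].
  have [_ _ -> _] := G; by rewrite (group_siblings G sh w) message_siblings.
rewrite message_siblings; suff -> : siblings v (restrict (shared v) h) = [::] by [].
have [tok wok _ _] := G; apply/eqP; rewrite -[_ == _]negbK -has_filter; apply/hasPn => i.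
rewrite mem_iota => /andP[_ iv]; apply/negP => /andP[iv' ij].
have [f vif [fa ff]] := ival_adom iv'; have := wok i iv iv'; rewrite /ikey vif /=.
have sf : shared v \subset adom (read v f) by rewrite fa shared_sub.
move: ij; rewrite /joins vif -(full_key_eq sf sh) => /eqP->.
by rewrite w.
Qed.

(** The content of [aW] between two node steps, when only the children in [Q] have sent their
    messages. *)
Definition cval (Q : {set N}) u f : option K :=
  if fits u f then omul times (init D nu u (read u f))
    (\big[omul times/Some (cm_one times)]_(c | (par c == Some u) && (c \in Q))
      gate thr c (message c (restrict (shared c) (read u f))))
  else None.

Lemma cval_setU1 Q v p f : v \notin Q -> par v = Some p ->
  cval (v |: Q) p f =
  omul times (cval Q p f) (gate thr v (message v (restrict (shared v) (read p f)))).
Proof.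
move=> vQ vp; rewrite /cval; case: (fits p f) => //.
rewrite (bigD1 v) /=; last by rewrite vp eqxx setU11.
rewrite -Monoid.mulmA; congr omul; rewrite Monoid.mulmC; congr omul.
apply: eq_bigl => c; rewrite in_setU1; case: (eqVneq c v) => [->|_]; rewrite ?andbT //=.
by rewrite (negPf vQ) !andbF.
Qed.

Lemma cval_other Q v u f : par v <> Some u -> cval (v |: Q) u f = cval Q u f.
Proof.
move=> vu; rewrite /cval; case: ifP => // _; congr omul; apply: eq_bigl => c.
by rewrite in_setU1; case: (eqVneq c v) => [->|] //=; case: eqP.
Qed.

Lemma cval_ival Q v i f : (forall c, par c = Some v -> c \in Q) ->
  onth (node_facts v) i = Some f -> cval Q v f = ival v i.
Proof.
move=> chQ vi; rewrite /ival vi /cval tuple_valE //; case: ifP => // _; congr omul.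
by apply: eq_bigl => c; case: eqP => // /chQ->.
Qed.

Lemma tuple_val_message c v h : par c = Some v -> tuple_val v h <> None ->
  message c (restrict (shared c) h) <> None.
Proof.
move=> cv; rewrite tuple_valE // (bigD1 c) ?cv //=.
case: (message c _) => // nN; case: nN; rewrite /gate if_same /=.
by rewrite omul_None.
Qed.

(** After a missing edge [xId] is bottom and remains so, because reading at a bottom index gives
    bottom; no test inside the loop is involved. *)
Lemma lookup_loop_spec m v p i f cnt : inp m -> pos_all m -> par v = Some p ->
  m (Work xV) [::] = Num (code v) -> m (Work xP) [::] = Num (code p) ->
  m (Work xI) [::] = Num i -> m (Work xId) [::] = Num 0 -> trie_ok m v cnt ->
  onth (node_facts p) i = Some f -> fits p f ->
  wp lookup_loop m (fun t m' => t <= 4 * size (at_ v).2 + 2 /\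
    m' (Work xId) [::] = oapp Num Bot (walk m v (full_key v (read p f)))).
Proof.
move=> im pos vp mV mP mI mId tok vi ff; set ts := (at_ v).2.
have fp : f \in node_facts p by apply/onthP; exists i.
have ap : adom (read p f) = nvars p := adom_read fp.
pose I j t m' := t <= 4 * j + 1 /\
  m' (Work xId) [::] = oapp Num Bot (walk m v (key v j (read p f))).
apply: (wp_for (n := size ts) (I := I)).
- by split=> //; rewrite update_array // /key /kvars take0.
- move=> j t m' _ A mJ _; have im' := inp_agree im A isT.
  by rewrite (eval_node_arity im' (e := var xV) (v := v)) // [LHS](A (Work xV) [::] isT).
- move=> j t m' jts A mJ [tj idj].
  have im' := inp_agree im A isT; have pos' := pos_all_agree pos A isT.
  have mV' : m' (Work xV) [::] = Num (code v) by rewrite (A (Work xV) [::] isT).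
  have mP' : m' (Work xP) [::] = Num (code p) by rewrite (A (Work xP) [::] isT).
  have mP2 : m' (Work xP) [::] = Num (pcode v) by rewrite mP' /pcode vp.
  have mI' : m' (Work xI) [::] = Num i by rewrite (A (Work xI) [::] isT).
  have [b tsj] := onth_lt jts.
  have out : (if b is inl x then x \notin shared v else true) ->
      I j.+1 (t + 1 + 2) (update m' (Work xJ) [::] (Num j.+1)).
    by move=> bs; split; [lia | rewrite (keyS_out _ tsj bs) update_array].
  apply: wp_if; rewrite holds_IsBot.
  case: b tsj out => [x|y] tsj out; last first.
    by rewrite (eval_par_pos_cst im' mV' mJ tsj) /=; apply: wp_skip; split=> //; apply: out.
  have pe := eval_par_pos im' pos' mV' mP2 mJ tsj; rewrite pe.
  case xs: (x \in shared v) out pe => out pe /=; last by apply: wp_skip; split=> //; apply: out.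
  have xp : x \in nvars p by apply: (subsetP (shared_par vp)) xs.
  have [y hx] : exists y, read p f x = Some y.
    by move: xp; rewrite -ap in_set; case: (read p f x) => // y _; exists y.
  have fx : onth f.2 (par_pos v x) = Some y by rewrite -hx ffunE xp /par_pos vp.
  have fy : eval m' (fact_at (var xP) (var xI) par_pos_entry) = Cst y.
    by rewrite (eval_fact_at im' (e := var xP) (v := p) mP' pe (ei := var xI) (i := i) mI') vi /= fx.
  apply: wp_assign0; split; first by rewrite update_array.
  split; first by lia.
  rewrite update_array // update_same (keyS tsj hx) xs walk_rcons.
  case w: (walk m v _) idj => [id|] idj; last exact: eval_read3_bot2.
  rewrite (eval_read3 _ (k1 := inl (code v)) (k2 := inl id) (k3 := inr y)) ?fy //.
  - by have [_ -> _ _] := eq_trie_ok (fun ks => A aTrie _ isT) tok; rewrite /tr (A aTrie _ isT).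
  - by rewrite [eval _ _]mV'.
  - by rewrite [eval _ _]idj.
- by move=> t m' A [tn R]; split; first by lia.
Qed.

Context (thrE : expr).
Hypothesis thr_ok : forall m, inp m -> eval m thrE = Num thr.

Lemma multiply_spec m v p i (x : option K) (b : K) : inp m ->
  m (Work xV) [::] = Num (code v) -> m (Work xP) [::] = Num (code p) ->
  m (Work xI) [::] = Num i -> eval m agg_entry = opt x ->
  m aW [:: inl (code p); inl i] = Val b ->
  wp (multiply thrE) m (fun t m' => t <= 3 /\ forall ks, m' aW ks =
    if ks == [:: inl (code p); inl i] then opt (omul times (Some b) (gate thr v x))
    else m aW ks).
Proof.
move=> im mV mP mI ae wb.
have mV' : eval m (var xV) = Num (code v) by [].
have we : eval m (Read aW [:: var xP; var xI]) = Val b.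
  by rewrite (eval_read2 _ (k1 := inl (code p)) (k2 := inl i)) // [eval _ _]/= ?mP ?mI.
have assign e w : eval m e = w -> w = opt (omul times (Some b) (gate thr v x)) ->
    forall k, k <= 2 ->
    wp (Assign aW [:: var xP; var xI] e) m (fun t m' => t + k <= 3 /\ forall ks, m' aW ks =
    if ks == [:: inl (code p); inl i] then opt (omul times (Some b) (gate thr v x))
    else m aW ks).
  move=> ew wE k k2; apply: (wp_assign2 (k1 := inl (code p)) (k2 := inl i)).
  - by rewrite [eval _ _]mP.
  - by rewrite [eval _ _]mI.
  - by split; [lia | move=> ks; rewrite update_ks ew wE].
apply: wp_if; rewrite holds_IsBot ae; case: x ae assign => [a|] ae assign /=; last first.
  apply: wp_conseq (assign bot Bot _ _ 1 isT) _ => [||t m' _ [? ?]] //=.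
  - by rewrite /gate if_same.
  - by split=> //; lia.
apply: wp_if; rewrite (@holds_Le _ _ _ _ _ _ _ (level v + 1) thr) ?thr_ok //; last first.
  by apply: eval_add => //; apply: (eval_node_level im (e := var xV) (v := v)).
rewrite addn1; case: ifP => lv.
  apply: wp_conseq (assign _ (Val (times b a)) (eval_stimes we ae) _ 2 isT) _ => [|t m' _ [? ?]].
    by rewrite /gate lv.
  by split=> //; lia.
apply: wp_skip; split=> // ks; case: eqP => // ->; rewrite wb /gate lv /= Monoid.mulm1.
by [].
Qed.

Lemma scatter_spec m v p Q cnt : inp m -> pos_all m -> par v = Some p -> v \notin Q ->
  m (Work xV) [::] = Num (code v) -> m (Work xP) [::] = Num (code p) ->
  gathered m v (size (node_facts v)) cnt ->
  (forall i f, onth (node_facts p) i = Some f ->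
     m aW [:: inl (code p); inl i] = opt (cval Q p f)) ->
  wp (scatter thrE) m (fun t m' => [/\
    t <= (4 * size (at_ v).2 + 10) * size (node_facts p) + 2,
    forall i f, onth (node_facts p) i = Some f ->
      m' aW [:: inl (code p); inl i] = opt (cval (v |: Q) p f),
    forall i f, onth (node_facts p) i = Some f -> cval Q p f ->
      m' aKey [:: inl (code v); inl i] = oapp Num Bot (walk m v (full_key v (read p f))) &
    other_rows m m' p aW /\ other_rows m m' v aKey]).
Proof.
move=> im pos vp vQ mV mP G mW; set a := size (at_ v).2.
have [tok _ _ _] := G.
pose I i t m' := [/\ t <= (4 * a + 10) * i + 1,
    forall i' f, onth (node_facts p) i' = Some f ->
      m' aW [:: inl (code p); inl i'] = opt (cval (if i' < i then v |: Q else Q) p f),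
    forall i' f, i' < i -> onth (node_facts p) i' = Some f -> cval Q p f ->
      m' aKey [:: inl (code v); inl i'] = oapp Num Bot (walk m v (full_key v (read p f))) &
    other_rows m m' p aW /\ other_rows m m' v aKey].
apply: (wp_for (n := size (node_facts p)) (I := I)).
- split=> //; first by rewrite muln0.
- move=> i t m' _ A mI _; have im' := inp_agree im A isT.
  by rewrite (eval_node_nfacts im' (e := var xP) (v := p)) // [LHS](A (Work xP) [::] isT).
- move=> i t m' inf A mI [ti Wi Ki [r1 r2]].
  have im' := inp_agree im A isT; have pos' := pos_all_agree pos A isT.
  have mV' : m' (Work xV) [::] = Num (code v) by rewrite (A (Work xV) [::] isT).
  have mP' : m' (Work xP) [::] = Num (code p) by rewrite (A (Work xP) [::] isT).
  have [f vi] := onth_lt inf.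
  have Wif := Wi i f vi; rewrite ltnn in Wif.
  have other i' f' : onth (node_facts p) i' = Some f' -> i' <> i ->
      m' aW [:: inl (code p); inl i'] = opt (cval (if i' < i.+1 then v |: Q else Q) p f').
    by move=> vi' ii; rewrite (Wi _ _ vi'); have -> : (i' < i.+1) = (i' < i) by lia.
  have We : eval m' (Read aW [:: var xP; var xI]) = opt (cval Q p f).
    rewrite (eval_read2 _ (k1 := inl (code p)) (k2 := inl i)) //.
    - by rewrite [eval _ _]mP'.
    - by rewrite [eval _ _]mI.
  apply: wp_if; rewrite holds_IsBot We; case iv: (cval Q p f) => [b|] /=; last first.
    apply: wp_skip; split=> //; split=> //; first by rewrite -/a; lia.
    - move=> i' f' vi'; rewrite update_array //; have [ii|/eqP ii] := eqVneq i' i; last exact: other.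
      move: vi'; rewrite ii ltnSn vi => -[<-]; rewrite Wif iv (cval_setU1 _ vQ vp) iv.
      by case: (gate _ _ _).
    - move=> i' f' i'i vi' f'v; rewrite update_array //; apply: Ki => //.
      suff : i' != i by lia.
      by apply: contraTneq f'v => ii; move: vi'; rewrite ii vi => -[<-]; rewrite iv.
  have ff : fits p f by move: iv; rewrite /cval; case: (fits p f).
  have fp : f \in node_facts p by apply/onthP; exists i.
  have sh : shared v \subset adom (read p f) by rewrite (adom_read fp) (shared_par vp).
  apply: wp_seq; apply: wp_assign0; rewrite [eval _ _]/=; set m1 := update m' _ _ _.
  have A1 : agree [:: Work xId] m' m1 by exact: agree_update.
  have im1 : inp m1 := inp_agree im' A1 isT.
  have tok1 : trie_ok m1 v cnt.
    by apply: eq_trie_ok tok => ks; rewrite (A1 aTrie _ isT) (A aTrie _ isT).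
  have walk1 : walk m1 v =1 walk m v.
    by apply: eq_walk => ks; rewrite (A1 aTrie _ isT) (A aTrie _ isT).
  apply: wp_seq.
  apply: wp_conseq (@lookup_loop_spec m1 v p i f cnt im1 (pos_all_agree pos' A1 isT) vp _ _ _ _ tok1 vi ff) _ => //.
  move=> t2 m2 A2 [t2a id2]; rewrite walk1 in id2.
  have im2 := inp_agree im1 A2 isT.
  have m2V : m2 (Work xV) [::] = Num (code v) by rewrite (A2 (Work xV) _ isT).
  have m2P : m2 (Work xP) [::] = Num (code p) by rewrite (A2 (Work xP) _ isT).
  have m2I : m2 (Work xI) [::] = Num i by rewrite (A2 (Work xI) _ isT).
  have m2W : m2 aW [:: inl (code p); inl i] = Val b.
    by rewrite (A2 aW _ isT) [LHS]Wif iv.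
  have ae : eval m2 agg_entry = opt (message v (restrict (shared v) (read p f))).
    rewrite -(agg_lookup G sh); case w: (walk m v _) id2 => [id|] id2; last first.
      exact: eval_read2_bot.
    rewrite (eval_read2 _ (k1 := inl (code v)) (k2 := inl id)).
    - by rewrite (A2 aAgg _ isT) (A1 aAgg _ isT) (A aAgg _ isT).
    - by rewrite [eval _ _]m2V.
    - by rewrite [eval _ _]id2.
  apply: wp_seq; apply: wp_conseq (multiply_spec im2 m2V m2P m2I ae m2W) _.
  move=> t3 m3 A3 [t33 W3].
  apply: (wp_assign2 (k1 := inl (code v)) (k2 := inl i)).
  - by rewrite [eval _ _](A3 (Work xV) _ isT) m2V.
  - by rewrite [eval _ _](A3 (Work xI) _ isT) m2I.
  rewrite [eval _ _](A3 (Work xId) _ isT) id2; set m4 := update m3 _ _ _.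
  split; first by rewrite /m4 update_array // (A3 (Work xI) _ isT).
  have eqi i' : ([:: inl i'] == [:: inl i] :> seq (nat + C)) = (i' == i).
    by rewrite eqseq_cons andbT.
  have W2 ks : m2 aW ks = m' aW ks by rewrite (A2 aW _ isT).
  have K3 ks : m3 aKey ks = m' aKey ks by rewrite (A3 aKey _ isT) (A2 aKey _ isT).
  split.
  - by rewrite -/a in t2a; lia.
  - move=> i' f' vi'; rewrite update_array // /m4 update_array // W3 row_neq eqi.
    case: eqP => [ii|ii]; last by rewrite W2; apply: other.
    by move: vi'; rewrite ii ltnSn vi => -[<-]; rewrite (cval_setU1 _ vQ vp) iv.
  - move=> i' f' i'i vi' f'v; rewrite update_array // /m4 update_ks row_neq eqi.
    case: eqP => [ii|ii]; first by move: vi'; rewrite ii vi => -[<-].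
    by rewrite K3; apply: Ki => //; lia.
  - split=> k ks kv; rewrite update_array // /m4.
    + by rewrite update_array // W3 eqseq_cons (negPf kv) W2 -r1.
    + by rewrite update_ks eqseq_cons (negPf kv) K3 -r2.
- move=> t m' A [tn Wn Kn R]; split=> //; first by lia.
  + by move=> i f vi; rewrite (Wn i f vi) -onthTE vi.
  + by move=> i f vi; apply: Kn => //; rewrite -onthTE vi.
Qed.

Lemma scatter_root m v : inp m -> par v = None -> m (Work xP) [::] = Num #|N| ->
  wp (scatter thrE) m (fun t m' => t <= 2 /\ agree [:: Work xI] m m').
Proof.
move=> im vn mP.
apply: (wp_for (n := 0) (I := fun i t m' => t <= 1 /\ (i = 0 -> agree [:: Work xI] m m'))).
- by split=> // _; apply: agree_update.
- move=> i t m' _ A mI _; have im' := inp_agree im A isT.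
  by apply: (bound_nfacts_out im' (n := #|N|)) => //; rewrite [LHS](A (Work xP) [::] isT).
- by [].
- by move=> t m' A [t1 /(_ erefl)].
Qed.

Definition none : assignment V C := [ffun => None].

(** What the enumeration retains of the messages: from a live fact of the parent, [aKey] leads to
    the list of matching facts of [v]. The root has the empty key, hence trie node 0. *)
Definition linked m v : Prop :=
  if par v is Some p then
    forall i f, onth (node_facts p) i = Some f -> ival p i ->
    exists id, m aKey [:: inl (code v); inl i] = Num id /\
      chain m v (m aHead [:: inl (code v); inl id])
        (rev (siblings v (restrict (shared v) (read p f))))
  else m aAgg [:: inl (code v); inl 0] = opt (message v none) /\
    chain m v (m aHead [:: inl (code v); inl 0]) (rev (siblings v none)).

Definition same_row m m' v (a : array) : Prop :=
  forall ks, m' a (inl (code v) :: ks) = m a (inl (code v) :: ks).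

Lemma eq_linked m m' v : same_row m m' v aKey -> same_row m m' v aHead ->
  same_row m m' v aNext -> same_row m m' v aAgg -> linked m v -> linked m' v.
Proof.
move=> rk rh rn ra; rewrite /linked; case: (par v) => [p|].
  move=> lk i f vi iv; have [id [kE ch]] := lk i f vi iv; exists id; split; first by rewrite rk.
  by rewrite rh; apply: eq_chain ch => i' _; rewrite rn.
move=> [aE ch]; split; first by rewrite ra.
by rewrite rh; apply: eq_chain ch => i' _; rewrite rn.
Qed.

(** A fact alive at the end was alive at every earlier stage, in particular when [scatter] recorded
    its key; dangling facts get none. *)
Lemma ival_cval Q p i f : onth (node_facts p) i = Some f -> ival p i -> cval Q p f.
Proof.
move=> pi; rewrite /ival pi /cval; case: (fits p f) => //.
rewrite tuple_valE // (bigID (fun c => c \in Q)) /= (omulA times).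
by set x := omul times (init _ _ _ _) _; case: x.
Qed.

Definition parent_nfacts v : nat := oapp (fun p => size (node_facts p)) 0 (par v).

Definition cost2 v : nat :=
  (7 * size (at_ v).2 + 11) * size (node_facts v)
  + (4 * size (at_ v).2 + 10) * parent_nfacts v + 6.

Lemma restrict0 h : restrict set0 h = none.
Proof. by apply/ffunP => x; rewrite !ffunE in_set0. Qed.

Lemma shared_root v : par v = None -> shared v = set0.
Proof. by rewrite /shared => ->. Qed.

Definition values_ok m Q : Prop := forall u i f, onth (node_facts u) i = Some f ->
  m aW [:: inl (code u); inl i] = opt (cval Q u f).

Lemma code_row u v : u <> v -> inl (code u) != inl (code v) :> nat + C.
Proof. by move=> uv; apply/eqP => -[/code_inj]. Qed.

Lemma node_step_spec m v Q : inp m -> pos_all m ->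
  m (Work xV) [::] = Num (code v) -> m aPar [:: inl (code v)] = Num (pcode v) ->
  row_blank m v aTrie -> row_blank m v aAgg -> row_blank m v aHead ->
  v \notin Q -> (forall c, par c = Some v -> c \in Q) -> values_ok m Q ->
  wp (node_step thrE) m (fun t m' => [/\ t <= cost2 v, values_ok m' (v |: Q), linked m' v
    & [/\ other_rows m m' v aTrie, other_rows m m' v aAgg, other_rows m m' v aHead,
         other_rows m m' v aNext & other_rows m m' v aKey]]).
Proof.
move=> im pos mV mPar bt ba bh vQ chQ mW.
apply: wp_seq; apply: wp_assign0.
rewrite (eval_read1 _ (k1 := inl (code v))) ?mPar; last by rewrite [eval _ _]mV.
apply: wp_seq; apply: wp_assign0; rewrite [eval _ _]/=; set m1 := update _ _ _ _.
have A1 : agree [:: Work xCnt; Work xP] m m1.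
  move=> a ks; rewrite !inE negb_or => /andP[a1 a2].
  by rewrite /m1 update_array // update_array.
have im1 : inp m1 := inp_agree im A1 isT.
have pos1 : pos_all m1 := pos_all_agree pos A1 isT.
have m1V : m1 (Work xV) [::] = Num (code v) by rewrite (A1 (Work xV) _ isT).
have m1P : m1 (Work xP) [::] = Num (pcode v).
  by rewrite /m1 update_array // update_same.
apply: wp_seq; apply: wp_conseq (@gather_spec m1 v im1 pos1 m1V m1P _ _ _ _ _) _.
- by rewrite /m1 update_same.
- by move=> ks; rewrite (A1 aTrie _ isT).
- by move=> ks; rewrite (A1 aAgg _ isT).
- by move=> ks; rewrite (A1 aHead _ isT).
- by move=> i f vi; rewrite (A1 aW _ isT) (mW _ _ _ vi) (cval_ival chQ vi).
move=> t2 m2 A2 [t2a [cnt G] [r1 r2 r3 r4]].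
have im2 := inp_agree im1 A2 isT; have pos2 := pos_all_agree pos1 A2 isT.
have m2V : m2 (Work xV) [::] = Num (code v) by rewrite (A2 (Work xV) _ isT).
have m2P : m2 (Work xP) [::] = Num (pcode v) by rewrite (A2 (Work xP) _ isT).
have m2W ks : m2 aW ks = m aW ks by rewrite (A2 aW _ isT) (A1 aW _ isT).
case vp: (par v) => [p|]; last first.
  apply: wp_conseq (@scatter_root m2 v im2 vp _) _; first by rewrite m2P /pcode vp.
  move=> t3 m3 _ [t3a A3]; split.
  - by rewrite /cost2; lia.
  - move=> u i f ui; rewrite (A3 aW _ isT) m2W (mW _ _ _ ui) cval_other // vp.
    by [].
  - have full0 : full_key v none = [::].
      by rewrite /full_key /key; elim: (kvars _ _) => //= x l IH; rewrite ffunE.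
    have sh0 : shared v \subset adom none by rewrite shared_root // sub0set.
    have w0 : walk m2 v (full_key v none) = Some 0 by rewrite full0.
    rewrite /linked vp; split.
      rewrite (A3 aAgg _ isT); have := agg_lookup G sh0; rewrite w0 => ->.
      by rewrite shared_root // restrict0.
    have [_ _ _ /(_ 0)] := G; rewrite (group_siblings G sh0 w0) shared_root // restrict0.
    by rewrite (A3 aHead _ isT); apply: eq_chain => i' _; rewrite (A3 aNext _ isT).
  - split=> k ks kv.
    + by rewrite (A3 aTrie _ isT) r1 // (A1 aTrie _ isT).
    + by rewrite (A3 aAgg _ isT) r2 // (A1 aAgg _ isT).
    + by rewrite (A3 aHead _ isT) r3 // (A1 aHead _ isT).
    + by rewrite (A3 aNext _ isT) r4 // (A1 aNext _ isT).
    + by rewrite (A3 aKey _ isT) (A2 aKey _ isT) (A1 aKey _ isT).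
have m2P' : m2 (Work xP) [::] = Num (code p) by rewrite m2P /pcode vp.
apply: wp_conseq (@scatter_spec m2 v p Q cnt im2 pos2 vp vQ m2V m2P' G _) _.
  by move=> i f pi; rewrite m2W (mW _ _ _ pi).
move=> t3 m3 A3 [t3a W3 K3 [r5 r6]].
split.
- have -> : cost2 v = (7 * size (at_ v).2 + 11) * size (node_facts v)
      + (4 * size (at_ v).2 + 10) * size (node_facts p) + 6.
    by rewrite /cost2 /parent_nfacts vp.
  by move: t2a t3a; clear; lia.
- move=> u i f ui; have [up|/eqP up] := eqVneq u p; first by rewrite up in ui *; apply: W3.
  rewrite r5 ?code_row // m2W (mW _ _ _ ui) cval_other // vp => -[pu].
  by rewrite pu in up.
- rewrite /linked vp => i f pi iv.
  have fp : f \in node_facts p by apply/onthP; exists i.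
  have sh : shared v \subset adom (read p f) by rewrite (adom_read fp) (shared_par vp).
  have pv := ival_cval Q pi iv; rewrite (K3 i f pi pv).
  have mN : message v (restrict (shared v) (read p f)) <> None.
    apply: tuple_val_message vp _; move: iv; rewrite /ival pi.
    by case: (fits p f) => //; case: (tuple_val _ _).
  have := agg_lookup G sh; case w: (walk m2 v _) => [id|]; last first.
    by case: (message _ _) mN.
  move=> _; exists id; split=> //; have [_ _ _ /(_ id)] := G.
  rewrite (group_siblings G sh w) (A3 aHead _ isT).
  by apply: eq_chain => i' _; rewrite (A3 aNext _ isT).
- split=> k ks kv.
  + by rewrite (A3 aTrie _ isT) r1 // (A1 aTrie _ isT).
  + by rewrite (A3 aAgg _ isT) r2 // (A1 aAgg _ isT).
  + by rewrite (A3 aHead _ isT) r3 // (A1 aHead _ isT).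
  + by rewrite (A3 aNext _ isT) r4 // (A1 aNext _ isT).
  + by rewrite r6 // (A2 aKey _ isT) (A1 aKey _ isT).
Qed.

Definition order_ok m : Prop :=
  (forall k v, onth s k = Some v -> m aOrd [:: inl k] = Num (code v)) /\
  (forall v, m aPar [:: inl (code v)] = Num (pcode v)).

Definition processed (k : nat) : {set N} := [set u | size s <= index u s + k].

Lemma size_s : size s = #|N|.
Proof.
have [us _] := s_ord; rewrite -(card_uniqP us); apply: eq_card => v.
by rewrite s_all.
Qed.

(** Reading [s] backwards treats children before parents. Rows of nodes not yet treated are still
    blank, so no array ever has to be cleared. *)
Lemma phase2_spec m : inp m -> pos_all m -> order_ok m ->
  (forall v, row_blank m v aTrie) -> (forall v, row_blank m v aAgg) ->
  (forall v, row_blank m v aHead) -> facts_ok T D nu m ->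
  wp (phase2 thrE) m (fun t m' => [/\ t <= \sum_v (cost2 v + 3) + 2,
    forall v i f, onth (node_facts v) i = Some f ->
      m' aW [:: inl (code v); inl i] = opt (ival v i) &
    forall v, linked m' v]).
Proof.
move=> im pos [ord opar] bt ba bh mW; have [us _] := s_ord.
pose I k t m' := [/\ t <= \sum_(u in processed k) (cost2 u + 3) + 1,
  values_ok m' (processed k),
  forall u, u \in processed k -> linked m' u &
  forall u, u \notin processed k ->
    [/\ row_blank m' u aTrie, row_blank m' u aAgg & row_blank m' u aHead]].
have proc0 : processed 0 = set0.
  apply/setP => u; rewrite !inE addn0; apply/negbTE; rewrite -ltnNge index_mem.
  exact: s_all.
apply: (wp_for (n := #|N|) (I := I)).
- split.
  + by rewrite proc0 big_set0.
  + move=> u i f ui; rewrite update_array // (mW _ _ _ ui) proc0 /cval.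
    rewrite big_pred0 => [|c]; last by rewrite in_set0 andbF.
    rewrite Monoid.mulm1 /init_val; case ff: (fits u f) => //.
    by rewrite init_read //; apply/onthP; exists i.
  + by move=> u; rewrite proc0 in_set0.
  + by move=> u _; split; [apply: bt | apply: ba | apply: bh].
- by move=> k t m' _ A mK _; rewrite (eval_num_nodes (inp_agree im A isT)).
- move=> k t m' kN A mK [tk Wk Lk Bk].
  have im' := inp_agree im A isT; have pos' := pos_all_agree pos A isT.
  have [v sv] : exists v, onth s (size s - 1 - k) = Some v by apply: onth_lt; rewrite size_s; lia.
  have iv : index v s = size s - 1 - k.
    by rewrite -(onth_nth v _ _ _ sv) index_uniq // size_s; lia.
  have procS : processed k.+1 = v |: processed k.
    apply/setP => u; rewrite in_setU1 !in_set; have [->|uv] := eqVneq u v.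
      by rewrite iv size_s; lia.
    have : index u s != index v s by apply: contra uv => /eqP/(index_eq s_all)->.
    by rewrite iv size_s /=; lia.
  have vQ : v \notin processed k by rewrite in_set iv size_s; lia.
  apply: wp_seq; apply: wp_assign0.
  have -> : eval m' (Read aOrd [:: Sub (Sub num_nodes (Lit 1)) (var xK)]) = Num (code v).
    rewrite (eval_read1 _ (k1 := inl (size s - 1 - k))).
      by rewrite (A aOrd _ isT) (ord _ _ sv).
    rewrite (@eval_sub _ _ _ _ _ _ _ (size s - 1) k) //; apply: eval_sub => //.
    by rewrite size_s (eval_num_nodes im').
  set m1 := update _ _ _ _.
  have A1 : agree [:: Work xV] m' m1 := @agree_update _ _ _ _ _ _.
  have [b1 b2 b3] := Bk v vQ.
  have im1 := inp_agree im' A1 isT; have pos1 := pos_all_agree pos' A1 isT.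
  apply: wp_conseq (@node_step_spec m1 v (processed k) im1 pos1 _ _ _ _ _ vQ _ _) _.
  + by rewrite /m1 update_same.
  + by rewrite (A1 aPar _ isT) (A aPar _ isT) opar.
  + by move=> ks; rewrite (A1 aTrie _ isT).
  + by move=> ks; rewrite (A1 aAgg _ isT).
  + by move=> ks; rewrite (A1 aHead _ isT).
  + move=> c cv; rewrite in_set; have := par_lt s_ord s_all cv; rewrite iv.
    by have := s_all c; rewrite -index_mem; lia.
  + by move=> u i f ui; rewrite (A1 aW _ isT); apply: Wk.
  move=> t2 m2 A2 [t2a W2 L2 [r1 r2 r3 r4 r5]].
  split; first by rewrite (A2 (Work xK) _ isT) (A1 (Work xK) _ isT).
  split.
  + by rewrite procS big_setU1 //=; lia.
  + by move=> u i f ui; rewrite procS update_array // (W2 u i f ui).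
  + move=> u; rewrite procS in_setU1 => /orP[/eqP->|uk].
      by apply: eq_linked L2 => ks; rewrite update_array.
    have uv : u <> v by move=> uv; rewrite -uv uk in vQ.
    apply: eq_linked (Lk u uk) => ks; rewrite update_array //.
    * by rewrite r5 ?code_row // (A1 aKey _ isT).
    * by rewrite r3 ?code_row // (A1 aHead _ isT).
    * by rewrite r4 ?code_row // (A1 aNext _ isT).
    * by rewrite r2 ?code_row // (A1 aAgg _ isT).
  + move=> u; rewrite procS in_setU1 negb_or => /andP[/eqP uv uk].
    have [c1 c2 c3] := Bk u uk.
    split=> ks; rewrite update_array //.
    * by rewrite r1 ?code_row // (A1 aTrie _ isT) c1.
    * by rewrite r2 ?code_row // (A1 aAgg _ isT) c2.
    * by rewrite r3 ?code_row // (A1 aHead _ isT) c3.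
- move=> t m' A [tn Wn Ln _].
  have all_proc u : u \in processed #|N| by rewrite in_set size_s; lia.
  split.
  + have -> : \sum_v (cost2 v + 3) = \sum_(u in processed #|N|) (cost2 u + 3).
      by apply: eq_bigl => u; rewrite all_proc.
    by rewrite addn2 ltnS; rewrite addn1 in tn.
  + by move=> v i f vi; rewrite (Wn v i f vi) (cval_ival _ vi).
  + by move=> v; apply: Ln.
Qed.

End Propagation.

(** * Searching the tree; evaluation without free variables *)

Definition xBest := 7. Definition xH := 8. Definition xW := 9.
Definition aSeen := Work 19.

Definition find_root : cmd :=
  Seq (Assign (Work xBest) [::] (Lit 0))
    (for_loop xV num_nodes
       (If (Le (Add (node_level (var xBest)) (Lit 1)) (node_level (var xV)))
          (Assign (Work xBest) [::] (var xV)) Skip)).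

Definition start_search : cmd :=
  Seq (Assign aOrd [:: Lit 0] (var xBest))
  (Seq (Assign aSeen [:: var xBest] (Lit 0))
  (Seq (Assign aPar [:: var xBest] num_nodes)
       (Assign (Work xCnt) [::] (Lit 1)))).

Definition visit : cmd :=
  Seq (Assign (Work xW) [::] (Read ANodeNbr [:: var xV; var xJ]))
    (If (IsBot (Read aSeen [:: var xW]))
       (Seq (Assign aSeen [:: var xW] (Lit 0))
       (Seq (Assign aOrd [:: var xCnt] (var xW))
       (Seq (Assign aPar [:: var xW] (var xV))
            (Assign (Work xCnt) [::] (Add (var xCnt) (Lit 1))))))
       Skip).

Definition search_loop : cmd :=
  for_loop xH num_nodes
    (Seq (Assign (Work xV) [::] (Read aOrd [:: var xH]))
         (for_loop xJ (Read ANodeDeg [:: var xV]) visit)).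

Section Search.
Context (S : schema) (V : finType) (C : eqType) (K : Type).
Context (g : query S V C K) (T : connex_join_tree g).
Context (D : database S C) (nu : fact S C -> K).
Local Notation N := (node T).
Local Notation times := (mul g).
Local Notation plus := (unzip1 (steps g)).
Local Notation memory := (Defs.mem C K).
Local Notation eval := (@eval C K times plus).
Local Notation wp := (@wp C K times plus).
Local Notation level := (@level _ _ _ _ _ T).
Local Notation inp := (@inp _ _ _ _ _ T D nu).
Local Notation e := (@edge V T).
Implicit Types (m : memory) (v u w : N) (s : seq N) (par : N -> option N).

Lemma find_root_spec m : inp m -> wp find_root m (fun t m' =>
  t <= 4 * #|N| + 3 /\ exists r, m' (Work xBest) [::] = Num (code r) /\
    forall u, level u <= level r).
Proof.
move=> im; have N0 : 0 < #|N| by have [] := (jtree T).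
apply: wp_seq; apply: wp_assign0; rewrite [eval _ _]/=; set m1 := update _ _ _ _.
have im1 : inp m1 by apply: inp_update.
pose I k t m' := t <= 4 * k + 1 /\ exists r, m' (Work xBest) [::] = Num (code r) /\
    forall u, code u < k -> level u <= level r.
apply: (wp_for (n := #|N|) (I := I)).
- have [r r0] := code_onto N0; split=> //; exists r.
  by rewrite update_array // /m1 update_same r0.
- by move=> k t m' _ A _ _; rewrite (eval_num_nodes (inp_agree im1 A isT)).
- move=> k t m' kN A mV [tk [r [rE rmax]]]; have im' := inp_agree im1 A isT.
  have [v cv] := code_onto kN.
  have lr : eval m' (node_level (var xBest)) = Num (level r).
    by rewrite (eval_node_level im' (e := var xBest) (v := r)).
  have lv : eval m' (node_level (var xV)) = Num (level v).
    by rewrite (eval_node_level im' (e := var xV) (v := v)) // cv.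
  have below u : code u < k.+1 -> u = v \/ code u < k.
    have [->|uv] := eqVneq u v; first by left.
    have : code u != code v by apply: contra uv => /eqP/code_inj->.
    by rewrite cv; right; lia.
  apply: wp_if; rewrite (@holds_Le _ _ _ _ _ _ _ (level r + 1) (level v)) //; last exact: eval_add.
  case: ifP => lrv.
    apply: wp_assign0; split; first by rewrite update_array.
    split; first by lia.
    exists v; split; first by rewrite update_array // update_same [eval _ _]mV cv.
    by move=> u /below[->//|/rmax]; lia.
  apply: wp_skip; split=> //; split; first by lia.
  exists r; split; first by rewrite update_array.
  by move=> u /below[->|/rmax//]; lia.
- move=> t m' A [tn [r [rE rmax]]]; split; first by lia.
  by exists r; split=> // u; apply: rmax; apply: code_lt.
Qed.

Definition search_ok m s par r : Prop :=
  [/\ parent_order e s par /\ (r \in s) && (index r s == 0),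
      m (Work xCnt) [::] = Num (size s),
      forall k v, onth s k = Some v -> m aOrd [:: inl k] = Num (code v),
      forall v, v \in s -> m aPar [:: inl (code v)] = Num (pcode par v) &
      forall v, is_bot (m aSeen [:: inl (code v)]) = (v \notin s)].

Definition degree v : nat := #|[set w | edge v w]|.

Lemma visit_spec m s par r v w j : inp m -> search_ok m s par r -> v \in s -> edge v w ->
  m (Work xV) [::] = Num (code v) -> m (Work xJ) [::] = Num j ->
  onth (enum [set w | edge v w]) j = Some w ->
  wp visit m (fun t m' => t <= 6 /\ exists l par', search_ok m' (s ++ l) par' r /\ w \in s ++ l).
Proof.
move=> im [[po rs] cnt ord pr seen] vs vw mV mJ jw.
apply: wp_seq; apply: wp_assign0.
have -> : eval m (Read ANodeNbr [:: var xV; var xJ]) = Num (code w).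
  rewrite (eval_read2 _ (k1 := inl (code v)) (k2 := inl j)).
  - by rewrite im //= onth_code /= jw.
  - by rewrite [eval _ _]mV.
  - by rewrite [eval _ _]mJ.
set m1 := update _ _ _ _.
have wE : m1 (Work xW) [::] = Num (code w) by rewrite /m1 update_same.
apply: wp_if; rewrite holds_IsBot (eval_read1 _ (k1 := inl (code w))) ?[eval _ _]wE //.
rewrite {1}/m1 update_array // seen; case: ifP => [ws|/negbFE ws]; last first.
  apply: wp_skip; split=> //; exists [::], par; rewrite cats0; split=> //.
apply: wp_seq; apply: (wp_assign1 (k1 := inl (code w))); first by rewrite [eval _ _]wE.
set m2 := update m1 _ _ _; apply: wp_seq.
apply: (wp_assign1 (k1 := inl (size s))); first by rewrite [eval _ _]cnt.
rewrite [eval _ _]wE; set m3 := update m2 _ _ _; apply: wp_seq.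
apply: (wp_assign1 (k1 := inl (code w))); first by rewrite [eval _ _]wE.
rewrite [eval _ _]mV; set m4 := update m3 _ _ _; apply: wp_assign0.
have -> : eval m4 (Add (var xCnt) (Lit 1)) = Num (size s + 1) by apply: eval_add.
set m5 := update m4 _ _ _; split=> //.
exists [:: w], (fun x => if x == w then Some v else par x).
rewrite cats1 mem_rcons mem_head; split=> //; split.
- split; first exact: parent_order_rcons.
  by case/andP: rs => rs r0; rewrite mem_rcons in_cons rs orbT -cats1 index_cat rs.
- by rewrite /m5 update_same size_rcons addn1.
- move=> k u; rewrite -cats1 onth_cat /m5 update_array // /m4 update_array // /m3 update_ks.
  have -> : ([:: inl k] == [:: inl (size s)] :> seq (nat + C)) = (k == size s).
    by rewrite eqseq_cons andbT.
  have [->|kn] := eqVneq k (size s); first by rewrite ltnn subnn => -[->].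
  case: ltnP => ks ; first by rewrite /m2 update_array // /m1 update_array //; apply: ord.
  by rewrite onth_default //=; lia.
- move=> u; rewrite mem_rcons in_cons /m5 update_array // /m4 update_ks /pcode.
  have -> : ([:: inl (code u)] == [:: inl (code w)] :> seq (nat + C)) = (u == w).
    rewrite eqseq_cons andbT; apply/eqP/eqP => [[/code_inj]|->] //.
  by case: eqP => //= _ /pr.
- move=> u; rewrite mem_rcons in_cons /m5 update_array // /m4 update_array // /m3 update_array //.
  rewrite /m2 update_ks.
  have -> : ([:: inl (code u)] == [:: inl (code w)] :> seq (nat + C)) = (u == w).
    rewrite eqseq_cons andbT; apply/eqP/eqP => [[/code_inj]|->] //.
  by case: eqP => //= _; rewrite /m1 update_array.
Qed.

Lemma search_ok_update m s par r a ks (b : word C K) : a \notin [:: Work xCnt; aOrd; aPar; aSeen] ->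
  search_ok m s par r -> search_ok (update m a ks b) s par r.
Proof.
rewrite !inE !negb_or => /and4P[a1 a2 a3 a4] [po cnt ord pr seen].
split=> // [|k v|v|v]; rewrite update_array 1?eq_sym //.
- exact: ord.
- exact: pr.
Qed.

Lemma visit_loop_spec m s par r v : inp m -> search_ok m s par r -> v \in s ->
  m (Work xV) [::] = Num (code v) ->
  wp (for_loop xJ (Read ANodeDeg [:: var xV]) visit) m (fun t m' =>
    t <= 8 * degree v + 2 /\ exists l par', search_ok m' (s ++ l) par' r /\
      forall w, edge v w -> w \in s ++ l).
Proof.
move=> im sok vs mV; set nb := enum [set w | edge v w].
pose I j t m' := t <= 8 * j + 1 /\ exists l par', search_ok m' (s ++ l) par' r /\
  forall w, w \in take j nb -> w \in s ++ l.
apply: (wp_for (n := degree v) (I := I)).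
- by split=> //; exists [::], par; rewrite cats0 take0; split.
- move=> j t m' _ A _ _; have im' := inp_agree im A isT.
  rewrite (eval_read1 _ (k1 := inl (code v))); first by rewrite im' //= onth_code.
  by rewrite [eval _ _](A (Work xV) [::] isT) mV.
- move=> j t m' jd A mJ [tj [l [par1 [sok1 nbj]]]]; have im' := inp_agree im A isT.
  have jnb : j < size nb by rewrite -cardE.
  have [w jw] := onth_lt jnb.
  have vw : edge v w.
    by have : w \in nb by [apply/onthP; exists j]; rewrite mem_enum inE.
  have mV' : m' (Work xV) [::] = Num (code v) by rewrite (A (Work xV) [::] isT).
  have vs1 : v \in s ++ l by rewrite mem_cat vs.
  apply: wp_conseq (visit_spec im' sok1 vs1 vw mV' mJ jw) _.
  move=> t2 m2 A2 [t2a [l2 [par2 [sok2 w2]]]].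
  split; first by rewrite (A2 (Work xJ) _ isT).
  split; first by lia.
  exists (l ++ l2), par2; rewrite catA; split; first by apply: search_ok_update.
  move=> u; rewrite (take_nth w) // mem_rcons in_cons (onth_nth _ _ _ _ jw).
  by case/orP => [/eqP->//|/nbj us]; rewrite mem_cat us.
- move=> t m' A [td [l [par' [sok' nbd]]]]; split; first by lia.
  exists l, par'; split=> // w vw; apply: nbd.
  by rewrite /degree cardE take_size mem_enum inE.
Qed.

Lemma search_loop_spec m s0 par0 r : inp m -> search_ok m s0 par0 r ->
  wp search_loop m (fun t m' => exists s par,
    [/\ parent_order e s par, forall v, v \in s, index r s = 0,
        order_ok s par m' & t <= 21 * #|N| + 2]).
Proof.
move=> im sok0.
pose I h t m' := exists s par, [/\ search_ok m' s par r, h <= size s,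
  forall k v w, k < h -> onth s k = Some v -> edge v w -> w \in s &
  t <= \sum_(v <- take h s) (8 * degree v + 5) + 1].
have uniq_all s par : parent_order e s par -> #|N| <= size s -> forall v, v \in s.
  move=> [us _] Ns v; have /subset_cardP/(_ (subset_predT _))-> // : #|s| = #|{: N}|.
  by apply/eqP; rewrite eqn_leq max_card (card_uniqP us).
apply: (wp_for (n := #|N|) (I := I)).
- by exists s0, par0; rewrite take0 big_nil; split.
- by move=> h t m' _ A _ _; rewrite (eval_num_nodes (inp_agree im A isT)).
- move=> h t m' hN A mH [s [par [sok hs cl th]]]; have im' := inp_agree im A isT.
  have [[po /andP[rs r0]] cnt ord pr seen] := sok.
  (* The queue does not run dry early: if every listed node had been treated, the list would be
     closed under adjacency and so contain all nodes. *)
  have hs' : h < size s.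
    rewrite ltn_neqAle hs andbT; apply/eqP => hE; suff : #|N| <= size s by lia.
    suff all_s v : v \in s by apply: leq_trans (card_size s); apply/subset_leq_card/subsetP.
    apply: (closed_seq_all (jtree T) rs) => u w us uw.
    by apply: (cl (index u s) u) uw; rewrite ?hE ?index_mem // onthE (nth_map u) ?index_mem ?nth_index.
  have [v sv] := onth_lt hs'.
  have vs : v \in s by apply/onthP; exists h.
  apply: wp_seq; apply: wp_assign0.
  rewrite (eval_read1 _ (k1 := inl h)) ?[eval _ _]mH // (ord _ _ sv).
  set m1 := update _ _ _ _; have im1 : inp m1 by apply: inp_update.
  have sok1 : search_ok m1 s par r by apply: search_ok_update.
  apply: wp_conseq (visit_loop_spec im1 sok1 vs _) _; first by rewrite /m1 update_same.
  move=> t2 m2 A2 [t2a [l [par' [sok2 nb]]]].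
  split; first by rewrite (A2 (Work xH) _ isT) /m1 update_array.
  exists (s ++ l), par'; split.
  + by apply: search_ok_update.
  + by rewrite size_cat; lia.
  + move=> k u w; rewrite ltnS leq_eqVlt onth_cat => /orP[/eqP->|kh].
      by rewrite hs' sv => -[<-]; apply: nb.
    rewrite ifT; last by lia.
    by move=> su uw; rewrite mem_cat (cl k u w).
  + rewrite takel_cat // (take_nth v) // (onth_nth _ _ _ _ sv) -cats1 big_cat big_seq1 /=.
    by lia.
- move=> t m' A [s [par [[[po /andP[rs /eqP r0]] cnt ord pr seen] Ns cl tn]]].
  have all_s := uniq_all s par po Ns.
  exists s, par; split=> //; first by split=> // v; apply: pr.
  have sN : size s = #|N| by apply: (size_s po all_s).
  (* Eight steps per adjacency and five per node give 21 per node, as degrees add up to at most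
     twice the number of nodes. *)
  rewrite take_oversize ?sN // big_split /= -big_distrr /= big_const_seq count_predT in tn.
  have := sum_degree (jtree T) po all_s; rewrite sN => deg.
  by move: tn deg; rewrite iter_addn_0 sN /degree; lia.
Qed.

Lemma search_spec m : inp m -> (forall ks, m aSeen ks = Bot) ->
  wp (Seq find_root (Seq start_search search_loop)) m (fun t m' => exists s par r,
    [/\ parent_order e s par, forall v, v \in s,
       order_ok s par m' /\ onth s 0 = Some r,
       forall u v, par v = None -> level u <= level v & t <= 25 * #|N| + 9]).
Proof.
move=> im blank; apply: wp_seq.
apply: wp_conseq (find_root_spec im) _ => t1 m1 A1 [t1a [r [rE rmax]]].
have im1 := inp_agree im A1 isT.
do 2 (apply: wp_seq); apply: (wp_assign1 (k1 := inl 0)) => //.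
rewrite [eval _ _]rE; set m2 := update m1 _ _ _; apply: wp_seq.
apply: (wp_assign1 (k1 := inl (code r))); first by rewrite [eval _ _]rE.
set m3 := update m2 _ _ _; apply: wp_seq.
apply: (wp_assign1 (k1 := inl (code r))); first by rewrite [eval _ _]rE.
have im3 : inp m3 by do 2 (apply: inp_update => //).
rewrite (eval_num_nodes im3); set m4 := update m3 _ _ _.
apply: wp_assign0; set m5 := update m4 _ _ _.
have im5 : inp m5 by do 2 (apply: inp_update => //).
have sok : search_ok m5 [:: r] (fun=> None) r.
  split.
  - by rewrite mem_head /= eqxx; split=> //; split=> // v; rewrite inE => /eqP->; rewrite /= eqxx.
  - by rewrite /m5 update_same.
  - move=> [|k] v /=; last by rewrite onth_default.
    by case=> <-; rewrite /m5 update_array // /m4 update_array // /m3 update_array // /m2 update_same.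
  - by move=> v; rewrite inE => /eqP->; rewrite /m5 update_array // /m4 update_same.
  - move=> v; rewrite inE /m5 update_array // /m4 update_array // /m3 update_ks.
    have -> : ([:: inl (code v)] == [:: inl (code r)] :> seq (nat + C)) = (v == r).
      by rewrite eqseq_cons andbT; apply/eqP/eqP => [[/code_inj]|->].
    by case: eqP => //= _; rewrite /m2 update_array // (A1 aSeen _ isT) blank.
apply: wp_conseq (search_loop_spec im5 sok) _ => t6 m6 _ [s [par [po all_s r0 oo t6a]]].
exists s, par, r; split=> //.
- split=> //; have rs := all_s r; rewrite -r0.
  by rewrite onthE (nth_map r) ?index_mem // nth_index.
- move=> u v /(par_none po all_s) v0; suff -> : v = r by apply: rmax.
  by apply: (index_eq all_s); rewrite v0.
- by lia.
Qed.

End Search.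

(** Exceeds every level, so that no message is reduced to a filter. *)
Definition thr_all : expr := Add (Read ANumSteps [::]) (Lit 1).

Definition output_result : cmd :=
  Seq (Assign (Work xV) [::] (Read aOrd [:: Lit 0]))
    (If (IsBot (Read aAgg [:: var xV; Lit 0]))
       (Assign AOutFlag [::] (Lit 0))
       (Seq (Assign AOutFlag [::] (Lit 1))
            (Assign AOutVal [::] (Read aAgg [:: var xV; Lit 0])))).

Definition search_tree : cmd := Seq find_root (Seq start_search search_loop).

(* The initial test makes the running time constant on databases in which
   all the relations of the query are empty. *)
Definition eval_query : cmd :=
  If (Le (Lit 1) (Read ANumFacts [:: Read AAtomRel [:: Lit 0]]))
    (Seq phase1 (Seq search_tree (Seq (phase2 thr_all) output_result)))
    (Assign AOutFlag [::] (Lit 0)).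

Section Evaluation.
Context (S : schema) (V : finType) (C : eqType) (K : Type).
Context (g : query S V C K) (T : connex_join_tree g).
Context (D : database S C) (nu : fact S C -> K).
Local Notation N := (node T).
Local Notation at_ := (@jt_atom _ _ _ _ _ T).
Local Notation times := (mul g).
Local Notation plus := (unzip1 (steps g)).
Local Notation memory := (Defs.mem C K).
Local Notation eval := (@eval C K times plus).
Local Notation wp := (@wp C K times plus).
Local Notation inp := (@inp _ _ _ _ _ T D nu).
Local Notation node_facts := (@node_facts _ _ _ _ _ T D).
Implicit Types (m : memory) (v : N).

Lemma eval_num_steps m : inp m -> eval m (Read ANumSteps [::]) = Num (size (steps g)).
Proof. by move=> im; rewrite /= im. Qed.

Lemma eval_thr_all m : inp m -> eval m thr_all = Num (size (steps g) + 1).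
Proof. by move=> im; apply: eval_add => //; apply: eval_num_steps. Qed.

Lemma sem_hom p : sem g D nu p -> exists h, homomorphism (atoms g) D h.
Proof.
rewrite /sem; suff : forall l (A : answer V C K -> Prop) p,
    foldl (fun A s => sem_proj s.1 s.2 A) A l p -> exists p', A p'.
  by move=> H /H[p' [hom _]]; exists p'.1.
elim=> [|st l IH] A p' /=; first by exists p'.
move/IH => [p2 [[|p3 l'] [_ inl nn _]]] //.
by exists p3; have [] := (inl p3).1 (or_introl erefl).
Qed.

Lemma output_result_spec m (r : N) (o : option K) : m aOrd [:: inl 0] = Num (code r) ->
  m aAgg [:: inl (code r); inl 0] = @opt C K o ->
  wp output_result m (fun t m' => t <= 4 /\ if o is Some k
    then m' AOutFlag [::] = Num 1 /\ m' AOutVal [::] = Val k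
    else m' AOutFlag [::] = Num 0).
Proof.
move=> m0 mr; apply: wp_seq; apply: wp_assign0; rewrite (eval_read1 _ (k1 := inl 0)) // m0.
set m1 := update _ _ _ _.
have E m2 : m2 (Work xV) [::] = Num (code r) -> m2 aAgg [:: inl (code r); inl 0] = @opt C K o ->
    eval m2 (Read aAgg [:: var xV; Lit 0]) = @opt C K o.
  by move=> V2 A2; rewrite (eval_read2 _ (k1 := inl (code r)) (k2 := inl 0)) // [eval _ _]V2.
have V1 : m1 (Work xV) [::] = Num (code r) by rewrite /m1 update_same.
have Agg1 : m1 aAgg [:: inl (code r); inl 0] = @opt C K o by rewrite /m1 update_array.
apply: wp_if; rewrite holds_IsBot (E _ V1 Agg1); case: o mr E Agg1 => [k|] mr E Agg1.
  apply: wp_seq; apply: wp_assign0; apply: wp_assign0.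
  by rewrite E.
by apply: wp_assign0; split=> //; rewrite update_same.
Qed.

Definition width_sum : nat := \sum_v (1 + size (at_ v).2).

Lemma cost1_le M : (forall v, size (node_facts v) <= M) ->
  \sum_(v : N) cost1 D v <= 6 * (width_sum * (1 + M)).
Proof.
move=> facts_le; rewrite /width_sum big_distrl big_distrr /=; apply: leq_sum => v _.
have := facts_le v; rewrite /cost1; set a := size (at_ v).2; set n := size _.
move=> nM; have : a * n <= a * M by rewrite leq_mul2l nM orbT.
by lia.
Qed.

(** 21 is 11 + 10, the costs per fact of the node and of its parent apart from arities; the other
    coefficients are smaller. *)
Lemma cost2_le (par : N -> option N) M : (forall v, size (node_facts v) <= M) ->
  \sum_(v : N) (cost2 D par v + 3) <= 21 * (width_sum * (1 + M)).
Proof.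
move=> facts_le; rewrite /width_sum big_distrl big_distrr /=; apply: leq_sum => v _.
have pM : parent_nfacts D par v <= M by rewrite /parent_nfacts; case: (par v) => //=.
have := facts_le v; rewrite /cost2; set a := size (at_ v).2; set n := size _.
move: pM; set p := parent_nfacts D par v => pM nM.
have : a * n <= a * M by rewrite leq_mul2l nM orbT.
have : a * p <= a * M by rewrite leq_mul2l pM orbT.
by lia.
Qed.

Lemma card_le_width : 0 < #|N| <= width_sum.
Proof.
have [-> _ _ _ _] := (jtree T); rewrite -sum1_card; apply: leq_sum => v _.
by rewrite leq_addr.
Qed.

(** The result [o] is chosen before the bound [M], because it is used both with [db_norm D] and with
    [db_size D + 1]. *)
Lemma eval_query_spec : semiring_query g -> free_vars g = set0 ->
  exists o : option K,
    (forall a, sem g D nu a <-> a.1 = none V C /\ o = Some a.2) /\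
    forall M, (forall v, size (node_facts v) <= M) ->
    wp eval_query (init_mem T D nu) (fun t m =>
      (t <= 2 \/ (exists v, 0 < size (node_facts v)) /\ t <= 70 * (width_sum * (1 + M))) /\
      if o is Some k then m AOutFlag [::] = Num 1 /\ m AOutVal [::] = Val k
      else m AOutFlag [::] = Num 0).
Proof.
move=> semi free0; set m0 := init_mem T D nu.
have im0 : inp m0 by [].
have [N0 _] := andP card_le_width.
have [v0 c0] := code_onto N0.
have [a [l aE]] : exists a l, atoms g = a :: l.
  by move: N0; rewrite (card_nodes T); case: (atoms g) => // a l _; exists a, l.
have ain : a \in atoms g by rewrite aE mem_head.
have guard : holds times plus m0 (Le (Lit 1) (Read ANumFacts [:: Read AAtomRel [:: Lit 0]])) =
    (0 < size (facts_of D a.1)).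
  apply: holds_Le => //; rewrite (eval_read1 _ (k1 := inl (code a.1))).
    by rewrite /= onth_code.
  by rewrite (eval_read1 _ (k1 := inl 0)) //= aE.
case: (posnP (size (facts_of D a.1))) => [empty|pos].
  (* An atom over an empty relation admits no homomorphism, hence there is no answer. *)
  exists None; split=> [p|M _].
    split=> [/sem_hom[h [_ /allP/(_ a ain) aD]]|[_ //]].
    have : apply_atom h a \in facts_of D a.1 by rewrite mem_filter eqxx.
    by move/size0nil: empty => ->.
  apply: wp_if; rewrite guard empty /=; apply: wp_assign0; split; first by left.
  by rewrite update_same.
have [_ _ _ /(_ a)[/(_ ain)[va vaE] _] _] := jt_join T.
have [t1 [m1 [ex1 [t1a pos1 bl1 facts1]]]] := phase1_spec im0 (fun _ _ _ => erefl).
have A1 := exec_agree ex1.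
have im1 := inp_agree im0 A1 isT.
have [|t2 [m2 [ex2 [s [par [r [po all_s [oo sr] rmax t2a]]]]]]] := search_spec im1.
  by move=> ks; rewrite (A1 aSeen _ isT).
have A2 := exec_agree ex2; have im2 := inp_agree im1 A2 isT.
have pos2 : pos_all T m2 by apply: (pos_all_agree (m := m1) _ A2 isT).
have blank a' v : a' \in [:: aTrie; aAgg; aHead] -> row_blank m2 v a'.
  rewrite !inE => /or3P[]/eqP-> ks.
  - by rewrite (A2 aTrie _ isT) (A1 aTrie _ isT).
  - by rewrite (A2 aAgg _ isT) (A1 aAgg _ isT).
  - by rewrite (A2 aHead _ isT) (A1 aHead _ isT).
have facts2 : facts_ok T D nu m2.
  by move=> v i f vi; rewrite (A2 aW _ isT); apply: facts1.
have [|||t3 [m3 [ex3 [t3a W3 L3]]]] :=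
  phase2_spec po all_s eval_thr_all im2 pos2 oo _ _ _ facts2.
- by move=> v; apply: blank; rewrite !inE eqxx.
- by move=> v; apply: blank; rewrite !inE eqxx orbT.
- by move=> v; apply: blank; rewrite !inE eqxx !orbT.
have rn : par r = None.
  case rp: (par r) => [p|] //; have := par_lt po all_s rp.
  have r0 : forall l : seq N, onth l 0 = Some r -> index r l = 0.
    by case=> //= v l' [->]; rewrite eqxx.
  by rewrite (r0 s sr).
have := L3 r; rewrite /linked rn => -[aggr _].
have A3 := exec_agree ex3.
set o := message _ _ _ _ _ _ _ in aggr.
have [ord _] := oo.
have m3o : m3 aOrd [:: inl 0] = Num (code r) by rewrite (A3 aOrd _ isT) (ord _ _ sr).
have [t4 [m4 [ex4 [t4a out]]]] := output_result_spec m3o aggr.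
exists o; split.
  move=> p; have [_ ->] := sem_represents g D nu.
  rewrite (sem_val_closed D nu (thr := size (steps g) + 1) po all_s rmax semi _ free0 rn); last by rewrite addn1.
  case: eqP => [p0|pn].
    have p1 : p.1 = none V C.
      apply/ffunP => x; rewrite ffunE; move/setP/(_ x): p0.
      by rewrite in_set0 in_set; case: (p.1 x).
    by rewrite p1 -/o; split=> [|[]].
  split=> // -[p1]; case: pn; rewrite p1.
  by apply/setP => x; rewrite in_set ffunE in_set0.
move=> M facts_le; apply: wp_if; rewrite guard pos.
exists (t1 + (t2 + (t3 + t4))), m4; split; first by do 3 (apply: ExecSeq; eauto).
split=> //; right; split; first by exists va; rewrite /node_facts vaE.
(* 70 is 6 + 21 + 25 for the two phases and the search, plus 18 for their additive constants, the
   output and the initial test. *)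
have := cost1_le facts_le; have := cost2_le par facts_le.
have [_ Nw] := andP card_le_width.
have : width_sum <= width_sum * (1 + M) by rewrite leq_pmulr.
by lia.
Qed.

End Evaluation.

(** * Both claims in the absence of free variables *)

Definition xStart := 30. Definition xOk := 31.
Definition aCur := Work 32.

(** The preprocessing has already written the output. The first run only leaves a mark; the second
    finds it and withdraws the answer. *)
Definition emit_once : cmd :=
  If (IsBot (var xStart)) (Assign (Work xStart) [::] (Lit 0)) (Assign AOutFlag [::] (Lit 0)).

Section ClosedCase.
Context (S : schema) (V : finType) (C : eqType) (K : Type).
Context (g : query S V C K) (T : connex_join_tree g).
Local Notation N := (node T).
Local Notation at_ := (@jt_atom _ _ _ _ _ T).
Local Notation wp := (@wp C K (mul g) (unzip1 (steps g))).

Lemma sum_facts_of (D : database S C) R :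
  \sum_(f <- facts D | f.1 == R) arity f.1 = size (facts_of D R) * arity R.
Proof.
rewrite /facts_of -sum1_size big_distrl /= big_filter.
by apply: eq_bigr => f /eqP->; rewrite mul1n.
Qed.

Lemma facts_of_le_norm (D : database S C) R : 0 < arity R ->
  size (facts_of D R) <= db_norm D.
Proof.
move=> R0; rewrite /db_norm.
apply: leq_trans (leq_bigmax_cond R isT).
by rewrite sum_facts_of leq_pmulr.
Qed.

(** A nullary relation adds nothing to the size but may hold one fact, the empty tuple; this
    accounts for the 1. *)
Lemma facts_of_le_size (D : database S C) R : size (facts_of D R) <= db_size D + 1.
Proof.
have [R0|R0] := posnP (arity R); last first.
  rewrite /db_size (bigD1 R) //= sum_facts_of -addnA.
  by apply: leq_trans (leq_addr _ _); rewrite leq_pmulr.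
suff : size (facts_of D R) <= 1 by lia.
have uniq_l : uniq (facts_of D R) by rewrite filter_uniq ?facts_uniq.
apply: (uniq_leq_size (s2 := [:: (R, [::])]) uniq_l) => f.
rewrite mem_filter => /andP[/eqP fR fD]; rewrite inE.
have /allP/(_ f fD)/eqP := facts_arity D; rewrite fR R0 => /size0nil f2.
by rewrite [f]surjective_pairing fR f2.
Qed.

Lemma width_sum_atoms : width_sum T = \sum_(a <- atoms g) (1 + arity a.1).
Proof.
rewrite (perm_big _ (atoms_perm T)) big_map /width_sum.
by apply: eq_bigr => v _; rewrite at_size.
Qed.

Lemma width_sum_le : (forall a, a \in atoms g -> 0 < arity a.1) ->
  width_sum T <= 2 * query_size g.
Proof.
move=> pos; rewrite width_sum_atoms /query_size mulnDr.
apply: leq_trans (leq_addr _ _); rewrite big_distrr /= big_seq [in leqRHS]big_seq.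
by apply: leq_sum => a /pos a0; rewrite mul2n -addnn leq_add2r.
Qed.

Lemma eval_query_result (D : database S C) nu :
  (forall a, a \in atoms g -> 0 < arity a.1) -> semiring_query g -> free_vars g = set0 ->
  exists t, t <= 280 * (query_size g * db_norm D + 1) /\
    obtains_result eval_query T D nu t.
Proof.
move=> pos semi free0.
have [o [semo run]] := eval_query_spec T D nu semi free0.
have facts_le (v : N) : size (node_facts D v) <= db_norm D.
  exact/facts_of_le_norm/pos/at_atoms.
have [t [m [ex [time out]]]] := run _ facts_le.
exists t; split.
  case: time => [|[[v v0] tle]]; first by lia.
  have d0 : 0 < db_norm D := leq_trans v0 (facts_le v).
  apply: leq_trans tle _; have := width_sum_le pos.
  move: (width_sum T) (query_size g) (db_norm D) d0 => w q d d0 wq.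
  (* 280 is 70 times 2 for the query size and 2 for the norm, which is positive because some
     relation of the query is non-empty. *)
  have : w * (1 + d) <= 2 * q * (2 * d) by apply: leq_mul; lia.
  by lia.
exists m; split=> // [a /semo[a0 oa]|no].
  by rewrite oa in out; case: out => *; split=> // x; rewrite free0 in_set0.
case: o semo out {run} => // k semo out.
by case: (no (none V C, k)); apply/semo.
Qed.

Lemma enumeration_closed : semiring_query g -> free_vars g = set0 ->
  constant_delay_after_linear_preprocessing T.
Proof.
(* 140 doubles 70 since [1 + M] is at most twice [M] for [M = db_size D + 1]; the added 2 covers
   runs stopped by the initial test. A run of [emit_once] is a test and an assignment. *)
move=> semi free0; exists eval_query, emit_once, (140 * width_sum T + 2), 2 => D nu.
have [o [semo run]] := eval_query_spec T D nu semi free0.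
have facts_le (v : N) : size (node_facts D v) <= db_size D + 1 := facts_of_le_size D _.
have [t [m [ex [time out]]]] := run _ facts_le.
have A := exec_agree ex.
have startN : m (Work xStart) [::] = Bot by rewrite (A (Work xStart) _ isT).
pose m1 := update m (Work xStart) [::] (Num 0).
have run1 : runs g emit_once m 2 m1.
  apply: ExecIf; rewrite holds_IsBot [eval _ _ _ _]startN /=.
  exact: (@ExecAssign _ _ _ _ m (Work xStart) [::] (Lit 0) [::]).
pose m2 := update m1 AOutFlag [::] (Num 0).
have run2 : runs g emit_once m1 2 m2.
  apply: ExecIf; rewrite holds_IsBot [eval _ _ _ _]update_same /=.
  exact: (@ExecAssign _ _ _ _ m1 AOutFlag [::] (Lit 0) [::]).
clear run; exists t, m, (if o is Some k then [:: (none V C, k)] else [::]); split=> //.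
- have : t <= 70 * (width_sum T * (1 + (db_size D + 1))) + 2 by case: time => [|[_]]; lia.
  move: (width_sum T) (db_size D) => w d; rewrite !mulnDr !mulnDl; lia.
- case: o {semo out} => [k|]; last by constructor.
  by constructor; [move=> [] | constructor].
- move=> p; rewrite semo; case: o {semo out} => [k|] /=; last by split=> // -[].
  split=> [[<-|//]|[p0 [pk]]]; first by [].
  by left; rewrite [p]surjective_pairing p0 pk.
- case: o {semo} out => [k|] /= out.
    exists 2, m1; split=> //; split.
      by case: out => flag val; split=> // x; rewrite free0 in_set0.
    by exists 2, m2; split=> //; rewrite /shows_none update_same.
  by exists 2, m1; split.
Qed.

End ClosedCase.

(** * Choices of facts at the nodes of the last witness subtree *)

Section Choices.
Context (S : schema) (V : finType) (C : eqType) (K : Type).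
Context (g : query S V C K) (T : connex_join_tree g).
Context (D : database S C) (nu : fact S C -> K).
Context (s : seq (node T)) (par : node T -> option (node T)).
Local Notation N := (node T).
Local Notation at_ := (@jt_atom _ _ _ _ _ T).
Local Notation times := (mul g).
Local Notation n := (size (steps g)).
Local Notation read := (@read _ _ _ _ _ T).
Local Notation fits := (@fits _ _ _ _ _ T).
Local Notation nvars := (@nvars _ _ _ _ _ T).
Local Notation node_facts := (@node_facts _ _ _ _ _ T D).
Local Notation level := (@level _ _ _ _ _ T).
Local Notation shared := (shared par).
Local Notation tuple_val := (tuple_val D nu s par n).
Local Notation message := (message D nu s par n).
Local Notation partial_val := (partial_val D nu s par n).
Local Notation ival := (ival D nu s par n).
Local Notation siblings := (siblings D nu s par n).
Local Notation joins := (joins D par).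
Local Notation none := (none V C).
Local Notation choice := {ffun N -> nat}.
Local Notation top := (above T n).
Implicit Types (v u p c : N) (x : V) (f : fact S C) (h z : assignment V C).
Implicit Types (t : choice) (us : seq N) (i : nat).

Hypothesis s_ord : parent_order (@edge V T) s par.
Hypothesis s_all : forall v, v \in s.
Hypothesis s_root : forall u v, par v = None -> level u <= level v.

(* The facts of [u] that agree with the fact chosen at its parent, in the
   order of their linked list. *)
Definition options u t0 : seq nat :=
  if par u is Some p then
    if onth (node_facts p) (t0 p) is Some f then rev (siblings u (restrict (shared u) (read p f)))
    else [::]
  else rev (siblings u none).

Definition choose t0 u i : choice := [ffun v => if v == u then i else t0 v].

(** Lexicographic, the last node varying fastest: the order in which the odometer moves. *)
Fixpoint choices us t0 : seq choice :=
  if us is u :: us' then flatten [seq choices us' (choose t0 u i) | i <- options u t0]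
  else [:: t0].

Fixpoint parents_first us : bool :=
  if us is u :: us' then
    [&& u \notin us', (if par u is Some p then p \notin us else true) & parents_first us']
  else true.

Lemma eq_options u t0 t1 : (forall p, par u = Some p -> t0 p = t1 p) ->
  options u t0 = options u t1.
Proof. by rewrite /options; case: (par u) => // p ->. Qed.

(** Options of a node depend only on its parent, which is settled earlier. They may therefore be
    computed from the final choice [t1], which makes the condition independent of the order. *)
Lemma mem_choices us t0 t1 : parents_first us ->
  (t1 \in choices us t0) <->
  (forall v, v \notin us -> t1 v = t0 v) /\ (forall u, u \in us -> t1 u \in options u t1).
Proof.
elim: us t0 => [|u us IH] t0 /=.
  rewrite inE; split=> [/eqP->|[eq01 _]] //.
  by apply/eqP/ffunP => v; apply: eq01.
case/and3P => uus pu pf;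
have opt_u t2 : (forall v, v \notin u :: us -> t2 v = t0 v) -> options u t2 = options u t0.
  move=> eq2; apply: eq_options => p up; apply: eq2.
  by rewrite up in pu.
split=> [/flatten_mapP[i iu /(IH _ pf)[out ins]]|[out ins]].
  have out' v : v \notin u :: us -> t1 v = t0 v.
    by rewrite in_cons negb_or => /andP[vu vus]; rewrite out // ffunE (negPf vu).
  split=> // v; rewrite in_cons => /orP[/eqP->|/ins//].
  by rewrite opt_u // out // ffunE eqxx.
apply/flatten_mapP; exists (t1 u); first by rewrite -(opt_u t1) // ins ?mem_head.
apply/IH => //; split=> [v vus|v vus]; last by apply: ins; rewrite in_cons vus orbT.
rewrite ffunE; case: eqP => [->//|/eqP vu]; apply: out.
by rewrite in_cons negb_or vu.
Qed.

Lemma uniq_options u t0 : uniq (options u t0).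
Proof.
have us z : uniq (rev (siblings u z)) by rewrite rev_uniq filter_uniq ?iota_uniq.
by rewrite /options; case: (par u) => // p; case: (onth _ _).
Qed.

Lemma uniq_choices us t0 : parents_first us -> uniq (choices us t0).
Proof.
elim: us t0 => [|u us IH] t0 //= /and3P[uus _ pf].
elim: (options u t0) (uniq_options u t0) => //= i l IHl /andP[il ul].
rewrite cat_uniq IH // IHl // andbT /=; apply/hasPn => t1 /flatten_mapP[i' i'l].
move=> /(mem_choices _ _ pf)[out _]; apply/negP => /(mem_choices _ _ pf)[out' _].
have := out u uus; rewrite out' // !ffunE eqxx => ii.
by rewrite ii i'l in il.
Qed.

Lemma sum_opt_isSome op (xs : seq (option K)) : has isSome xs -> sum_opt op xs.
Proof.
rewrite /sum_opt => hx; suff : forall o : option K, (o || has isSome xs) -> foldl (add_opt op) o xs.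
  by apply.
elim: xs {hx} => [|x xs IH] o /=; first by rewrite orbF.
by move=> ox; apply: IH; case: o x ox => [a|] [b|].
Qed.

Lemma message_isSome c i z : i \in siblings c z -> message c z.
Proof.
move=> ic; rewrite message_siblings; apply: sum_opt_isSome; rewrite has_map; apply/hasP.
exists i => //=; by move: ic; rewrite mem_filter => /andP[/andP[]].
Qed.

Lemma mem_siblings c i z : i \in siblings c z ->
  exists f, [/\ onth (node_facts c) i = Some f, fits c f, f \in node_facts c,
    ival c i = tuple_val c (read c f) & ival c i /\ restrict (shared c) (read c f) = z].
Proof.
rewrite mem_filter => /andP[/andP[iv]]; rewrite /joins.
case ci: (onth _ i) => [f|] // /eqP fz _; exists f.
have fc : f \in node_facts c by apply/onthP; exists i.
by move: (iv); rewrite /ival ci; case: ifP.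
Qed.

Lemma omul_big_isSome (I : Type) (r : seq I) (P : pred I) (F : I -> option K) :
  (forall j, P j -> F j) -> \big[omul times/Some (cm_one times)]_(j <- r | P j) F j.
Proof. by move=> PF; apply: (big_ind isSome) => // -[a|] [b|]. Qed.

Lemma omul_big_factor (I : finType) (P : pred I) (F : I -> option K) (j : I) :
  P j -> \big[omul times/Some (cm_one times)]_(k | P k) F k -> F j.
Proof. by move=> Pj; rewrite (bigD1 j) //=; case: (F j). Qed.

Hypothesis top0 : top != set0.

Lemma par_top u p : par u = Some p -> u \in top -> p \in top.
Proof. by move=> up ut; apply: (above_up_closed s_ord s_all s_root) ut up. Qed.

(** The boundary messages are regrouped by parent. Those sent inside the subtree have level at least
    the threshold, so where they exist they contribute the unit. *)
Lemma partial_val_tuples h : adom h = dom top ->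
  (forall c, c \in top -> par c -> message c (restrict (shared c) h)) ->
  \big[omul times/Some (cm_one times)]_(u in top) tuple_val u h = partial_val top h.
Proof.
move=> hA mS; rewrite /partial_val hA eqxx.
have [r0 r0A] := set0Pn _ top0.
pose up c := odflt r0 (par c).
have par_bd c : boundary par top c -> exists2 p, par c = Some p & p \in top.
  rewrite /boundary => /andP[cA]; case cp: (par c) => [p|] pA; first by exists p.
  have := root_in s_ord s_all (above_up_closed s_ord s_all s_root (L := n)) r0A cp.
  by rewrite (negPf cA).
rewrite [X in _ = omul _ _ X](partition_big up (fun w => w \in top)) /=; last first.
  by move=> c /par_bd[p cp pA]; rewrite /up cp.
rewrite -big_split /=; apply: eq_bigr => u uA; rewrite tuple_valE //; congr omul.
rewrite (bigID (fun w => w \in top)) /= big1 ?Monoid.mul1m => [|c /andP[/eqP cu cA]].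
  apply: eq_big => [c|c /andP[/eqP cu cA]].
    apply/andP/andP => [[/eqP cu cA]|[bc /eqP cu]].
      by rewrite /boundary cA cu uA /up cu.
    have [p cp _] := par_bd c bc; move: bc cu; rewrite /boundary /up cp /= => /andP[-> _] ->.
    by rewrite eqxx.
  by rewrite /gate ltnNge; move: cA; rewrite in_set => /negPf->.
rewrite /gate ltnNge; move: (cA); rewrite in_set => ->.
by case: (message c _) (mS c cA) => //; rewrite cu => /(_ isT).
Qed.

(** Induction from the leaves. A child outside the subtree sends a message that is a factor of
    [partial_val]; a child inside is alive at [h], and its own fact under [h] witnesses its
    message. *)
Lemma tuple_val_top h u : partial_val top h -> u \in top -> tuple_val u h.
Proof.
move=> ph uA; have hA : adom h = dom top.
  by apply: (@partial_val_adom _ _ _ _ _ T D nu s par n); case: (partial_val top h) ph.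
have [inits msgs] : (forall v, v \in top -> init D nu v h) /\
    (forall c, boundary par top c -> message c (restrict (shared c) h)).
  move: ph; rewrite /partial_val hA eqxx.
  set a := \big[_/_]_(_ | _) _; set b := \big[_/_]_(_ | _) _ => ab.
  have [aS bS] : isSome a /\ isSome b by move: ab; case: a b => [a|] [b|].
  by split=> [v vA|c cA]; [apply: omul_big_factor vA aS | apply: omul_big_factor cA bS].
elim: (size s - index u s) {-2}u (leqnn (size s - index u s)) uA => [|k IHk] v vk vA.
  have : index v s < size s by rewrite index_mem.
  by move: vk; clear; lia.
rewrite tuple_valE //; case: (init D nu v h) (inits v vA) => // a _.
have : \big[omul times/Some (cm_one times)]_(c | par c == Some v)
    gate n c (message c (restrict (shared c) h)).
  apply: omul_big_isSome => c /eqP cv.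
  suff : message c (restrict (shared c) h) by rewrite /gate; case: ifP => // _; case: (message c _).
  have [cA|cA] := boolP (c \in top); last first.
    by apply: msgs; rewrite /boundary cA cv vA.
  have tc : tuple_val c h.
    have ic : index c s < size s by rewrite index_mem.
    by apply: IHk => //; move: (par_lt s_ord s_all cv) ic vk; clear; lia.
  have ch : nvars c \subset adom h by rewrite hA nvars_dom.
  have iN : init D nu c h <> None.
    by apply: (@tuple_val_init _ _ _ _ _ T D nu s par n) => //; case: (tuple_val c h) tc.
  have [fc ff fr] := init_node_facts ch iN.
  have /onthP[i ci] := fc.
  apply: (@message_isSome c i); rewrite mem_filter mem_iota /= add0n.
  rewrite -onthTE /joins /ival ci ff fr tuple_val_restrict // tc /=.
  by rewrite restrict_restrict ?shared_sub ?eqxx.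
by case: (\big[_/_]_(_ | _) _).
Qed.

Definition top_nodes : seq N := [seq u <- s | u \in top].

Lemma mem_top_nodes u : (u \in top_nodes) = (u \in top).
Proof. by rewrite mem_filter s_all andbT. Qed.

Lemma top_parents_first : parents_first top_nodes.
Proof.
have [us _] := s_ord.
have : pairwise (fun u v => index u s < index v s) top_nodes.
  apply: pairwise_filter; case: (s) us => // r s' us.
  by apply/(pairwiseP r) => i j ilt jlt ij; rewrite !index_uniq.
elim: top_nodes => //= u l IH /andP[/allP lu /IH->]; rewrite andbT; apply/andP; split.
  by apply/negP => /lu; rewrite ltnn.
case up: (par u) => [p|] //; have pu := par_lt s_ord s_all up.
rewrite in_cons negb_or; apply/andP; split; first by apply: contraTneq pu => ->; rewrite ltnn.
by apply/negP => /lu; move: pu; clear; lia.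
Qed.

Definition valid t : Prop := forall u, u \in top -> t u \in options u t.

Definition chosen t u : assignment V C :=
  if onth (node_facts u) (t u) is Some f then read u f else none.

(** The node at which [x] is read is arbitrary: [chosen_agree] makes the value independent of it.
    [emit_var] uses the same pick. *)
Definition choice_assignment t : assignment V C :=
  [ffun x => if [pick u | (u \in top) && (x \in nvars u)] is Some u
             then chosen t u x else None].

Lemma chosenP t u : valid t -> u \in top ->
  [/\ exists f, [/\ onth (node_facts u) (t u) = Some f, fits u f & chosen t u = read u f],
      adom (chosen t u) = nvars u, ival u (t u) = tuple_val u (chosen t u),
      ival u (t u) &
      forall p, par u = Some p ->
        restrict (shared u) (chosen t u) = restrict (shared u) (chosen t p)].
Proof.
move=> val uA; have := val u uA; rewrite /options.
have core z : t u \in siblings u z -> [/\ exists f, [/\ onth (node_facts u) (t u) = Some f,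
      fits u f & chosen t u = read u f],
    adom (chosen t u) = nvars u, ival u (t u) = tuple_val u (chosen t u), ival u (t u)
    & restrict (shared u) (chosen t u) = z].
  case/mem_siblings => f [uf ff fu iv [ivS fz]]; rewrite /chosen uf.
  by split=> //; [exists f | apply: adom_read fu].
case up: (par u) => [p|]; last first.
  by rewrite mem_rev => /core[? ? ? ? _]; split.
case pf: (onth _ _) => [f|] //; rewrite mem_rev => /core[? ? ? ? eqz]; split=> // p' [<-].
by rewrite eqz /chosen pf.
Qed.

(** By running intersection the later of the two nodes shares [x] with its parent, and validity
    makes the chosen facts agree there; the comparison passes to the parent, of smaller index. *)
Lemma chosen_agree t u v x : valid t -> u \in top -> v \in top ->
  x \in nvars u -> x \in nvars v -> chosen t u x = chosen t v x.
Proof.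
move=> val.
suff bounded k : forall u v, index u s < k -> index v s < k -> u \in top -> v \in top ->
    x \in nvars u -> x \in nvars v -> chosen t u x = chosen t v x.
  by move=> uA vA xu xv; apply: (bounded (size s)) => //; rewrite index_mem.
elim: k => // k IHk.
have step a b : index a s = k -> index b s < k -> a \in top -> b \in top ->
    x \in nvars a -> x \in nvars b -> chosen t a x = chosen t b x.
  move=> ak bk aA bA xa xb.
  have bd : boundary par [set w | index w s < index a s] a.
    rewrite /boundary in_set ltnn /=; case ap: (par a) => [p|] //.
    by rewrite in_set; apply: (par_lt s_ord s_all ap).
  have xs : x \in shared a.
    apply: (boundary_shared s_ord s_all (up_closed_before s_ord s_all (v := a)) bd xa).
    by apply/bigcupP; exists b; rewrite // in_set ak.
  have [p ap] : exists p, par a = Some p.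
    by move: xs; rewrite /shared; case: (par a) => [p|]; rewrite ?in_set0 //; exists p.
  have [_ _ _ _ /(_ p ap)/ffunP/(_ x)] := chosenP val aA.
  rewrite !ffunE xs => ->; apply: IHk => //; last first.
  - by apply: (subsetP (shared_par ap)) xs.
  - exact: par_top ap aA.
  - by rewrite -ak; apply: (par_lt s_ord s_all ap).
move=> a b ak bk aA bA xa xb.
case: (ltngtP (index a s) k) => [ak'|ak'|ak']; last 1 first.
- case: (ltngtP (index b s) k) => [bk'|bk'|bk']; first exact: step.
    by move: bk bk'; clear; lia.
  by rewrite (@index_eq _ s s_all a b) // ak' bk'.
- case: (ltngtP (index b s) k) => [bk'|bk'|bk']; first exact: IHk.
    by move: bk bk'; clear; lia.
  by rewrite (step b a).
- by move: ak ak'; clear; lia.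
Qed.

Lemma restrict_choice t u : valid t -> u \in top ->
  restrict (nvars u) (choice_assignment t) = chosen t u.
Proof.
move=> val uA; apply/ffunP => x; rewrite !ffunE.
have [_ au _ _ _] := chosenP val uA.
case: ifP => xu; last first.
  by apply/esym/eqP; move/negbT: xu; rewrite -au in_set negbK.
case: pickP => [v /andP[vA xv]|/(_ u)]; last by rewrite uA xu.
exact: chosen_agree.
Qed.

Lemma adom_choice t : valid t -> adom (choice_assignment t) = dom top.
Proof.
move=> val; apply/setP => x; rewrite in_set ffunE; case: pickP => [v /andP[vA xv]|no].
  have [_ av _ _ _] := chosenP val vA.
  have -> : x \in dom top by apply/bigcupP; exists v.
  by move: xv; rewrite -av in_set.
by apply/esym/negP => /bigcupP[v vA xv]; have := no v; rewrite vA xv.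
Qed.

Lemma choice_val t : valid t ->
  partial_val top (choice_assignment t) =
    \big[omul times/Some (cm_one times)]_(u <- top_nodes) ival u (t u) /\
  partial_val top (choice_assignment t).
Proof.
move=> val.
have tv u : u \in top -> tuple_val u (choice_assignment t) = ival u (t u).
  move=> uA; have [_ _ -> _ _] := chosenP val uA.
  by rewrite -(restrict_choice val uA) tuple_val_restrict.
have top_sum (F : N -> option K) :
    \big[omul times/Some (cm_one times)]_(u <- top_nodes) F u =
    \big[omul times/Some (cm_one times)]_(u in top) F u.
  have [us _] := s_ord; rewrite /top_nodes big_filter big_mkcond big_uniq //.
  by rewrite [RHS]big_mkcond; apply: eq_bigl => u; rewrite s_all.
rewrite -partial_val_tuples ?adom_choice // => [|c cA].
  split; first by rewrite top_sum; apply: eq_bigr => u uA; rewrite tv.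
  by apply: omul_big_isSome => u uA; rewrite tv //; have [] := chosenP val uA.
case cp: (par c) => [p|] // _; have pA := par_top cp cA.
have [_ _ _ _ /(_ p cp) eqp] := chosenP val cA.
have := val c cA; rewrite /options cp.
have [[f [pf _ fE]] _ _ _ _] := chosenP val pA; rewrite pf mem_rev => cs.
have -> : restrict (shared c) (choice_assignment t) = restrict (shared c) (read p f).
  by rewrite -fE -(restrict_choice val pA) restrict_restrict // (shared_par cp).
exact: message_isSome cs.
Qed.

(** At each node the image of its atom under [h] is chosen; [tuple_val_top] says that this fact is
    alive, hence among the options. *)
Lemma choice_onto h : partial_val top h ->
  exists2 t, valid t /\ (forall v, v \notin top -> t v = 0) & choice_assignment t = h.
Proof.
move=> ph; have hA : adom h = dom top.
  by apply: (@partial_val_adom _ _ _ _ _ T D nu s par n); case: (partial_val top h) ph.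
pose t : choice := [ffun u => if u \in top then index (apply_atom h (at_ u)) (node_facts u) else 0].
have tP u : u \in top -> exists f, [/\ onth (node_facts u) (t u) = Some f, fits u f,
    read u f = restrict (nvars u) h & ival u (t u)].
  move=> uA; have tu := tuple_val_top ph uA.
  have uh : nvars u \subset adom h by rewrite hA nvars_dom.
  have iN : init D nu u h <> None.
    by apply: (@tuple_val_init _ _ _ _ _ T D nu s par n) => //; case: (tuple_val u h) tu.
  have [fu ff fr] := init_node_facts uh iN; exists (apply_atom h (at_ u)).
  have ut : onth (node_facts u) (t u) = Some (apply_atom h (at_ u)).
    by rewrite ffunE uA onthE (nth_map (apply_atom h (at_ u))) ?index_mem ?nth_index.
  by rewrite /ival ut ff fr tuple_val_restrict.
have val : valid t.
  move=> u uA; have [f [uf ff fr iv]] := tP u uA.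
  have mem z : restrict (shared u) h = z -> t u \in rev (siblings u z).
    move=> hz; rewrite mem_rev mem_filter mem_iota /= add0n -onthTE iv /joins uf fr.
    by rewrite restrict_restrict ?shared_sub // hz eqxx.
  rewrite /options; case up: (par u) => [p|]; last first.
    by apply: mem; rewrite (shared_root up) restrict0.
  have [f' [pf' _ fr' _]] := tP p (par_top up uA); rewrite pf'; apply: mem.
  by rewrite fr' restrict_restrict ?(shared_par up).
exists t; first by split=> // v vA; rewrite ffunE (negPf vA).
apply/ffunP => x; rewrite ffunE; case: pickP => [u /andP[uA xu]|no].
  have [f [uf _ fr _]] := tP u uA.
  by rewrite /chosen uf fr ffunE xu.
apply/esym/eqP; suff : x \notin adom h by rewrite in_set negbK.
by rewrite hA; apply/bigcupP => -[u uA xu]; have := no u; rewrite uA xu.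
Qed.

(** The chosen fact is recovered by applying the atom to the assignment, and its rank because facts
    are listed without repetition. *)
Lemma choice_inj t1 t2 : valid t1 -> valid t2 ->
  (forall v, v \notin top -> t1 v = t2 v) ->
  choice_assignment t1 = choice_assignment t2 -> t1 = t2.
Proof.
move=> v1 v2 out eq12; apply/ffunP => u; have [uA|] := boolP (u \in top); last exact: out.
have [[f1 [uf1 /eqP ff1 r1]] _ _ _ _] := chosenP v1 uA.
have [[f2 [uf2 /eqP ff2 r2]] _ _ _ _] := chosenP v2 uA.
have f12 : f1 = f2.
  rewrite -ff1 -ff2 -[read_atom _ f1]/(read u f1) -[read_atom _ f2]/(read u f2).
  by rewrite -r1 -r2 -(restrict_choice v1 uA) -(restrict_choice v2 uA) eq12.
have uniq_f : uniq (node_facts u) by rewrite filter_uniq ?facts_uniq.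
have idx t f : onth (node_facts u) (t u) = Some f -> t u = index f (node_facts u).
  move=> tf; have tlt : t u < size (node_facts u) by rewrite -onthTE tf.
  by rewrite -(onth_nth f _ _ _ tf) index_uniq.
by rewrite (idx _ _ uf1) (idx _ _ uf2) f12.
Qed.

Definition all_choices : seq choice := choices top_nodes [ffun=> 0].

Lemma all_choicesP t : (t \in all_choices) <->
  valid t /\ (forall v, v \notin top -> t v = 0).
Proof.
rewrite mem_choices; last exact: top_parents_first.
split=> [[out ins]|[val out]]; split=> v; rewrite ?mem_top_nodes => vA.
- by apply: ins; rewrite mem_top_nodes.
- by rewrite out ?mem_top_nodes // ffunE.
- by rewrite out ?ffunE.
- exact: val.
Qed.

Definition answer_of t : option (answer V C K) :=
  omap (pair (choice_assignment t)) (partial_val top (choice_assignment t)).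

Definition all_answers : seq (answer V C K) := pmap answer_of all_choices.

Let all_answersE : all_answers =
  pmap (fun h => omap (pair h) (partial_val top h)) (map choice_assignment all_choices).
Proof. by rewrite /all_answers; elim: all_choices => //= t l ->. Qed.

Lemma all_answers_NoDup : List.NoDup all_answers.
Proof.
rewrite all_answersE; apply: NoDup_pmap; rewrite map_inj_in_uniq.
  by apply: uniq_choices; apply: top_parents_first.
move=> t1 t2 /all_choicesP[v1 o1] /all_choicesP[v2 o2]; apply: choice_inj => // v vA.
by rewrite o1 ?o2.
Qed.

Lemma all_answersP (p : answer V C K) : semiring_query g -> List.In p all_answers <-> sem g D nu p.
Proof.
move=> semi; rewrite all_answersE In_pmap; have [_ ->] := sem_represents g D nu.
rewrite (sem_val_partial D nu (thr := n) s_ord s_all s_root semi (leqnn n)).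
split=> [[]//|ph]; split=> //.
have [|t [val out] th] := @choice_onto p.1; first by rewrite ph.
by rewrite -th map_f //; apply/all_choicesP.
Qed.

End Choices.

(** * The enumeration program *)

Definition write_cells (l : seq (array * nat * nat)) : cmd :=
  foldr (fun c => Seq (Assign c.1.1 [:: Lit c.1.2] (Lit c.2))) Skip l.

Section Enumerator.
Context (S : schema) (V : finType) (C : eqType) (K : Type).
Context (g : query S V C K) (T : connex_join_tree g).
Context (s : seq (node T)) (par : node T -> option (node T)).
Local Notation N := (node T).
Local Notation at_ := (@jt_atom _ _ _ _ _ T).
Local Notation nvars := (@nvars _ _ _ _ _ T).
Local Notation n := (size (steps g)).
Local Notation top := (above T n).

(** The tree being fixed, a rooted order is hard-wired into the program as a table instead of being
    searched. *)
Definition order_cells : seq (array * nat * nat) :=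
  [seq (aOrd, index v s, code v) | v <- s] ++ [seq (aPar, code v, pcode par v) | v <- s].

Definition preprocess : cmd :=
  Seq (write_cells order_cells) (Seq phase1 (phase2 (Read ANumSteps [::]))).

Definition cur (u : N) : expr := Read aCur [:: Lit (code u)].

Definition head_of (u : N) : expr :=
  Read aHead [:: Lit (code u);
    if par u is Some p then Read aKey [:: Lit (code u); cur p] else Lit 0].

Definition next_of (u : N) : expr := Read aNext [:: Lit (code u); cur u].

Fixpoint reset (us : seq N) : cmd :=
  if us is u :: us' then Seq (Assign aCur [:: Lit (code u)] (head_of u)) (reset us')
  else Skip.

(* Moves the last node of [us] that is not at the end of its list. *)
Fixpoint advance (us : seq N) : cmd :=
  if us is u :: us' then
    Seq (advance us')
      (If (var xOk) Skip
        (If (IsBot (next_of u)) Skip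
          (Seq (Assign aCur [:: Lit (code u)] (next_of u))
          (Seq (reset us') (Assign (Work xOk) [::] (Lit 1))))))
  else Assign (Work xOk) [::] (Lit 0).

(** A single expression, whose size depends on the query only, so the product counts as one step. *)
Definition value_expr (us : seq N) : expr :=
  foldr (fun u => STimes (Read aW [:: Lit (code u); cur u])) SOne us.

Definition emit_var (x : V) : cmd :=
  if [pick u | (u \in top) && (x \in nvars u)] is Some u then
    Assign AOutVar [:: Lit (code x)]
      (Read AFact [:: Lit (code (at_ u).1); cur u; Lit (index (inl x) (at_ u).2)])
  else Skip.

Definition emit_vars (xs : seq V) : cmd := foldr (fun x => Seq (emit_var x)) Skip xs.

Definition emit (us : seq N) : cmd :=
  If (var xOk)
    (Seq (Assign AOutVal [::] (value_expr us))
    (Seq (emit_vars (enum (free_vars g))) (Assign AOutFlag [::] (Lit 1))))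
    (Assign AOutFlag [::] (Lit 0)).

(** Only the list at the root can be empty: below it every live fact has a match at each child. The
    test at [r] thus decides whether there is any answer. *)
Definition start (r : N) (us : seq N) : cmd :=
  Seq (Assign (Work xStart) [::] (Lit 0))
    (If (IsBot (head_of r)) (Assign (Work xOk) [::] (Lit 0))
       (Seq (reset us) (Assign (Work xOk) [::] (Lit 1)))).

Definition next_answer (r : N) (us : seq N) : cmd :=
  Seq (If (IsBot (var xStart)) (start r us) (advance us)) (emit us).

Context (D : database S C) (nu : fact S C -> K).
Local Notation times := (mul g).
Local Notation plus := (unzip1 (steps g)).
Local Notation memory := (Defs.mem C K).
Local Notation eval := (@eval C K times plus).
Local Notation wp := (@wp C K times plus).
Local Notation read := (@read _ _ _ _ _ T).
Local Notation fits := (@fits _ _ _ _ _ T).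
Local Notation node_facts := (@node_facts _ _ _ _ _ T D).
Local Notation level := (@level _ _ _ _ _ T).
Local Notation ival := (ival D nu s par n).
Local Notation siblings := (siblings D nu s par n).
Local Notation options := (options D nu s par).
Local Notation choices := (choices D nu s par).
Local Notation all_choices := (all_choices D nu s par).
Local Notation top_nodes := (top_nodes s).
Local Notation answer_of := (answer_of D nu s par).
Local Notation choice := {ffun N -> nat}.
Local Notation inp := (@inp _ _ _ _ _ T D nu).
Local Notation opt := (@opt C K).
Implicit Types (m : memory) (u v p : N) (us : seq N) (i : nat).

Hypothesis s_ord : parent_order (@edge V T) s par.
Hypothesis s_all : forall v, v \in s.
Hypothesis s_root : forall u v, par v = None -> level u <= level v.
Hypothesis top0 : top != set0.

Lemma write_cells_spec (l : seq (array * nat * nat)) m :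
  {in l &, forall c d, c.1 = d.1 -> c.2 = d.2} ->
  wp (write_cells l) m (fun t m' => [/\ t = size l,
    forall c, c \in l -> m' c.1.1 [:: inl c.1.2] = Num c.2 &
    forall a i, (a, i) \notin [seq c.1 | c <- l] -> m' a [:: inl i] = m a [:: inl i]]).
Proof.
elim: l m => [|c l IH] m con; first by apply: wp_skip.
apply: wp_seq; apply: (wp_assign1 (k1 := inl c.1.2)) => //.
set m1 := update _ _ _ _.
have con' : {in l &, forall c d, c.1 = d.1 -> c.2 = d.2}.
  by move=> a b al bl; apply: con; rewrite in_cons ?al ?bl orbT.
apply: wp_conseq (IH m1 con') _ => t m' _ [-> cells out]; split=> //.
  move=> d; rewrite in_cons => /orP[/eqP->|]; last exact: cells.
  have [/mapP[d' d'l cd]|cl] := boolP (c.1 \in [seq c.1 | c <- l]).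
    rewrite cd (cells d' d'l); congr Num; apply: con; rewrite ?mem_head //.
    by rewrite in_cons d'l orbT.
  by rewrite out -?surjective_pairing // /m1 update_same.
move=> a i; rewrite in_cons negb_or => /andP[ac al]; rewrite out // /m1 /update.
case: andP => // -[/eqP aE /eqP[iE]]; case/negP: ac.
by rewrite aE iE -surjective_pairing.
Qed.

Lemma order_cells_ok m : (forall c, c \in order_cells -> m c.1.1 [:: inl c.1.2] = Num c.2) ->
  order_ok s par m.
Proof.
move=> cells; have [us _] := s_ord; split=> [k v kv|v].
  have kE : index v s = k.
    by rewrite -(onth_nth v _ _ _ kv) index_uniq // -onthTE kv.
  rewrite -kE; apply: (cells (aOrd, index v s, code v)).
  by rewrite mem_cat map_f // s_all.
apply: (cells (aPar, code v, pcode par v)).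
by rewrite mem_cat [X in _ || X]map_f ?orbT // s_all.
Qed.

Lemma order_cells_consistent : {in order_cells &, forall c d, c.1 = d.1 -> c.2 = d.2}.
Proof.
move=> c d; rewrite !mem_cat => /orP[]/mapP[u _ ->] /orP[]/mapP[v _ ->] //= [].
  by move=> /(index_eq s_all)->.
by move=> /code_inj->.
Qed.

(** * The odometer on the memory left by the preprocessing *)

Definition volatile : seq array :=
  [:: aCur; Work xOk; Work xStart; AOutFlag; AOutVar; AOutVal].

Variable mp : memory.
Hypothesis mp_inp : inp mp.
Hypothesis mp_values : forall v i f, onth (node_facts v) i = Some f ->
  mp aW [:: inl (code v); inl i] = opt (ival v i).
Hypothesis mp_linked : forall v, linked D nu s par n mp v.

Lemma agree_step ws m m' : agree volatile mp m -> agree ws m m' ->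
  {subset ws <= volatile} -> agree volatile mp m'.
Proof. by move=> A B sub; apply: agree_trans A B. Qed.

Lemma ival_onth u i : ival u i -> exists f, onth (node_facts u) i = Some f.
Proof. by rewrite /ival; case: (onth _ _) => // f _; exists f. Qed.

Lemma head_chain m u (t : choice) : agree volatile mp m ->
  (forall p, par u = Some p -> m aCur [:: inl (code p)] = Num (t p) /\ ival p (t p)) ->
  chain mp u (eval m (head_of u)) (options u t).
Proof.
move=> A parent; have := mp_linked u; rewrite /linked /options /head_of.
case up: (par u) => [p|] link; last first.
  rewrite (eval_read2 _ (k1 := inl (code u)) (k2 := inl 0)) //.
  by rewrite (A aHead _ isT); have [] := link.
have [pE pv] := parent p up; have [f pf] := ival_onth pv; rewrite pf.
have [id [kE ch]] := link _ _ pf pv.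
rewrite (eval_read2 _ (k1 := inl (code u)) (k2 := inl id)) ?(A aHead _ isT) //.
rewrite (eval_read2 _ (k1 := inl (code u)) (k2 := inl (t p))) ?(A aKey _ isT) ?kE //.
by rewrite (eval_read1 _ (k1 := inl (code p))) // pE.
Qed.

Lemma options_ival u i (t : choice) : i \in options u t -> ival u i.
Proof.
rewrite /options; have sib z : i \in rev (siblings u z) -> ival u i.
  by rewrite mem_rev mem_filter => /andP[/andP[]].
case: (par u) => [p|]; last exact: sib.
by case: (onth _ _) => // f; apply: sib.
Qed.

(** There are no dead ends: a live fact has received a message from each child, and an empty list
    would give none. This is what makes the delay constant. *)
Lemma options_neq0 u p (t : choice) : par u = Some p -> ival p (t p) -> options u t <> [::].
Proof.
move=> up pv; have [f pf] := ival_onth pv; rewrite /options up pf => o0.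
have : message D nu s par n u (restrict (shared par u) (read p f)) <> None.
  apply: (tuple_val_message s_ord s_all up); move: pv; rewrite /ival pf.
  by case: (fits p f) => //; case: (tuple_val _ _ _ _ _ _ _).
by rewrite message_siblings -[siblings _ _]revK o0.
Qed.

Lemma chain_next m u w k1 i k2 : chain m u w (k1 ++ i :: k2) ->
  chain m u (m aNext [:: inl (code u); inl i]) k2.
Proof. by elim: k1 w => [|j k1 IH] w /= [_]; last exact: IH. Qed.

Definition shows m us (t : choice) : Prop :=
  forall u, u \in us -> m aCur [:: inl (code u)] = Num (t u).

Definition anchored m us (t : choice) : Prop := forall u p, u \in us -> par u = Some p ->
  p \notin us -> m aCur [:: inl (code p)] = Num (t p) /\ ival p (t p).

Lemma cur_update m u v w : u <> v ->
  update m aCur [:: inl (code u)] w aCur [:: inl (code v)] = m aCur [:: inl (code v)].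
Proof.
move=> uv; rewrite update_ks; case: eqP => // -[/code_inj vu].
by rewrite vu in uv.
Qed.

Lemma choices_off us t t1 v : parents_first par us -> t1 \in choices us t -> v \notin us ->
  t1 v = t v.
Proof. by move=> pf /(mem_choices _ _ _ _ _ pf)[out _]; apply: out. Qed.

Lemma anchored_choose m us u i (t : choice) : parents_first par (u :: us) ->
  anchored m (u :: us) t -> i \in options u t ->
  forall m', (forall v, v <> u -> m' aCur [:: inl (code v)] = m aCur [:: inl (code v)]) ->
  m' aCur [:: inl (code u)] = Num i ->
  anchored m' us (choose t u i).
Proof.
move=> _ anc iu m' same mu v p vus vp pus; rewrite ffunE; case: eqP => [->|pu].
  by split=> //; apply: options_ival iu.
rewrite same //; apply: anc vp _; rewrite in_cons ?vus ?orbT // negb_or pus andbT.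
by apply/eqP.
Qed.

(** Every list met is non-empty, by [options_neq0] below a parent and by assumption at a root, so
    taking heads throughout yields the first choice. *)
Lemma reset_spec us m (t : choice) : parents_first par us -> agree volatile mp m ->
  anchored m us t -> (forall u, u \in us -> par u = None -> options u t <> [::]) ->
  wp (reset us) m (fun tm m' => [/\ tm = size us,
    exists t' l, choices us t = t' :: l /\ shows m' us t' &
    forall v, v \notin us -> m' aCur [:: inl (code v)] = m aCur [:: inl (code v)]]).
Proof.
elim: us m t => [|u us IH] m t pf A anc roots.
  by apply: wp_skip; split=> //; exists t, [::].
have := pf; rewrite /= => /and3P[uus pu pfus].
have parent p : par u = Some p -> m aCur [:: inl (code p)] = Num (t p) /\ ival p (t p).
  by move=> up; apply: anc (up) _; rewrite ?mem_head //; move: pu; rewrite up.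
have : options u t <> [::].
  case up: (par u) => [p|]; last by apply: roots; rewrite ?mem_head.
  by have [_ pv] := parent p up; apply: options_neq0 up pv.
have := head_chain A parent; case uo: (options u t) => [|i l] // ch _.
have hE : eval m (head_of u) = Num i by have [] := ch.
apply: wp_seq; apply: (wp_assign1 (k1 := inl (code u))) => //; rewrite hE.
set m1 := update _ _ _ _.
have A1 : agree volatile mp m1.
  by apply: (agree_step (ws := [:: aCur])) A _ _; [apply: agree_update | move=> a; rewrite !inE => ->].
have m1u : m1 aCur [:: inl (code u)] = Num i by rewrite /m1 update_same.
have iu : i \in options u t by rewrite uo mem_head.
have m1v v : v <> u -> m1 aCur [:: inl (code v)] = m aCur [:: inl (code v)].
  by move=> vu; rewrite /m1 cur_update // => /esym.
have anc1 := anchored_choose pf anc iu m1v m1u.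
apply: wp_conseq (IH m1 (choose t u i) pfus A1 anc1 _) _.
  move=> v vus vn; rewrite (@eq_options _ _ _ _ _ _ _ _ _ _ _ _ t) => [|p]; last by rewrite vn.
  by apply: roots; rewrite // in_cons vus orbT.
move=> tm m2 _ [-> [t' [l' [ch' sh]]] out]; split=> //.
  exists t', (l' ++ flatten [seq choices us (choose t u j) | j <- l]).
  rewrite /= ch'; split=> // v; rewrite in_cons => /orP[/eqP->|]; last exact: sh.
  rewrite out // m1u (choices_off pfus _ uus (t1 := t') (t := choose t u i)) ?ch' ?mem_head //.
  by rewrite ffunE eqxx.
move=> v; rewrite in_cons negb_or => /andP[/eqP vu vus].
by rewrite out // m1v.
Qed.

(** A crude bound, which charges a reset at every node although at most one happens; it only depends
    on the tree. *)
Fixpoint advance_cost (k : nat) : nat :=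
  if k is k'.+1 then advance_cost k' + k' + 5 else 1.

Lemma cat_eq_cat (B : Type) (a b l1 : seq B) x l2 : a ++ b = l1 ++ x :: l2 ->
  (exists2 a2, a = l1 ++ x :: a2 & l2 = a2 ++ b) \/
  (exists2 b1, l1 = a ++ b1 & b = b1 ++ x :: l2).
Proof.
elim: a l1 => [|y a IH] [|z l1] /=.
- by move=> ->; right; exists [::].
- by move=> ->; right; exists (z :: l1).
- by case=> -> <-; left; exists a.
- by case=> -> /IH[[a2 -> ->]|[b1 -> ->]]; [left; exists a2 | right; exists b1].
Qed.

(** Locates the current choice inside the block given by the option taken at the first node. *)
Lemma flatten_split (A B : Type) (F : A -> seq B) (l : seq A) l1 x l2 :
  flatten [seq F a | a <- l] = l1 ++ x :: l2 ->
  exists k1 a k2 a1 a2, [/\ l = k1 ++ a :: k2, F a = a1 ++ x :: a2 &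
    l2 = a2 ++ flatten [seq F a | a <- k2]].
Proof.
elim: l l1 => [|a l IH] l1 /=; first by case: l1.
move=> e; have [[a2 fa ->]|[b1 _ e']] := cat_eq_cat e.
  by exists [::], a, l, l1, a2.
have [k1 [a' [k2 [a1 [a2 [-> fa ->]]]]]] := IH _ e'.
by exists (a :: k1), a', k2, a1, a2.
Qed.

Lemma reset_writes us : all (fun a => a \in volatile) (writes (reset us)).
Proof. by elim: us. Qed.

Lemma advance_writes us : all (fun a => a \in volatile) (writes (advance us)).
Proof. by elim: us => //= u us IH; rewrite !all_cat IH /= all_cat reset_writes. Qed.

Lemma advance_keeps_start us : all (fun a => a != Work xStart) (writes (advance us)).
Proof.
elim: us => //= u us IH; rewrite !all_cat IH /= all_cat andbT /=.
by elim: us {IH}.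
Qed.

(** If the block of [t1] continues, the recursive call has moved within it. Otherwise memory still
    shows [t1], and the next option at [u], if any, opens a block whose first element is what
    [reset] installs. Resets only concern tails, which contain no root. *)
Lemma advance_spec us m (t : choice) l1 t1 l2 : parents_first par us ->
  agree volatile mp m -> anchored m us t ->
  (forall u, u \in behead us -> par u <> None) ->
  choices us t = l1 ++ t1 :: l2 -> shows m us t1 ->
  wp (advance us) m (fun tm m' => [/\ tm <= advance_cost (size us),
    forall v, v \notin us -> m' aCur [:: inl (code v)] = m aCur [:: inl (code v)] &
    if l2 is t2 :: _ then m' (Work xOk) [::] = Num 1 /\ shows m' us t2
    else m' (Work xOk) [::] = Num 0 /\ shows m' us t1]).
Proof.
elim: us m t l1 t1 l2 => [|u us IH] m t l1 t1 l2 pf A anc noroot.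
  rewrite /=; case: l1 => [|a [|b l1]] // [<- <-] _; apply: wp_assign0.
  by split=> //; split=> //; rewrite update_same.
have := pf; rewrite [parents_first _ _]/= => /and3P[uus pu pfus].
have noroot' v : v \in behead us -> par v <> None.
  by move=> vus; apply: noroot; case: (us) vus => // w l vl; rewrite /= in_cons vl orbT.
have parent p : par u = Some p -> m aCur [:: inl (code p)] = Num (t p) /\ ival p (t p).
  by move=> up; apply: anc (up) _; rewrite ?mem_head //; move: pu; rewrite up.
rewrite [choices _ _]/= => e sh.
have [k1 [i [k2 [a1 [a2 [uo ci l2E]]]]]] := flatten_split e.
have ch := head_chain A parent; rewrite uo in ch; have {}ch := chain_next ch.
have t1c : t1 \in choices us (choose t u i) by rewrite ci mem_cat mem_head orbT.
have t1u : t1 u = i by rewrite (choices_off pfus t1c uus) ffunE eqxx.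
have mu : m aCur [:: inl (code u)] = Num i by rewrite sh ?mem_head // t1u.
have iu : i \in options u t by rewrite uo mem_cat mem_head orbT.
have anc1 := anchored_choose pf anc iu (fun v _ => erefl _) mu.
have sh1 : shows m us t1 by move=> v vus; apply: sh; rewrite in_cons vus orbT.
apply: wp_seq; apply: wp_conseq (IH m _ a1 t1 a2 pfus A anc1 noroot' ci sh1) _.
move=> tm m1 A1' [tm_le out1 step].
have A1 : agree volatile mp m1.
  by apply: agree_step A A1' (allP (advance_writes us)).
have m1u : m1 aCur [:: inl (code u)] = Num i by rewrite out1.
case: a2 ci l2E step => [|t2 a2] ci l2E [ok sh2]; last first.
  apply: wp_if; rewrite /holds [eval _ _]ok /=; apply: wp_skip; split.
  - by move: tm_le; clear; rewrite /=; lia.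
  - by move=> v; rewrite in_cons negb_or => /andP[_ vus]; rewrite out1.
  rewrite l2E /=; split=> // v; rewrite in_cons => /orP[/eqP->|]; last exact: sh2.
  have t2c : t2 \in choices us (choose t u i) by rewrite ci mem_cat !in_cons eqxx !orbT.
  by rewrite m1u (choices_off pfus t2c uus) ffunE eqxx.
apply: wp_if; rewrite /holds [eval _ _]ok /=; apply: wp_if; rewrite holds_IsBot.
have nextE : eval m1 (next_of u) = mp aNext [:: inl (code u); inl i].
  rewrite (eval_read2 _ (k1 := inl (code u)) (k2 := inl i)) ?(A1 aNext _ isT) //.
  by rewrite (eval_read1 _ (k1 := inl (code u))) // m1u.
rewrite nextE l2E; case: k2 uo ch {l2E} => [|i2 k2] uo ch.
  rewrite [mp _ _]ch /=; apply: wp_skip; split.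
  - by move: tm_le; clear; rewrite /=; lia.
  - by move=> v; rewrite in_cons negb_or => /andP[_ vus]; rewrite out1.
  split=> // v; rewrite in_cons => /orP[/eqP->|]; last exact: sh2.
  by rewrite m1u t1u.
have [nE _] := ch; rewrite nE /=.
apply: wp_seq; apply: (wp_assign1 (k1 := inl (code u))) => //; rewrite nextE nE.
set m2 := update _ _ _ _.
have A2 : agree volatile mp m2.
  by apply: (agree_step (ws := [:: aCur])) A1 _ _; [apply: agree_update | move=> a; rewrite !inE => ->].
have m2u : m2 aCur [:: inl (code u)] = Num i2 by rewrite /m2 update_same.
have i2u : i2 \in options u t by rewrite uo mem_cat !in_cons eqxx !orbT.
have m2v v : v <> u -> m2 aCur [:: inl (code v)] = m1 aCur [:: inl (code v)].
  by move=> vu; rewrite /m2 cur_update // => /esym.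
have ancm1 : anchored m1 (u :: us) t.
  move=> v p vus vp pus; have [? ?] := anc v p vus vp pus; split=> //; rewrite out1 //.
  by move: pus; rewrite in_cons negb_or => /andP[].
have anc2 := anchored_choose pf ancm1 i2u m2v m2u.
apply: wp_seq; apply: wp_conseq (reset_spec pfus A2 anc2 _) _.
  by move=> v vus vn; case: (noroot v).
move=> tm3 m3 _ [-> [t' [l' [ch' sh']]] out3]; apply: wp_assign0; split.
- by move: tm_le; clear; rewrite /=; lia.
- move=> v; rewrite in_cons negb_or => /andP[/eqP vu vus].
  by rewrite update_array // out3 // m2v // out1.
rewrite /= ch' /=; split; first by rewrite update_same.
move=> v; rewrite update_array // in_cons => /orP[/eqP->|]; last exact: sh'.
have t'c : t' \in choices us (choose t u i2) by rewrite ch' mem_head.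
by rewrite out3 // m2u (choices_off pfus t'c uus) ffunE eqxx.
Qed.

Lemma value_expr_spec us m (t : choice) : agree volatile mp m -> shows m us t ->
  (forall u, u \in us -> ival u (t u)) ->
  eval m (value_expr us) =
    opt (\big[omul times/Some (cm_one times)]_(u <- us) ival u (t u)).
Proof.
move=> A; elim: us => [|u us IH] sh iv; first by rewrite big_nil.
have tail : eval m (value_expr us) =
    opt (\big[omul times/Some (cm_one times)]_(u <- us) ival u (t u)).
  by apply: IH => v vus; [apply: sh | apply: iv]; rewrite in_cons vus orbT.
have uv := iv u (mem_head _ _); have [f uf] := ival_onth uv.
have hd : eval m (Read aW [:: Lit (code u); cur u]) = opt (ival u (t u)).
  rewrite (eval_read2 _ (k1 := inl (code u)) (k2 := inl (t u))) //.
    by rewrite (A aW _ isT) (mp_values uf).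
  by rewrite (eval_read1 _ (k1 := inl (code u))) // sh ?mem_head.
rewrite big_cons; move: hd tail; case: (ival u (t u)) uv => // a _.
have : isSome (\big[omul times/Some (cm_one times)]_(v <- us) ival v (t v)).
  rewrite big_seq; apply: omul_big_isSome => v vus; apply: iv.
  by rewrite in_cons vus orbT.
case: (\big[_/_]_(v <- us) _) => // b _ hd tail.
exact: eval_stimes hd tail.
Qed.

Lemma emit_vars_spec xs m (t : choice) : agree volatile mp m -> shows m top_nodes t ->
  valid D nu s par t -> {subset xs <= dom top} ->
  wp (emit_vars xs) m (fun tm m' => [/\ tm = size xs,
    agree [:: AOutVar] m m',
    forall x, x \in xs -> m' AOutVar [:: inl (code x)] =
       cell Cst (choice_assignment D t x) &
    forall x, x \notin xs -> m' AOutVar [:: inl (code x)] = m AOutVar [:: inl (code x)]]).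
Proof.
move=> A sh val; elim: xs m A sh => [|x xs IH] m A sh sub; first by apply: wp_skip.
have xtop : x \in dom top by apply: sub; rewrite mem_head.
apply: wp_seq; rewrite /emit_var.
have : choice_assignment D t x = if [pick u | (u \in top) && (x \in nvars u)] is Some u
    then chosen D t u x else None by rewrite ffunE.
case: pickP => [u /andP[uA xu]|no]; last first.
  by case/bigcupP: xtop => u uA xu; have := no u; rewrite uA xu.
have [[f [uf _ ->]] _ _ _ _] := chosenP val uA.
rewrite [RHS]ffunE [x \in avars _]xu => xE.
have curE : eval m (cur u) = Num (t u).
  by rewrite (eval_read1 _ (k1 := inl (code u))) // sh // mem_top_nodes.
have rE : eval m (Read AFact [:: Lit (code (at_ u).1); cur u; Lit (index (inl x) (at_ u).2)]) =
    cell Cst (choice_assignment D t x).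
  rewrite (eval_read3 _ (k1 := inl (code (at_ u).1)) (k2 := inl (t u))
    (k3 := inl (index (inl x) (at_ u).2))) ?curE //.
  by rewrite (A AFact _ isT) mp_inp //= onth_code [obind _ _]/= -/(node_facts u) uf /= xE.
apply: (wp_assign1 (k1 := inl (code x))) => //; rewrite rE; set m1 := update _ _ _ _.
have A01 : agree [:: AOutVar] m m1 by apply: agree_update.
have A1 : agree volatile mp m1.
  by apply: (agree_step A A01) => a; rewrite inE => /eqP->.
apply: wp_conseq (IH m1 A1 _ _) _.
- by move=> v vus; rewrite (A01 aCur _ isT) sh.
- by move=> y yxs; apply: sub; rewrite in_cons yxs orbT.
have m1x y : y != x -> m1 AOutVar [:: inl (code y)] = m AOutVar [:: inl (code y)].
  move=> yx; rewrite /m1 update_ks; case: eqP => // -[/code_inj yE].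
  by rewrite yE eqxx in yx.
move=> tm m2 _ [-> A12 vis out]; split=> //.
- by apply: agree_trans A01 A12.
- move=> y; rewrite in_cons; have [yxs _|yxs] := boolP (y \in xs); first exact: vis.
  by rewrite orbF => /eqP yE; rewrite out // /m1 yE update_same.
- by move=> y; rewrite in_cons negb_or => /andP[yx yxs]; rewrite out // m1x.
Qed.

Lemma emit_some m t : agree volatile mp m -> shows m top_nodes t -> t \in all_choices ->
  m (Work xOk) [::] = Num 1 ->
  exists p : answer V C K, answer_of t = Some p /\
  wp (emit top_nodes) m (fun tm m' => [/\ tm <= #|V| + 3, shows_answer g m' p &
    agree [:: AOutFlag; AOutVar; AOutVal] m m']).
Proof.
move=> A sh /(all_choicesP D nu s_ord s_all)[val _] ok.
have [valE valS] := choice_val s_ord s_all s_root top0 val.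
rewrite /answer_of; case pv: (partial_val _ _ _ _ _ _ _) valE valS => [k|] // valE _.
exists (choice_assignment D t, k); split=> //.
apply: wp_if; rewrite /holds [eval _ _]ok /=; apply: wp_seq; apply: wp_assign0.
have -> : eval m (value_expr top_nodes) = Val k.
  rewrite (value_expr_spec A sh) -?valE // => u; rewrite mem_top_nodes // => uA.
  by have [] := chosenP val uA.
set m1 := update _ _ _ _.
have A01 : agree [:: AOutVal] m m1 by apply: agree_update.
have A1 : agree volatile mp m1.
  by apply: (agree_step A A01) => a; rewrite inE => /eqP->.
apply: wp_seq; apply: wp_conseq (@emit_vars_spec (enum (free_vars g)) m1 t A1 _ val _) _.
- by move=> v vus; rewrite (A01 aCur _ isT) sh.
- by move=> x; rewrite mem_enum dom_free.
move=> tm m2 _ [-> A12 vis _]; apply: wp_assign0; set m3 := update m2 _ _ _.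
split=> //.
- have sz : size (enum (free_vars g)) <= #|V| by rewrite -cardE max_card.
  by rewrite addn1 add1n -addn3 leq_add2r; apply: sz.
- split.
  + by rewrite /m3 update_same.
  + by rewrite /m3 update_array // (A12 AOutVal _ isT) /m1 update_same.
  + by move=> x xf; rewrite /m3 update_array // vis // mem_enum.
- move=> a ks; rewrite !inE !negb_or => /and3P[a1 a2 a3].
  by rewrite /m3 update_array // A12 ?inE // A01 // inE.
Qed.

Lemma emit_none m : m (Work xOk) [::] = Num 0 ->
  wp (emit top_nodes) m (fun tm m' => tm <= 2 /\ shows_none m').
Proof.
by move=> ok; apply: wp_if; rewrite /holds [eval _ _]ok /=; apply: wp_assign0.
Qed.

Context (r : N).
Hypothesis root_r : par r = None.

Definition delay : nat := advance_cost (size top_nodes) + size top_nodes + #|V| + 10.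

Lemma top_nodesE : exists2 l, top_nodes = r :: l & r \notin l.
Proof.
have [r0 r0A] := set0Pn _ top0; have [us _] := s_ord.
have rA : r \in top.
  exact: (root_in s_ord s_all (above_up_closed s_ord s_all s_root (L := n)) r0A root_r).
have := par_none s_ord s_all root_r; have := mem_top_nodes s_all r.
have : uniq top_nodes by rewrite filter_uniq.
rewrite /top_nodes; case: (s) => [|r' s'] /=; first by rewrite rA.
case: eqP => // -> + _ _; rewrite rA /= => /andP[rl _].
by exists [seq u <- s' | u \in top].
Qed.

Lemma root_unique u : par u = None -> u = r.
Proof.
move=> un; apply: (index_eq s_all).
by rewrite (par_none s_ord s_all un) (par_none s_ord s_all root_r).
Qed.

Lemma top_rootless u : u \in behead top_nodes -> par u <> None.
Proof.
have [l -> rl] := top_nodesE; move=> /= ul /root_unique ur.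
by rewrite -ur ul in rl.
Qed.

Lemma top_anchored m (t : choice) : anchored m top_nodes t.
Proof.
move=> u p; rewrite !(mem_top_nodes s_all) => uA up.
by rewrite (par_top s_ord s_all s_root up uA).
Qed.

Definition running m (t : choice) : Prop :=
  [/\ agree volatile mp m, m (Work xStart) [::] = Num 0 & shows m top_nodes t].

Definition produced m (l : seq choice) : Prop :=
  if l is t :: _ then exists p : answer V C K,
    [/\ answer_of t = Some p, shows_answer g m p & running m t]
  else shows_none m.

Lemma emit_produced m l : agree volatile mp m -> m (Work xStart) [::] = Num 0 ->
  {subset l <= all_choices} ->
  (if l is t :: _ then m (Work xOk) [::] = Num 1 /\ shows m top_nodes t
   else m (Work xOk) [::] = Num 0) ->
  wp (emit top_nodes) m (fun tm m' => tm <= #|V| + 3 /\ produced m' l).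
Proof.
move=> A st; case: l => [|t l] sub.
  by move=> ok; apply: wp_conseq (emit_none ok) _ => tm m' _ [? ?]; split=> //; lia.
move=> [ok sh]; have [p [pE run]] := emit_some A sh (sub t (mem_head _ _)) ok.
apply: wp_conseq run _ => tm m' _ [tmE ans A']; split=> //; exists p; split=> //; split.
- by apply: (agree_step A A') => a; rewrite !inE => /or3P[] /eqP->.
- by rewrite (A' (Work xStart) _ isT).
- by move=> u us; rewrite (A' aCur _ isT) sh.
Qed.

Lemma next_first m : agree volatile mp m -> m (Work xStart) [::] = Bot ->
  wp (next_answer r top_nodes) m (fun tm m' => tm <= delay /\ produced m' all_choices).
Proof.
move=> A st; apply: wp_seq; apply: wp_if; rewrite holds_IsBot [eval _ _]st /=.
apply: wp_seq; apply: wp_assign0; rewrite [eval _ _]/=; set m1 := update _ _ _ _.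
have A1 : agree volatile mp m1.
  by apply: (agree_step (ws := [:: Work xStart]) A); [apply: agree_update | move=> a; rewrite inE => /eqP->].
have st1 : m1 (Work xStart) [::] = Num 0 by rewrite /m1 update_same.
pose t0 : choice := [ffun=> 0].
have no_par p : par r = Some p -> m1 aCur [:: inl (code p)] = Num (t0 p) /\ ival p (t0 p).
  by rewrite root_r.
have pf := top_parents_first s_ord s_all (T := T).
apply: wp_if; rewrite holds_IsBot.
case ro: (options r t0) (@head_chain m1 r t0 A1 no_par) => [|i o] ch.
  rewrite [eval _ _]ch /=; apply: wp_assign0; set m2 := update _ _ _ _.
  have A2 : agree volatile mp m2.
    by apply: (agree_step (ws := [:: Work xOk]) A1); [apply: agree_update | move=> a; rewrite inE => /eqP->].
  have none_left : all_choices = [::].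
    by rewrite /all_choices; have [l -> _] := top_nodesE; rewrite /= -/t0 ro.
  rewrite none_left; apply: wp_conseq (@emit_produced m2 [::] A2 _ _ _) _ => //.
  by move=> tm m' _ [? ?]; split=> //; rewrite /delay; lia.
have [hE _] := ch; rewrite hE /=.
apply: wp_seq; apply: wp_conseq (@reset_spec top_nodes m1 t0 pf A1 (@top_anchored m1 t0) _) _.
  by move=> u _ /root_unique->; rewrite ro.
move=> tm2 m2 B2 [-> [t [l [chE sh]]] _]; apply: wp_assign0; set m3 := update _ _ _ _.
have A2 : agree volatile mp m2 := agree_step A1 B2 (allP (reset_writes _)).
have A3 : agree volatile mp m3.
  by apply: (agree_step (ws := [:: Work xOk]) A2); [apply: agree_update | move=> a; rewrite inE => /eqP->].
have acE : all_choices = t :: l by [].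
have st2 : m2 (Work xStart) [::] = Num 0.
  by rewrite B2 ?st1 //; apply/negP; elim: (top_nodes).
rewrite acE; apply: wp_conseq (@emit_produced m3 (t :: l) A3 _ _ _) _.
- by rewrite /m3 update_array.
- by rewrite acE.
- by split; [rewrite /m3 update_same | move=> u us; rewrite /m3 update_array // sh].
- by move=> tm m' _ [? ?]; split=> //; rewrite /delay; lia.
Qed.

Lemma next_step m l1 t l2 : running m t -> all_choices = l1 ++ t :: l2 ->
  wp (next_answer r top_nodes) m (fun tm m' => tm <= delay /\ produced m' l2).
Proof.
move=> [A st sh] acE; apply: wp_seq; apply: wp_if; rewrite holds_IsBot [eval _ _]st /=.
have pf := top_parents_first s_ord s_all (T := T).
apply: wp_conseq (advance_spec pf A (@top_anchored m [ffun=> 0]) top_rootless acE sh) _.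
move=> tm1 m1 B1 [tm1E _ res].
have A1 : agree volatile mp m1 := agree_step A B1 (allP (advance_writes _)).
have st1 : m1 (Work xStart) [::] = Num 0.
  by rewrite B1 ?st //; apply/negP => /(allP (advance_keeps_start _)).
apply: wp_conseq (@emit_produced m1 l2 A1 st1 _ _) _.
- by move=> t'; rewrite acE mem_cat in_cons => ->; rewrite !orbT.
- by case: l2 res {acE} => [[]|].
- by move=> tm m' _ [? ?]; split=> //; rewrite /delay; lia.
Qed.

Lemma enumerates_rest m l1 t l2 : running m t -> all_choices = l1 ++ t :: l2 ->
  enumerates g (next_answer r top_nodes) delay m (pmap answer_of l2).
Proof.
elim: l2 m l1 t => [|t2 l2 IH] m l1 t run acE.
  by have [tm [m' [ex [tmE none]]]] := next_step run acE; exists tm, m'.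
have [tm [m' [ex [tmE [p [pE ans run']]]]]] := next_step run acE.
rewrite /= pE /=; exists tm, m'; split=> //; split=> //.
by apply: (IH m' (l1 ++ [:: t]) t2 run'); rewrite -catA.
Qed.

Lemma enumerates_all : mp (Work xStart) [::] = Bot ->
  enumerates g (next_answer r top_nodes) delay mp (all_answers D nu s par).
Proof.
move=> st; have A0 : agree volatile mp mp by [].
have [tm [m' [ex [tmE pr]]]] := next_first A0 st.
rewrite /all_answers; case acE: all_choices pr => [|t l] pr.
  by exists tm, m'.
have [p [pE ans run]] := pr.
rewrite /= pE /=; exists tm, m'; split=> //; split=> //.
exact: (@enumerates_rest m' [::] t l).
Qed.

End Enumerator.

(** * The first claim in the presence of free variables *)

Section OpenCase.
Context (S : schema) (V : finType) (C : eqType) (K : Type).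
Context (g : query S V C K) (T : connex_join_tree g).
Local Notation N := (node T).
Local Notation at_ := (@jt_atom _ _ _ _ _ T).

Lemma write_cells_writes l a : a \in writes (write_cells l) -> exists2 c, c \in l & a = c.1.1.
Proof.
elim: l => //= c l IH; rewrite in_cons => /orP[/eqP->|/IH[d dl ->]].
  by exists c; rewrite ?mem_head.
by exists d; rewrite // in_cons dl orbT.
Qed.

Lemma rooted_order : exists s par r, [/\ parent_order (@edge V T) s par,
  forall v, v \in s, par r = None & forall u v : N, par v = None -> level u <= level v].
Proof.
have [N0 _ _ _ _] := jtree T; have [v0 _] := code_onto N0.
have [r _ rmax] := @arg_maxnP N v0 predT (@level _ _ _ _ _ T) isT.
have [s [par [po all_s r0]]] := parent_order_exists (jtree T) r.
exists s, par, r; split=> // [|u v vn]; last first.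
  suff -> : v = r by apply: rmax.
  by apply: (index_eq all_s); rewrite (par_none po all_s vn).
by case rp: (par r) => [p|] //; have := par_lt po all_s rp; rewrite r0.
Qed.

Lemma enumeration_open : semiring_query g -> free_vars g != set0 ->
  constant_delay_after_linear_preprocessing T.
Proof.
move=> semi free0; have [s [par [r [po all_s rn rmax]]]] := rooted_order.
have top0 : above T (size (steps g)) != set0.
  apply: contra free0 => /eqP e; apply/eqP.
  rewrite -(dom_free T) e /dom; apply/setP => x; rewrite in_set0.
  by apply/bigcupP => -[u]; rewrite in_set0.
(* 54 is twice 6 + 21, because [1 + (d + 1)] is at most [2 * (d + 1)]; each order cell costs one
   step, and 4 collects the additive constants of the two phases. *)
exists (preprocess s par), (next_answer par r (top_nodes s)),
  (54 * width_sum T + size (order_cells s par) + 4), (delay s) => D nu.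
pose m0 := init_mem T D nu.
have im0 : inp T D nu m0 by [].
have [t1 [m1 [ex1 [t1E cells _]]]] :=
  write_cells_spec g m0 (@order_cells_consistent _ _ _ _ _ T s par all_s).
have A1 : agree [:: aOrd; aPar] m0 m1.
  move=> a ks aN; apply: (exec_agree ex1); apply: contra aN => /write_cells_writes[c cl ->].
  by move: cl; rewrite mem_cat => /orP[] /mapP[v _ ->]; rewrite !inE.
have im1 : inp T D nu m1 := inp_agree im0 A1 isT.
have oo1 := order_cells_ok po all_s cells.
have [|t2 [m2 [ex2 [t2E pos2 bl2 facts2]]]] := phase1_spec im1.
  by move=> j ks _; rewrite (A1 aPos _ isT).
have A2 := exec_agree ex2.
have im2 : inp T D nu m2 := inp_agree im1 A2 isT.
have oo2 : order_ok s par m2.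
  have [ord opar] := oo1; split=> [k v sv|v]; first by rewrite (A2 aOrd _ isT) (ord k v sv).
  by rewrite (A2 aPar _ isT) opar.
have [|||t3 [m3 [ex3 [t3E values links]]]] :=
  phase2_spec po all_s (@eval_num_steps _ _ _ _ _ T D nu) im2 (conj pos2 bl2) oo2 _ _ _ facts2.
- by move=> v ks; rewrite (A2 aTrie _ isT) (A1 aTrie _ isT).
- by move=> v ks; rewrite (A2 aAgg _ isT) (A1 aAgg _ isT).
- by move=> v ks; rewrite (A2 aHead _ isT) (A1 aHead _ isT).
have A3 := exec_agree ex3.
have im3 : inp T D nu m3 := inp_agree im2 A3 isT.
have start3 : m3 (Work xStart) [::] = Bot.
  by rewrite (A3 (Work xStart) _ isT) (A2 (Work xStart) _ isT) (A1 (Work xStart) _ isT).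
exists (t1 + (t2 + t3)), m3, (all_answers D nu s par); split.
- by apply: ExecSeq ex1 (ExecSeq ex2 ex3).
- have facts_le (v : N) : size (node_facts D v) <= db_size D + 1 := facts_of_le_size D _.
  have := cost1_le facts_le; have := cost2_le par facts_le.
  move: t2E t3E; rewrite t1E; move: (\sum_v cost1 D v) (\sum_v (cost2 D par v + 3)).
  move: (width_sum T) (size (order_cells s par)) (db_size D) => w k d c1 c2 t2E t3E c1E c2E.
  have wd : w * (1 + (d + 1)) <= 2 * (w * (d + 1)).
    by rewrite mulnCA leq_mul2l; apply/orP; right; lia.
  have kd : k <= k * (d + 1) by rewrite leq_pmulr // addn1.
  have -> : (54 * w + k + 4) * (d + 1) = 54 * (w * (d + 1)) + k * (d + 1) + 4 * (d + 1) by lia.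
  move: (w * (1 + (d + 1))) (w * (d + 1)) (k * (d + 1)) wd kd c1E c2E; lia.
- exact: (all_answers_NoDup D nu po all_s rmax).
- move=> p; exact: (all_answersP D nu po all_s rmax).
- exact: (enumerates_all po all_s rmax top0 im3 values links rn start3).
Qed.

End OpenCase.

Theorem lemma6p2 :
  (forall (S : schema) (V : finType) (C : eqType) (K : Type)
          (g : query S V C K) (T : connex_join_tree g),
     semiring_query g ->
     constant_delay_after_linear_preprocessing T)
  /\
  (exists (p : cmd) (c : nat),
   forall (S : schema) (V : finType) (C : eqType) (K : Type)
          (g : query S V C K) (T : connex_join_tree g)
          (D : database S C) (nu : fact S C -> K),
     (forall a, a \in atoms g -> 0 < arity a.1) ->
     semiring_query g ->
     free_vars g = set0 ->
     exists t : nat,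
       t <= c * (query_size g * db_norm D + 1) /\
       obtains_result p T D nu t).
Proof.
split=> [S V C K g T semi|].
  (* The odometer starts at the root of the last witness subtree, which is surely non-empty only
     when there are free variables. *)
  have [free0|free0] := eqVneq (free_vars g) set0; first exact: enumeration_closed.
  exact: enumeration_open.
exists eval_query, 280 => S V C K g T D nu; exact: eval_query_result.
Qed.
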